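(* Let $k$ be a field of characteristic zero and let $d,e\ge 0$ be integers. The point of $\mathrm{Corr}_{d,e}$ which represents a correspondence $C$ of degree $(d,e)$ is a stable point (resp. a semistable point) if and only if $C$ has no point of multiplicity $\ge \frac{d+e}{2}$ (resp. no point of multiplicity $>\frac{d+e}{2}$) on the diagonal of $\mathbb{P}^1\times\mathbb{P}^1$.
   Context: $V_{d,e}$ denotes the $k$-vector space of forms $f=\sum_{0\le i\le d,\,0\le j\le e}a_{ij}x_0^{d-i}x_1^{i}y_0^{e-j}y_1^{j}$, i.e. the global sections of $\mathcal{O}(d,e)$ on $\mathbb{P}^1\times\mathbb{P}^1$. A (divisorial) correspondence of degree $(d,e)$ is a closed subscheme $C=V(f)\subset\mathbb{P}^1\times\mathbb{P}^1$ with $f\ne 0$ such a form, and $\mathrm{Corr}_{d,e}\cong\mathbb{P}(V_{d,e})\cong\mathbb{P}^{(d+1)(e+1)-1}$ is the moduli space of these correspondences. Points (of $\mathrm{Corr}_{d,e}$ and of $C$) are geometric points. The multiplicity of $C$ at a point $P$ is the largest $m\ge 0$ such that a local equation of $C$ at $P$ lies in $\mathfrak{m}_P^m$. The group $\mathrm{PGL}_2=\mathrm{Aut}(\mathbb{P}^1)$, and hence $\mathrm{SL}_2$, acts on $\mathrm{Corr}_{d,e}$ through the diagonal action on $\mathbb{P}^1\times\mathbb{P}^1$ (equivalently, by conjugation of correspondences). The $\mathrm{SL}_2$-action comes from the linear action on $V_{d,e}$ by the same linear substitution in $(x_0,x_1)$ and $(y_0,y_1)$, which gives an $\mathrm{SL}_2$-linearization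 of $\mathcal{L}=\mathcal{O}(1)$. Stability is in the sense of geometric invariant theory for this action and linearization, with the following definitions, where $X=\mathrm{Corr}_{d,e}$ and $G=\mathrm{SL}_2$. A geometric point $P$ of $X$ is pre-stable if its stabilizer group is finite and $P$ has a $G$-stable affine open neighborhood. It is semistable if there exist $n$ and $s\in H^0(X,\mathcal{L}^n)^{G}$ such that $s(P)\neq0$ and $X_s=\{s\ne0\}$ is affine. It is stable if it is semistable and pre-stable.
   Formalization: Pre-stability additionally requires SL_2-orbits of geometric points to be closed in the G-stable affine open neighborhood (as in Mumford); without this, x_0^2 x_1(x_0-x_1) in degree (4,0) would be stable despite having a diagonal point of multiplicity 2=(d+e)/2. *)

(* Defs.v *)
From HB Require Import structures.
From mathcomp Require Import all_boot all_order all_algebra.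
From mathcomp Require Import mpoly.
Set Implicit Arguments.
Unset Strict Implicit.
Unset Printing Implicit Defensive.
Import GRing.Theory.
Local Open Scope ring_scope.

(* An element of V_{d,e}(R) is encoded by its coefficient matrix (a_ij).  In
   {mpoly R[2 + 2]} the variables x_i, y_j have indices lshift 2 i, rshift 2 j. *)
Definition xy_tuple (S : Type) (x y : 'I_2 -> S) : (2 + 2).-tuple S :=
  cat_tuple (mktuple x) (mktuple y).

Definition bimonomial (d e : nat) (i : 'I_d.+1) (j : 'I_e.+1) :
    'X_{1..(2 + 2)} :=
  Multinom (xy_tuple (fun l : 'I_2 => if l == 0 then (d - i)%N else i : nat)
                     (fun l : 'I_2 => if l == 0 then (e - j)%N else j : nat)).

Definition form (R : comNzRingType) (d e : nat) (a : 'M[R]_(d.+1, e.+1)) :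
    {mpoly R[2 + 2]} :=
  \sum_i \sum_j a i j *: 'X_[bimonomial i j].

(* x_j |-> \sum_i g_ij x_i and y_j |-> \sum_i g_ij y_i, that is,
   (g . f)(x, y) = f(x g, y g) for row vectors x, y; this is a left action. *)
Definition lin_subst (R : comNzRingType) (g : 'M[R]_2) :
    (2 + 2).-tuple {mpoly R[2 + 2]} :=
  xy_tuple (fun j => \sum_(i < 2) g i j *: 'X_(lshift 2 i))
           (fun j => \sum_(i < 2) g i j *: 'X_(rshift 2 i)).

Definition sl2_act (R : comNzRingType) (d e : nat) (g : 'M[R]_2)
    (a : 'M[R]_(d.+1, e.+1)) : 'M[R]_(d.+1, e.+1) :=
  \matrix_(i, j) (form a \mPo lin_subst g)@_(bimonomial i j).

(* The same action in the linear coordinates of V_{d,e}. *)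
Definition sl2_act_coord (R : comNzRingType) (d e : nat) (g : 'M[R]_2)
    (v : 'rV[R]_(d.+1 * e.+1)) : 'rV[R]_(d.+1 * e.+1) :=
  mxvec (sl2_act g (vec_mx v)).

Section Multiplicity.
Variables (K : fieldType) (d e : nat).
Implicit Types (a : 'M[K]_(d.+1, e.+1)) (p q : 'rV[K]_2).

(* Points of P^1 are given by nonzero homogeneous coordinates p, q.  On the
   affine open {x_c <> 0, y_c' <> 0}, with coordinates
   u = x_(1-c) / x_c and w = y_(1-c') / y_c', a local equation of V(f) is f with
   x_c = y_c' = 1 (note that rev_ord c = 1 - c). *)
Definition local_equation a (c c' : 'I_2) : {mpoly K[2]} :=
  form a \mPo xy_tuple (fun i => if i == c then 1 else 'X_0)
                       (fun j => if j == c' then 1 else 'X_1).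

Definition chart_point p q (c c' : 'I_2) : 'I_2 -> K :=
  fun l => if l == 0 then p 0 (rev_ord c) / p 0 c
           else q 0 (rev_ord c') / q 0 c'.

(* The m-th power of the maximal ideal of K[u, w] at z. *)
Definition in_ideal_pow (z : 'I_2 -> K) (m : nat) (h : {mpoly K[2]}) : Prop :=
  exists (r : nat) (b : 'I_r -> {mpoly K[2]})
         (t : 'I_r -> 'I_m -> {mpoly K[2]}),
    (forall l i, (t l i).@[z] = 0) /\ h = \sum_l b l * \prod_i t l i.

(* Membership of h in the m-th power of the maximal ideal of the local ring at
   z, the localization of K[u, w] at the polynomials not vanishing at z. *)
Definition in_local_pow (z : 'I_2 -> K) (m : nat) (h : {mpoly K[2]}) : Prop :=
  exists g : {mpoly K[2]}, g.@[z] != 0 /\ in_ideal_pow z m (g * h).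

Definition vanishes_to_order a p q (m : nat) : Prop :=
  exists c c' : 'I_2, [/\ p 0 c != 0, q 0 c' != 0 &
    in_local_pow (chart_point p q c c') m (local_equation a c c')].

Definition has_multiplicity a p q (m : nat) : Prop :=
  vanishes_to_order a p q m /\
  forall m', vanishes_to_order a p q m' -> (m' <= m)%N.

End Multiplicity.

(* Classical varieties in the projective space with homogeneous coordinates
   'rV[K]_n, K algebraically closed: a point is a nonzero vector up to scaling,
   a set of points is a predicate on vectors. *)
Section ProjectiveSpace.
Variables (K : closedFieldType) (n : nat).
Implicit Types (v w : 'rV[K]_n) (U : 'rV[K]_n -> Prop) (h : {mpoly K[n]}).

Definition peval h v : K := h.@[fun i => v 0 i].

Definition same_point v w : Prop := exists2 c : K, c != 0 & w = c *: v.

Definition all_homog (F : fieldType) (T : seq {mpoly F[n]}) : Prop :=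
  forall s, s \in T -> exists m : nat, s \is m.-homog.

Definition closed_in U (Z : 'rV[K]_n -> Prop) : Prop :=
  exists2 T : seq {mpoly K[n]}, all_homog T &
    forall v, Z v <-> U v /\ forall h, h \in T -> peval h v = 0.

Definition regular_on U (phi : 'rV[K]_n -> K) : Prop :=
  forall v, U v -> exists (m : nat) (A B : {mpoly K[n]}),
    [/\ A \is m.-homog, B \is m.-homog, peval B v != 0 &
      forall w, U w -> peval B w != 0 -> phi w = peval A w / peval B w].

(* U, an open set of projective space, is isomorphic to a Zariski closed subset
   of an affine space K^m: phi is a morphism U -> K^m with closed image, and psi
   gives, locally around phi v, a morphism back which inverts phi. *)
Definition affine_open U : Prop :=
  exists (m : nat) (phi : 'I_m -> 'rV[K]_n -> K),
  [/\ forall i, regular_on U (phi i),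
      exists T : seq {mpoly K[m]}, forall y : 'I_m -> K,
        (exists2 v, U v & forall i, phi i v = y i) <->
        (forall t, t \in T -> t.@[y] = 0)
    & forall v, U v -> exists psi : 'I_n -> {mpoly K[m]},
        let inv w := \row_i (psi i).@[fun l => phi l w] in
        inv v != 0 /\ forall w, U w -> inv w != 0 -> same_point w (inv w)].

End ProjectiveSpace.

(* Corr_{d,e} = P(V_{d,e}) over k; a geometric point with values in K is a
   nonzero a : 'M[K]_(d.+1, e.+1).  Open subschemes over k are given by their
   K-points (iota : k -> K), and are affine iff they are so over K. *)
Section Stability.
Variables (k : fieldType) (K : closedFieldType) (iota : {rmorphism k -> K}).
Variables (d e : nat).
Local Notation N := (d.+1 * e.+1)%N.
Implicit Types (a : 'M[K]_(d.+1, e.+1)) (v w : 'rV[K]_N).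

(* H^0(Corr_{d,e}, O(m))^{SL_2}; invariance under the group scheme SL_2 is
   tested on points with values in arbitrary commutative k-algebras. *)
Definition invariant_section (m : nat) (s : {mpoly k[N]}) : Prop :=
  s \is m.-homog /\
  forall (R : comNzRingType) (j : {rmorphism k -> R}) (g : 'M[R]_2)
         (v : 'rV[R]_N),
    \det g = 1 ->
    (map_mpoly j s).@[fun i => sl2_act_coord g v 0 i]
      = (map_mpoly j s).@[fun i => v 0 i].

Definition nonvanishing_locus (s : {mpoly k[N]}) : 'rV[K]_N -> Prop :=
  fun v => v != 0 /\ peval (map_mpoly iota s) v != 0.

Definition semistable a : Prop :=
  exists (m : nat) (s : {mpoly k[N]}),
    [/\ invariant_section m s, nonvanishing_locus s (mxvec a)
      & affine_open (nonvanishing_locus s)].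

Definition open_over_base (U : 'rV[K]_N -> Prop) : Prop :=
  exists2 T : seq {mpoly k[N]}, all_homog T &
    forall v, U v <-> exists2 s, s \in T & nonvanishing_locus s v.

Definition sl2_stable (U : 'rV[K]_N -> Prop) : Prop :=
  forall (g : 'M[K]_2) v, \det g = 1 -> U v -> U (sl2_act_coord g v).

Definition sl2_orbit v : 'rV[K]_N -> Prop :=
  fun w => exists2 g : 'M[K]_2, \det g = 1 & same_point (sl2_act_coord g v) w.

Definition closed_action (U : 'rV[K]_N -> Prop) : Prop :=
  forall v, U v -> closed_in U (sl2_orbit v).

Definition finite_stabilizer a : Prop :=
  exists S : seq 'M[K]_2, forall g : 'M[K]_2, \det g = 1 ->
    same_point (mxvec a) (sl2_act_coord g (mxvec a)) -> g \in S.

(* As in Mumford's Geometric Invariant Theory, Definition 1.7, the action on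
   the neighborhood is required to be closed.  Without this a strictly
   semistable point with finite stabilizer, such as x_0^2 x_1 (x_0 - x_1) in
   degree (4, 0), would count as stable. *)
Definition prestable a : Prop :=
  finite_stabilizer a /\
  exists U : 'rV[K]_N -> Prop,
    [/\ open_over_base U, affine_open U, sl2_stable U, closed_action U
      & U (mxvec a)].

Definition stable a : Prop := semistable a /\ prestable a.

End Stability.

(* Main.v *)
(* A point of multiplicity at least T on the diagonal can be moved to a coordinate point by SL_2,
   where it means that the coefficients a_ij with i + j < T vanish; call f destabilized then.

   If f is destabilized for the relevant T, a one-parameter subgroup carries f to a limit.  For
   semistability every invariant of positive degree vanishes at f.  For stability, functions on an
   invariant affine neighborhood U of f are fractions whose denominators have no zero on U, hence
   are SL_2-invariant and do not vanish at the limit; so the limit lies in U, therefore in the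
   closed orbit of f, and it is fixed by a torus.

   Conversely, averaging P(g v) over g by Cayley's Omega functional gives invariants.  If those
   built from a family of P all vanish at f, the ideal generated by the functions P(g f) of g is
   proper, and Chevalley's extension theorem gives a place of the function field of GL_2 at which
   they are small.  A pole of g at such a place is impossible unless f is destabilized, so g and
   g^-1 are regular and f itself is a common zero.  With the coordinates as P this proves
   semistability; with the coefficients of an equation of the destabilized locus it gives an
   invariant s vanishing on that locus but not at f.  The same valuative argument shows that the
   orbits in X_s are closed and that the stabilizer of f is finite. *)
From HB Require Import structures.
From mathcomp Require Import all_boot all_order all_algebra.
From mathcomp Require Import ssrcomplements mpoly.
From mathcomp Require Import ring zify.
From Stdlib Require Import Classical.
Require Import Defs.
Set Implicit Arguments.
Unset Strict Implicit.
Unset Printing Implicit Defensive.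
Import GRing.Theory.
Local Open Scope ring_scope.

(** * The action on bihomogeneous forms *)

(** Two difficulties shape the proof. The form has coefficients in [K], but an invariant section
    must have them in [k]. Hence nonvanishing is passed from a [K]-combination to one of its terms,
    a monomial or a product of polynomials over [k], and linear relations over [K] are reduced to
    relations over [k]. Moreover the functions [P(g f)] have mixed degrees in [g] while the
    determinant of [g] is inverted. Omega is therefore divided by a factorial in each degree, which
    makes it blind to powers of the determinant; this is where characteristic zero enters. The
    places are partial: a subring of a field with a proper ideal of it. Each argument decides only
    finitely many elements, with one extension step for each. The thresholds are
    [T = uphalf (d + e)] for stability and [T = (d + e)./2.+1] for semistability. A pole of [g]
    contributes the exponent [d + e - 2 (i + j)], which for [i + j < T] is positive in the first
    case but may be zero in the second; there the moved form is small rather than merely regular,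
    and this makes up for it. *)

Lemma big_ord2 (V : nmodType) (F : 'I_2 -> V) : \sum_i F i = F 0 + F 1.
Proof. by rewrite big_ord_recl big_ord1; congr (_ + F _); apply: val_inj. Qed.

Lemma ord2P (c : 'I_2) : c = 0 \/ c = 1.
Proof. by case: c => [[|[|//]] ?]; [left|right]; apply: val_inj. Qed.

Section SymmetricPower.
Variables (R : comNzRingType).

Definition homogenize (A : comNzRingType) (j : {rmorphism R -> A}) D
    (P : {poly R}) (x0 x1 : A) : A :=
  \sum_(i < D.+1) j P`_i * x0 ^+ (D - i) * x1 ^+ i.

Definition lin (a b : R) : {poly R} := a%:P + b *: 'X.

Lemma size_lin a b : (size (lin a b) <= 2)%N.
Proof.
rewrite /lin (leq_trans (size_polyD _ _)) // geq_max.
rewrite (leq_trans (size_polyC_leq1 _)) //=.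
by rewrite (leq_trans (size_scale_leq _ _)) // size_polyX.
Qed.

Lemma homogenize_lin (A : comNzRingType) (j : {rmorphism R -> A}) D
    (P : {poly R}) a b (x0 x1 : A) :
  (size P <= D.+1)%N ->
  homogenize j D.+1 (P * lin a b) x0 x1
    = homogenize j D P x0 x1 * (j a * x0 + j b * x1).
Proof.
move=> sP; rewrite /homogenize /lin.
have E i : (P * (a%:P + b *: 'X))`_i = P`_i * a + (if i == 0 then 0 else P`_i.-1 * b).
  rewrite mulrDr coefD coefMC -scalerAr coefZ coefMX.
  by case: i => [|i] /=; ring.
rewrite (eq_bigr (fun i : 'I_D.+2 => j P`_i * j a * x0 ^+ (D.+1 - i) * x1 ^+ i
   + (if i == 0 :> nat then 0 else j P`_i.-1 * j b) * x0 ^+ (D.+1 - i) * x1 ^+ i)); last first.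
  move=> i _; rewrite E rmorphD rmorphM !mulrDl.
  by case: ifP => _; rewrite ?rmorph0 ?rmorphM.
rewrite big_split /= mulrDr; congr (_ + _).
  rewrite big_ord_recr /= nth_default // rmorph0 !mul0r addr0 mulr_suml.
  apply: eq_bigr => i _; have -> : (D.+1 - i = (D - i).+1)%N by have := ltn_ord i; lia.
  rewrite exprS; ring.
rewrite big_ord_recl /= !mul0r add0r mulr_suml.
apply: eq_bigr => i _; rewrite /bump /= add1n subSS exprS; ring.
Qed.

Lemma size_lin_exp a b m (P : {poly R}) D : (size P <= D.+1)%N ->
  (size (P * lin a b ^+ m)%R <= (D + m).+1)%N.
Proof.
move=> sP; elim: m => [|m IH]; first by rewrite mulr1 addn0.
rewrite exprSr mulrA (leq_trans (size_polyMleq _ _)) //.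
have := size_lin a b; lia.
Qed.

Lemma size_lin_exp1 a b m : (size (lin a b ^+ m) <= m.+1)%N.
Proof. by rewrite -[lin a b ^+ m]mul1r -[m in m.+1]add0n size_lin_exp ?size_poly1. Qed.

Lemma homogenize_lin_exp (A : comNzRingType) (j : {rmorphism R -> A}) D
    (P : {poly R}) a b (x0 x1 : A) m :
  (size P <= D.+1)%N ->
  homogenize j (D + m) (P * lin a b ^+ m) x0 x1
    = homogenize j D P x0 x1 * (j a * x0 + j b * x1) ^+ m.
Proof.
move=> sP; elim: m => [|m IH]; first by rewrite !mulr1 addn0.
rewrite exprSr mulrA addnS homogenize_lin ?size_lin_exp // IH exprSr; ring.
Qed.

Definition sym_poly d (g : 'M[R]_2) (k : nat) : {poly R} :=
  lin (g 0 0) (g 1 0) ^+ (d - k) * lin (g 0 1) (g 1 1) ^+ k.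

(* The matrix of the substitution g on binary forms of degree d: its column k
   lists the coefficients of x_0^(d-k) x_1^k after substitution. *)
Definition sym_mx d (g : 'M[R]_2) : 'M[R]_d.+1 :=
  \matrix_(i, k) (sym_poly d g k)`_i.

Lemma homogenize_sym (A : comNzRingType) (j : {rmorphism R -> A}) d (g : 'M_2) (k : nat) (x0 x1 : A) :
  (k <= d)%N ->
  homogenize j d (sym_poly d g k) x0 x1
    = (j (g 0 0) * x0 + j (g 1 0) * x1) ^+ (d - k)
      * (j (g 0 1) * x0 + j (g 1 1) * x1) ^+ k.
Proof.
move=> kd; rewrite /sym_poly -[X in homogenize _ X](subnK kd).
rewrite homogenize_lin_exp ?size_lin_exp1 //; congr (_ * _).
rewrite -[lin _ _ ^+ _]mul1r -{1}[(d - k)%N]add0n.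
rewrite homogenize_lin_exp ?size_poly1 //.
by rewrite /homogenize big_ord1 coef1 rmorph1 !expr0 !mul1r.
Qed.

Lemma sum_sym_mx (A : comNzRingType) (j : {rmorphism R -> A}) d (g : 'M_2) (k : 'I_d.+1) (x0 x1 : A) :
  \sum_(i < d.+1) j (sym_mx d g i k) * x0 ^+ (d - i) * x1 ^+ i
    = (j (g 0 0) * x0 + j (g 1 0) * x1) ^+ (d - k)
      * (j (g 0 1) * x0 + j (g 1 1) * x1) ^+ k.
Proof.
rewrite -homogenize_sym ?leq_ord //.
by apply: eq_bigr => i _; rewrite mxE.
Qed.

Lemma mulmx2E (A : comNzRingType) (g h : 'M[A]_2) (i k : 'I_2) :
  (g *m h) i k = g i 0 * h 0 k + g i 1 * h 1 k.
Proof. by rewrite mxE big_ord2. Qed.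

(** Column [k] of [sym_mx d h] is a binary form; [sum_sym_mx], evaluated at the two linear forms
    given by [g], composes the substitutions. *)
Lemma sym_mxM d (g h : 'M[R]_2) : sym_mx d (g *m h) = sym_mx d g *m sym_mx d h.
Proof.
apply/matrixP => i k; rewrite mxE [RHS]mxE.
have E a b : lin (g 0 0 * a + g 0 1 * b) (g 1 0 * a + g 1 1 * b)
    = a%:P * lin (g 0 0) (g 1 0) + b%:P * lin (g 0 1) (g 1 1).
  rewrite /lin -!mul_polyC !rmorphD !rmorphM /=; ring.
rewrite /sym_poly !mulmx2E !E -(sum_sym_mx polyC) coef_sum.
apply: eq_bigr => l _; rewrite -mulrA coefCM mulrC.
by rewrite [sym_mx d g i l]mxE.
Qed.

Lemma sym_mx_diag d a b (i k : 'I_d.+1) (g : 'M[R]_2) :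
  g 0 0 = a -> g 1 1 = b -> g 0 1 = 0 -> g 1 0 = 0 ->
  sym_mx d g i k = if i == k then a ^+ (d - i) * b ^+ i else 0.
Proof.
move=> ga gb g01 g10; rewrite mxE /sym_poly ga gb g01 g10 /lin scale0r addr0 add0r.
rewrite exprZn -scalerAr coefZ -rmorphXn coefCM coefXn -val_eqE /=.
by case: eqP => [->|_]; rewrite ?mulr1 ?mulr0 // mulrC.
Qed.

Lemma sym_mx1 d : sym_mx d 1%:M = 1%:M.
Proof.
apply/matrixP => i k; rewrite (@sym_mx_diag _ 1 1) ?mxE //=.
by rewrite !expr1n mulr1; case: eqP.
Qed.

End SymmetricPower.

Lemma map_sym_mx (R S : comNzRingType) (j : {rmorphism R -> S}) d (g : 'M[R]_2) :
  map_mx j (sym_mx d g) = sym_mx d (map_mx j g).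
Proof.
apply/matrixP => i k; rewrite !mxE -coef_map; congr (_`_i).
have E a b : map_poly j (lin a b) = lin (j a) (j b).
  by rewrite /lin rmorphD /= map_polyC /= map_polyZ map_polyX.
by rewrite /sym_poly rmorphM !rmorphXn /= !E !mxE.
Qed.

(* Evaluation of a bihomogeneous form, free of the encoding by {mpoly R[2+2]}. *)
Definition bieval (R A : comNzRingType) (j : {rmorphism R -> A}) d e
    (a : 'M[R]_(d.+1, e.+1)) (x0 x1 y0 y1 : A) : A :=
  \sum_k \sum_l j (a k l) * (x0 ^+ (d - k) * x1 ^+ k)
                          * (y0 ^+ (e - l) * y1 ^+ l).

Lemma bieval_map (R A B : comNzRingType) (j : {rmorphism R -> A})
    (j' : {rmorphism R -> B}) (L : {rmorphism A -> B}) d e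
    (a : 'M[R]_(d.+1, e.+1)) (x0 x1 y0 y1 : A) : (forall c, L (j c) = j' c) ->
  L (bieval j a x0 x1 y0 y1) = bieval j' a (L x0) (L x1) (L y0) (L y1).
Proof.
move=> E; rewrite /bieval rmorph_sum; apply: eq_bigr => k _.
rewrite rmorph_sum; apply: eq_bigr => l _.
by rewrite !rmorphM !rmorphXn E.
Qed.

Section Action.
Variables (R : comNzRingType) (d e : nat).
Implicit Types (g h : 'M[R]_2) (a b : 'M[R]_(d.+1, e.+1)).

(** The space of forms is a tensor product of two symmetric powers, so the substitution is a
    two-sided matrix product; [sl2_actE] identifies it with the substitution of variables. *)
Definition act g a : 'M[R]_(d.+1, e.+1) := sym_mx d g *m a *m (sym_mx e g)^T.

Lemma actE g a i j :
  act g a i j = \sum_k \sum_l a k l * sym_mx d g i k * sym_mx e g j l.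
Proof.
rewrite /act mxE exchange_big /=; apply: eq_bigr => l _.
rewrite !mxE mulr_suml; apply: eq_bigr => k _; rewrite !mxE; ring.
Qed.

Lemma bieval_act (A : comNzRingType) (j : {rmorphism R -> A}) g a (x0 x1 y0 y1 : A) :
  bieval j (act g a) x0 x1 y0 y1 =
  bieval j a (j (g 0 0) * x0 + j (g 1 0) * x1) (j (g 0 1) * x0 + j (g 1 1) * x1)
             (j (g 0 0) * y0 + j (g 1 0) * y1) (j (g 0 1) * y0 + j (g 1 1) * y1).
Proof.
rewrite /bieval.
transitivity (\sum_i \sum_i' \sum_k \sum_l j (a k l) *
   (j (sym_mx d g i k) * x0 ^+ (d - i) * x1 ^+ i) *
   (j (sym_mx e g i' l) * y0 ^+ (e - i') * y1 ^+ i')).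
  apply: eq_bigr => i _; apply: eq_bigr => i' _.
  rewrite actE rmorph_sum !mulr_suml; apply: eq_bigr => k _.
  rewrite rmorph_sum !mulr_suml; apply: eq_bigr => l _.
  rewrite !rmorphM; ring.
under eq_bigr => i _ do rewrite exchange_big.
rewrite exchange_big; apply: eq_bigr => k _ /=.
under eq_bigr => i _ do rewrite exchange_big.
rewrite exchange_big; apply: eq_bigr => l _ /=.
rewrite -!sum_sym_mx -mulrA big_distrlr mulr_sumr; apply: eq_bigr => i _.
by rewrite mulr_sumr; apply: eq_bigr => i' _; rewrite -mulrA.
Qed.

Lemma actM g h a : act (g *m h) a = act g (act h a).
Proof. by rewrite /act !sym_mxM trmx_mul !mulmxA. Qed.

Lemma act1 a : act 1%:M a = a.
Proof. by rewrite /act !sym_mx1 trmx1 mul1mx mulmx1. Qed.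

Lemma act_diag g a i j : g 0 1 = 0 -> g 1 0 = 0 ->
  act g a i j = g 0 0 ^+ ((d - i) + (e - j)) * g 1 1 ^+ (i + j) * a i j.
Proof.
move=> g01 g10; rewrite actE (bigD1 i) //= [X in _ + X]big1 ?addr0; last first.
  move=> k /negbTE ki; apply: big1 => l _.
  by rewrite (sym_mx_diag _ _ erefl erefl) // eq_sym ki mulr0 mul0r.
rewrite (bigD1 j) //= [X in _ + X]big1 ?addr0; last first.
  move=> l /negbTE lj.
  by rewrite [sym_mx e g j l](sym_mx_diag _ _ erefl erefl) // eq_sym lj mulr0.
rewrite !(sym_mx_diag _ _ erefl erefl) // !eqxx !exprD; ring.
Qed.

Lemma act_scale g c a : act g (c *: a) = c *: act g a.
Proof. by rewrite /act -scalemxAr -scalemxAl. Qed.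

Lemma act0 g : act g 0 = 0.
Proof. by rewrite /act mulmx0 mul0mx. Qed.

End Action.

Lemma map_act (R S : comNzRingType) (j : {rmorphism R -> S}) d e g
    (a : 'M[R]_(d.+1, e.+1)) :
  map_mx j (act g a) = act (map_mx j g) (map_mx j a).
Proof. by rewrite /act !map_mxM -map_trmx !map_sym_mx. Qed.

Section Forms.
Variables (R : comNzRingType) (d e : nat).
Implicit Types (g h : 'M[R]_2) (a : 'M[R]_(d.+1, e.+1)).

Lemma tnth_xy_l (S : Type) (x y : 'I_2 -> S) i :
  tnth (xy_tuple x y) (lshift 2 i) = x i.
Proof. by rewrite tnth_lshift tnth_mktuple. Qed.

Lemma tnth_xy_r (S : Type) (x y : 'I_2 -> S) i :
  tnth (xy_tuple x y) (rshift 2 i) = y i.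
Proof. by rewrite tnth_rshift tnth_mktuple. Qed.

Lemma bimonomialE (S : comNzRingType) (i : 'I_d.+1) (j : 'I_e.+1)
    (t : 'I_(2 + 2) -> S) :
  \prod_l t l ^+ bimonomial i j l =
  (t (lshift 2 0) ^+ (d - i) * t (lshift 2 1) ^+ i)
  * (t (rshift 2 0) ^+ (e - j) * t (rshift 2 1) ^+ j).
Proof.
rewrite big_split_ord /=.
have two (G : 'I_2 -> S) : \prod_l G l = G 0 * G 1.
  by rewrite big_ord_recl big_ord1; congr (_ * G _); apply: val_inj.
by rewrite !two !multinomE !tnth_xy_l !tnth_xy_r.
Qed.

Lemma form_comp (n : nat) a (x y : 'I_2 -> {mpoly R[n]}) :
  form a \mPo xy_tuple x y = bieval (mpolyC n (R := R)) a (x 0) (x 1) (y 0) (y 1).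
Proof.
rewrite /form /bieval raddf_sum; apply: eq_bigr => i _ /=.
rewrite raddf_sum; apply: eq_bigr => j _ /=.
rewrite comp_mpolyZ comp_mpolyX (bimonomialE _ _ (tnth _)).
by rewrite !tnth_xy_l !tnth_xy_r -mul_mpolyC -!mulrA.
Qed.


Lemma bimonomial_inj i j i' j' :
  (@bimonomial d e i j == bimonomial i' j') = (i == i') && (j == j').
Proof.
apply/eqP/andP => [E|[/eqP-> /eqP->]] //; split; apply/eqP/val_inj.
  have := congr1 (fun m : 'X_{1..2+2} => m (lshift 2 1)) E.
  by rewrite !multinomE !tnth_xy_l.
have := congr1 (fun m : 'X_{1..2+2} => m (rshift 2 1)) E.
by rewrite !multinomE !tnth_xy_r.
Qed.

Lemma mcoeff_form a i j : (form a)@_(bimonomial i j) = a i j.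
Proof.
rewrite /form raddf_sum (bigD1 i) //= raddf_sum (bigD1 j) //=.
rewrite mcoeffZ mcoeffX eqxx mulr1 big1 ?addr0 => [|j' /negbTE jj].
  rewrite big1 ?addr0 // => i' /negbTE ii; rewrite raddf_sum big1 // => j' _ /=.
  by rewrite mcoeffZ mcoeffX bimonomial_inj ii mulr0.
by rewrite mcoeffZ mcoeffX bimonomial_inj jj andbF mulr0.
Qed.

Lemma form_bieval a :
  form a = bieval (mpolyC (2 + 2) (R := R)) a
    'X_(lshift 2 0) 'X_(lshift 2 1) 'X_(rshift 2 0) 'X_(rshift 2 1).
Proof.
rewrite /form /bieval; apply: eq_bigr => i _; apply: eq_bigr => j _.
by rewrite mpolyXE_id (bimonomialE _ _ (fun l => 'X_l)) -mul_mpolyC -!mulrA.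
Qed.

Lemma sl2_actE g a : sl2_act g a = act g a.
Proof.
apply/matrixP => i j; rewrite mxE form_comp -[RHS]mcoeff_form form_bieval.
by rewrite bieval_act !big_ord2 !mul_mpolyC.
Qed.

End Forms.

(** * Multiplicity on the diagonal and vanishing corners *)

Lemma closed_poly0 (K : closedFieldType) (q : {poly K}) :
  (forall x, q.[x] = 0) -> q = 0.
Proof.
move=> q0; apply/eqP; apply: contraT => /closed_nonrootP [x].
by rewrite /root q0 eqxx.
Qed.

Section IdealPow.
Variables (K : fieldType) (z : 'I_2 -> K).

Lemma in_ideal_powD m h1 h2 : in_ideal_pow z m h1 -> in_ideal_pow z m h2 ->
  in_ideal_pow z m (h1 + h2).
Proof.
move=> [r1 [b1 [t1 [z1 ->]]]] [r2 [b2 [t2 [z2 ->]]]].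
exists (r1 + r2)%N, (fun l => match split l with inl i => b1 i | inr i => b2 i end),
  (fun l => match split l with inl i => t1 i | inr i => t2 i end); split.
  by move=> l i; case: (split l).
rewrite big_split_ord /=; congr (_ + _); apply: eq_bigr => i _.
  by rewrite (unsplitK (inl i)).
by rewrite (unsplitK (inr i)).
Qed.

Lemma in_ideal_pow0 m : in_ideal_pow z m 0.
Proof.
exists 0%N, (fun _ => 0), (fun _ _ => 0); split; last by rewrite big_ord0.
by case.
Qed.

Lemma in_ideal_pow_sum m (I : Type) (s : seq I) (P : pred I) F :
  (forall i, P i -> in_ideal_pow z m (F i)) ->
  in_ideal_pow z m (\sum_(i <- s | P i) F i).
Proof.
move=> H; elim/big_rec: _ => [|i x Pi]; first exact: in_ideal_pow0.
by move=> Hx; apply: in_ideal_powD => //; apply: H.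
Qed.

Lemma in_ideal_pow_prod m i j (b t s : {mpoly K[2]}) :
  t.@[z] = 0 -> s.@[z] = 0 -> (m <= i + j)%N ->
  in_ideal_pow z m (b * (t ^+ i * s ^+ j)).
Proof.
move=> tz sz mij.
have [i' [j' [E1 E2 E3]]] : exists i' j', [/\ (i' <= i)%N, (j' <= j)%N & (i' + j')%N = m].
  by exists (minn i m), (m - minn i m)%N; split; lia.
exists 1%N, (fun _ => b * (t ^+ (i - i') * s ^+ (j - j'))),
  (fun _ l => if (l < i')%N then t else s); split.
  by move=> _ l; case: ifP.
rewrite big_ord1 -mulrA; congr (_ * _).
have -> : \prod_(l < m) (if (l < i')%N then t else s) = t ^+ i' * s ^+ j'.
  rewrite -E3 big_split_ord /=; congr (_ * _).
    by rewrite (eq_bigr (fun _ => t)) ?prodr_const ?card_ord // => l _; rewrite ltn_ord.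
  by rewrite (eq_bigr (fun _ => s)) ?prodr_const ?card_ord // => l _; rewrite ltnNge leq_addr.
rewrite -[in LHS](subnK E1) -[in LHS](subnK E2) !exprD; ring.
Qed.

End IdealPow.

Section Multiplicity.
Variables (K : closedFieldType) (d e : nat).
Implicit Types (f a : 'M[K]_(d.+1, e.+1)) (g : 'M[K]_2).

(** Restriction to the affine line through [z] with direction [s] and parameter ['X]. *)
Definition line (z s : 'I_2 -> K) : {mpoly K[2]} -> {poly K} :=
  mmap (@polyC K) (fun l => (z l)%:P + s l *: 'X).

HB.instance Definition _ z s := GRing.RMorphism.copy (line z s)
  (mmap (@polyC K) (fun l => (z l)%:P + s l *: 'X)).

Lemma dvdpX0 (p : {poly K}) : ('X %| p) = root p 0.
Proof. by rewrite -dvdp_XsubCl polyC0 subr0. Qed.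

Lemma line0 z s h : (line z s h).[0] = h.@[z].
Proof.
rewrite /line /meval /mmap horner_sum; apply: eq_bigr => m _.
rewrite hornerM hornerC; congr (_ * _).
rewrite /mmap1 horner_prod; apply: eq_bigr => i _.
by rewrite horner_exp hornerD hornerC hornerZ hornerX mulr0 addr0.
Qed.

(** Polynomials vanishing at [z] become multiples of ['X] on a line through [z], and a denominator
    nonzero at [z] becomes coprime to ['X^m]. *)
Lemma line_ideal_pow z s m h : in_local_pow z m h ->
  forall l, (l < m)%N -> (line z s h)`_l = 0.
Proof.
move=> [g [gz [r [b [t [tz E]]]]]] l lm.
have dv : 'X^m %| line z s g * line z s h.
  rewrite -rmorphM E rmorph_sum; elim/big_ind: _ => [|x y|i _].
  - exact: dvdp0.
  - exact: dvdp_add.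
  - rewrite rmorphM dvdp_mull // rmorph_prod.
    have -> : 'X^m = \prod_(i < m) ('X : {poly K}) by rewrite prodr_const card_ord.
    elim/big_rec2: _ => // j p q _ pq; rewrite dvdp_mul //.
    by rewrite dvdpX0 /root line0 tz.
have cop : coprimep ('X^m : {poly K}) (line z s g).
  apply: coprimep_expl; by rewrite coprimep_sym coprimepX /root line0.
move: dv; rewrite Gauss_dvdpr // => /dvdpP [q ->].
by rewrite coefMXn lm.
Qed.

(* Local coordinates x g^-1 at the point p = row 0 of g. *)
Definition loc0 (A : comNzRingType) (j : {rmorphism K -> A}) g (x : 'I_2 -> A) : A :=
  x 0 * j (g 1 1) - x 1 * j (g 1 0).
Definition loc1 (A : comNzRingType) (j : {rmorphism K -> A}) g (x : 'I_2 -> A) : A :=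
  x 1 * j (g 0 0) - x 0 * j (g 0 1).

Lemma det2E (A : comNzRingType) (g : 'M[A]_2) :
  \det g = g 0 0 * g 1 1 - g 0 1 * g 1 0.
Proof.
rewrite (expand_det_row _ 0) big_ord2 /cofactor !det_mx11 !mxE /= expr0 expr1 mul1r mulN1r.
rewrite mulrN; congr (_ * g _ _ - _ * g _ _); exact: val_inj.
Qed.

Lemma bieval_loc (A : comNzRingType) (j : {rmorphism K -> A}) g f (x y : 'I_2 -> A) :
  \det g = 1 ->
  bieval j f (x 0) (x 1) (y 0) (y 1) =
  bieval j (act g f) (loc0 j g x) (loc1 j g x) (loc0 j g y) (loc1 j g y).
Proof.
rewrite det2E => /(congr1 j); rewrite rmorphB !rmorphM rmorph1 => /eqP; rewrite subr_eq => /eqP D.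
rewrite bieval_act /loc0 /loc1; congr bieval; ring: D.
Qed.

(** In the coordinates x g^-1 the point [row 0 g] is [1 : 0], and [act g f i j] multiplies the i-th
    and j-th powers of local parameters of the two factors, up to units. This gives membership in
    the power of the maximal ideal at once. Conversely the coefficients are recovered by induction
    on [i + j], restricting the local equation to all lines through the point. *)
Lemma vanishes_to_order_row (g : 'M[K]_2) f m : \det g = 1 ->
  vanishes_to_order f (row 0 g) (row 0 g) m <->
  forall (i : 'I_d.+1) (j : 'I_e.+1), (i + j < m)%N -> act g f i j = 0.
Proof.
move=> Dg; have row0 i : row 0 g 0 i = g 0 i by rewrite mxE.
have rv0 : rev_ord (0 : 'I_2) = 1 by apply: val_inj.
have rv1 : rev_ord (1 : 'I_2) = 0 by apply: val_inj.
have n10 : (1 == 0 :> 'I_2) = false by [].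
(* the coordinate loc1 is a local parameter, loc0 is a unit at the point *)
have locP (c : 'I_2) (A : comNzRingType) (j : {rmorphism K -> A}) (u : A) : g 0 c != 0 ->
    let x := fun i : 'I_2 => if i == c then 1 else u in
    let sg : K := if c == 0 then g 0 0 else - g 0 1 in
    [/\ loc1 j g x = j sg * (u - j (g 0 (rev_ord c) / g 0 c)), sg != 0
      & loc0 j g x = j (g 0 c)^-1 + j (if c == 0 then - g 1 0 else g 1 1)
          * (u - j (g 0 (rev_ord c) / g 0 c))].
  move: Dg; rewrite det2E /loc0 /loc1 => Dg g0c.
  have jV : j (g 0 c) * j (g 0 c)^-1 = 1 by rewrite -rmorphM mulfV ?rmorph1.
  have D : j (g 0 0) * j (g 1 1) = 1 + j (g 0 1) * j (g 1 0).
    by rewrite -!rmorphM -(rmorph1 j) -rmorphD -Dg subrK.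
  case: (ord2P c) => cE; rewrite cE in g0c jV *; rewrite ?rv0 ?rv1 /= ?n10 ?oppr_eq0; split => //.
  - by rewrite rmorphM; ring: jV.
  - have E : j (g 1 1) = j (g 0 0)^-1 * (1 + j (g 0 1) * j (g 1 0)).
      by rewrite -D mulrA [X in X * _]mulrC jV mul1r.
    by rewrite rmorphM rmorphN; ring: E.
  - by rewrite rmorphM rmorphN; ring: jV.
  - have E : j (g 1 0) = j (g 0 1)^-1 * (j (g 0 0) * j (g 1 1) - 1).
      by rewrite D addrAC subrr add0r mulrA [X in X * _]mulrC jV mul1r.
    by rewrite rmorphM; ring: E.
split=> [[c [c' [pc pc' H]]]|H].
  rewrite !row0 in pc pc'.
  set z := chart_point _ _ _ _ in H.
  have z0 : z 0 = g 0 (rev_ord c) / g 0 c by rewrite /z /chart_point !row0.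
  have z1 : z 1 = g 0 (rev_ord c') / g 0 c' by rewrite /z /chart_point !row0.
  suff claim h : forall (i : 'I_d.+1) (j : 'I_e.+1),
      (i + j)%N = h -> (h < m)%N -> act g f i j = 0.
    by move=> i j ij; apply: (claim (i + j)%N).
  elim/ltn_ind: h => h IH i0 j0 ij0 hm.
  set s0 := if c == 0 then g 0 0 else - g 0 1; set s1 := if c' == 0 then g 0 0 else - g 0 1.
  set al := (g 0 c)^-1; set be := (g 0 c')^-1.
  have [s0n s1n] : s0 != 0 /\ s1 != 0.
    by have [_ ? _] := locP c K idfun 0 pc; have [_ ? _] := locP c' K idfun 0 pc'.
  (* The coefficient of degree [h] along the line with direction [(t, 1)]: terms with [i + j < h]
     vanish by induction, and those with [i + j > h] do not contribute. *)
  have key (t : K) : \sum_(i < d.+1) \sum_(j < e.+1) (if (i + j)%N == h then act g f i j * (al ^+ (d - i) * (s0 * t) ^+ i)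
      * (be ^+ (e - j) * s1 ^+ j) else 0) = 0.
    have := line_ideal_pow (fun l : 'I_2 => if l == 0 then t else 1) H hm.
    rewrite /local_equation form_comp.
    set sl := fun l : 'I_2 => _.
    have LX l : line z sl 'X_l = (z l)%:P + (if l == 0 then t else 1) *: 'X.
      by rewrite /line mmapX mmap1U.
    have Lif (b : bool) l : line z sl (if b then 1 else 'X_l) = if b then 1 else line z sl 'X_l.
      by case: b; rewrite ?rmorph1.
    rewrite (bieval_map (j' := polyC)) => [|a]; last by rewrite /= /line mmapC.
    rewrite /= !Lif (bieval_loc _ _ (fun l : 'I_2 => if l == c then 1 else line z sl 'X_0)
      (fun l : 'I_2 => if l == c' then 1 else line z sl 'X_1) Dg).
    have [-> _ ->] := locP c _ polyC (line z sl 'X_0) pc.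
    have [-> _ ->] := locP c' _ polyC (line z sl 'X_1) pc'.
    rewrite !LX /= z0 z1 ![_ + _ *: 'X]addrC !addrK -/s0 -/s1 -/al -/be => E.
    rewrite -[RHS]E /bieval coef_sum; apply: eq_bigr => i _.
    rewrite coef_sum; apply: eq_bigr => j _.
    set P0 := _%:P + _; set P1 := be%:P + _.
    have -> : (act g f i j)%:P * (P0 ^+ (d - i) * (s0%:P * (t *: 'X)) ^+ i) *
       (P1 ^+ (e - j) * (s1%:P * (1 *: 'X)) ^+ j) =
       ((act g f i j)%:P * (P0 ^+ (d - i) * ((s0 * t) ^+ i)%:P) * (P1 ^+ (e - j) * (s1 ^+ j)%:P)) * 'X^(i + j).
      rewrite scale1r -mul_polyC exprD !rmorphXn rmorphM /= !exprMn; ring.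
    rewrite coefMXn; case: ltngtP => [hl|hl|hl]; rewrite ?ltnn //.
      by rewrite (IH _ hl i j) ?(ltn_trans hl) // !mul0r coef0.
    rewrite hl subnn -horner_coef0 !hornerM !horner_exp !hornerC.
    by rewrite /P0 /P1 !hornerD !hornerM !hornerC !hornerZ !hornerX !mulr0 !addr0.
  (* The same coefficient as a polynomial in [t]. Since [i] determines [j = h - i], each of its
     coefficients is a single entry of [act g f] times a nonzero constant. *)
  pose q := \sum_(i < d.+1) (\sum_(j < e.+1) (if (i + j)%N == h then act g f i j *
      (al ^+ (d - i) * s0 ^+ i) * (be ^+ (e - j) * s1 ^+ j) else 0)) *: 'X^i.
  have q0 : q = 0.
    apply: closed_poly0 => t; rewrite -[RHS](key t) /q horner_sum.
    apply: eq_bigr => i _; rewrite hornerZ hornerXn mulr_suml; apply: eq_bigr => j _.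
    by case: ifP; rewrite ?mul0r // exprMn => _; ring.
  have := congr1 (fun p : {poly K} => p`_i0) q0; rewrite /q coef_sum coef0.
  rewrite (bigD1 i0) //= [X in _ + X]big1 ?addr0 => [|i ii]; last first.
    by rewrite coefZ coefXn eq_sym val_eqE (negbTE ii) mulr0.
  rewrite coefZ coefXn eqxx mulr1 (bigD1 j0) //= ij0 eqxx [X in _ + X]big1 ?addr0 => [/eqP|j jj].
    by rewrite !mulf_eq0 !expf_eq0 !invr_eq0 (negbTE pc) (negbTE pc') (negbTE s0n) (negbTE s1n)
      !andbF !orbF => /eqP.
  case: eqP => // E; case/eqP: jj; apply: val_inj; apply/eqP.
  by rewrite -(eqn_add2l i0) E ij0.
have [c pc] : exists c, g 0 c != 0.
  apply: NNPP => N; have g0 c : g 0 c = 0 by apply/eqP/contraT => gc; case: N; exists c.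
  by move: Dg; rewrite det2E !g0 !mul0r subrr => /esym/eqP; rewrite oner_eq0.
exists c, c; split; rewrite ?row0 //.
exists 1; rewrite mul1r meval1 oner_eq0; split => //.
set z := chart_point _ _ _ _.
have z0 : z 0 = g 0 (rev_ord c) / g 0 c by rewrite /z /chart_point !row0.
have z1 : z 1 = g 0 (rev_ord c) / g 0 c by rewrite /z /chart_point !row0.
rewrite /local_equation form_comp (bieval_loc _ _ (fun l : 'I_2 => if l == c then 1 else 'X_0)
      (fun l : 'I_2 => if l == c then 1 else 'X_1) Dg).
have [-> _ _] := locP c _ (mpolyC 2 (R := K)) 'X_0 pc.
have [-> _ _] := locP c _ (mpolyC 2 (R := K)) 'X_1 pc.
apply: in_ideal_pow_sum => i _; apply: in_ideal_pow_sum => j _.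
case: (ltnP (i + j) m) => ij; first by rewrite H // rmorph0 !mul0r; apply: in_ideal_pow0.
set t := _%:MP * ('X_0 - _); set s := _%:MP * ('X_1 - _); set A := loc0 _ _ _; set B := loc0 _ _ _.
have -> : (act g f i j)%:MP * (A ^+ (d - i) * t ^+ i) * (B ^+ (e - j) * s ^+ j) =
   ((act g f i j)%:MP * A ^+ (d - i) * B ^+ (e - j)) * (t ^+ i * s ^+ j) by ring.
apply: in_ideal_pow_prod ij; rewrite mevalM mevalB mevalXU !mevalC.
  by rewrite z0 subrr mulr0.
by rewrite z1 subrr mulr0.
Qed.

End Multiplicity.

Definition mx2 (R : nzRingType) (a b c e : R) : 'M[R]_2 :=
  \matrix_(i, j) if i == 0 then (if j == 0 then a else b)
                 else (if j == 0 then c else e).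

Lemma mx2_eta (R : nzRingType) (g : 'M[R]_2) :
  g = mx2 (g 0 0) (g 0 1) (g 1 0) (g 1 1).
Proof.
apply/matrixP => i j; rewrite mxE.
by case: (ord2P i) => ->; case: (ord2P j) => ->.
Qed.

Lemma det_mx2 (R : comNzRingType) (a b c e : R) :
  \det (mx2 a b c e) = a * e - b * c.
Proof. by rewrite det2E !mxE. Qed.

Lemma map_mx2 (R S : nzRingType) (j : {rmorphism R -> S}) a b c e' :
  map_mx j (mx2 a b c e') = mx2 (j a) (j b) (j c) (j e').
Proof. by apply/matrixP => i l; rewrite !mxE; do 2!case: ifP. Qed.

Definition destab (K : fieldType) d e T (f : 'M[K]_(d.+1, e.+1)) : Prop :=
  exists2 g, \det g = 1 &
    forall (i : 'I_d.+1) (j : 'I_e.+1), (i + j < T)%N -> act g f i j = 0.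

Lemma act_inj (R : comUnitRingType) d e (g : 'M[R]_2) (f : 'M[R]_(d.+1, e.+1)) :
  \det g = 1 -> act (invmx g) (act g f) = f.
Proof. by move=> Dg; rewrite -actM mulVmx ?act1 // unitmxE Dg unitr1. Qed.

(** Every nonzero [p] is the first row of a matrix of determinant 1. Conversely, the multiplicity at
    [row 0 g] is the least [i + j] with [act g f i j != 0], which exists because [f] is nonzero. *)
Lemma multiplicity_destab (K : closedFieldType) d e T (f : 'M[K]_(d.+1, e.+1)) :
  f != 0 ->
  (exists (p : 'rV[K]_2) (m : nat),
     [/\ p != 0, has_multiplicity f p p m & (T <= m)%N]) <-> destab T f.
Proof.
move=> f0; split=> [[p [m [p0 [Hm _] Tm]]]|[g Dg H]].
  have [g Dg Ep] : exists2 g : 'M[K]_2, \det g = 1 & row 0 g = p.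
    have E (g : 'M[K]_2) : g 0 0 = p 0 0 -> g 0 1 = p 0 1 -> row 0 g = p.
      by move=> g0 g1; apply/rowP => i; rewrite mxE; case: (ord2P i) => ->.
    have [p00|p00] := eqVneq (p 0 0) 0.
      have p01 : p 0 1 != 0.
        apply: contraNneq p0 => p01; apply/eqP/rowP => i; rewrite mxE.
        by case: (ord2P i) => ->.
      exists (mx2 0 (p 0 1) (- (p 0 1)^-1) 0); last by apply: E; rewrite mxE.
      by rewrite det_mx2 mulrN opprK mulfV // mul0r add0r.
    exists (mx2 (p 0 0) (p 0 1) 0 (p 0 0)^-1); last by apply: E; rewrite mxE.
    by rewrite det_mx2 mulr0 subr0 mulfV.
  exists g => // i j ij; rewrite -Ep in Hm.
  by apply: ((vanishes_to_order_row f m Dg).1 Hm); apply: leq_trans Tm.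
pose P h := [exists i : 'I_d.+1, exists j : 'I_e.+1, (i + j == h)%N && (act g f i j != 0)].
have exP : exists h, P h.
  apply: NNPP => N; case/eqP: f0; rewrite -(act_inj f Dg).
  have -> : act g f = 0; last by rewrite act0.
  apply/matrixP => i j; rewrite [RHS]mxE; apply/eqP/contraT => ne; case: N; exists (i + j)%N.
  by apply/existsP; exists i; apply/existsP; exists j; rewrite eqxx.
case: (ex_minnP exP) => m /existsP [i /existsP [j /andP [/eqP ij ne]]] min.
exists (row 0 g), m; split.
- apply: contra_eqT Dg => /negPn/eqP r0; rewrite det2E.
  have g0 c : g 0 c = 0 by have : row 0 g 0 c = 0 by [rewrite r0 mxE]; rewrite mxE.
  by rewrite !g0 !mul0r subrr eq_sym oner_eq0.
- split; first apply/(vanishes_to_order_row f m Dg).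
    move=> i' j' ij'; apply/eqP; apply: contraT => ne'.
    suff : (m <= i' + j')%N by rewrite leqNgt ij'.
    by apply: min; apply/existsP; exists i'; apply/existsP; exists j'; rewrite eqxx.
  move=> m' /(vanishes_to_order_row f m' Dg) H'; rewrite leqNgt; apply/negP => mm'.
  by move: ne; rewrite H' ?eqxx // ij.
- rewrite leqNgt; apply/negP => mT; move: ne; rewrite H ?eqxx // ij //.
Qed.

(** * Partial places of a field *)

Section Places.
Variables (K : closedFieldType) (F : fieldType) (kap : {rmorphism K -> F}).

(* A partially defined place: a subring with a proper ideal of it. *)
Record place := Place {
  reg : F -> Prop;
  small : F -> Prop;
  reg_const : forall c, reg (kap c);
  regD : forall x y, reg x -> reg y -> reg (x + y);
  regM : forall x y, reg x -> reg y -> reg (x * y);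
  small0 : small 0;
  smallW : forall x, small x -> reg x;
  smallD : forall x y, small x -> small y -> small (x + y);
  smallM : forall x y, reg x -> small y -> small (x * y);
  small1 : ~ small 1
}.

(** The residue ring is [K] itself, so regular elements specialize to elements of [K]. *)
Definition rational (p : place) :=
  forall x, reg p x -> exists c, small p (x - kap c).

Definition place_le (p q : place) :=
  (forall x, reg p x -> reg q x) /\ (forall x, small p x -> small q x).

Lemma place_le_trans p q r : place_le p q -> place_le q r -> place_le p r.
Proof. by move=> [a b] [a' b']; split=> x; [move/a/a'|move/b/b']. Qed.

Section PlaceTheory.
Variable p : place.

Lemma reg0 : reg p 0.
Proof. by rewrite -(rmorph0 kap); apply: reg_const. Qed.

Lemma reg1 : reg p 1.
Proof. by rewrite -(rmorph1 kap); apply: reg_const. Qed.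

Lemma regN x : reg p x -> reg p (- x).
Proof. by move=> rx; rewrite -mulN1r -(rmorphN1 kap); apply: regM => //; apply: reg_const. Qed.

Lemma regB x y : reg p x -> reg p y -> reg p (x - y).
Proof. by move=> rx ry; apply: regD => //; apply: regN. Qed.

Lemma regX x n : reg p x -> reg p (x ^+ n).
Proof.
move=> rx; elim: n => [|n IH]; first exact: reg1.
by rewrite exprS; apply: regM.
Qed.

Lemma reg_sum (I : Type) (s : seq I) (P : pred I) (G : I -> F) :
  (forall i, P i -> reg p (G i)) -> reg p (\sum_(i <- s | P i) G i).
Proof. by move=> H; elim/big_ind: _ => //; [apply: reg0 | apply: regD]. Qed.

Lemma smallN x : small p x -> small p (- x).
Proof. by move=> sx; rewrite -mulN1r; apply: smallM => //; apply: regN reg1. Qed.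

Lemma smallB x y : small p x -> small p y -> small p (x - y).
Proof. by move=> sx sy; apply: smallD => //; apply: smallN. Qed.

Lemma smallMr x y : small p x -> reg p y -> small p (x * y).
Proof. by move=> sx ry; rewrite mulrC; apply: smallM. Qed.

Lemma smallX x n : small p x -> (0 < n)%N -> small p (x ^+ n).
Proof. by case: n => // n sx _; rewrite exprSr; apply: smallM => //; apply/regX/smallW. Qed.

Lemma small_const c : small p (kap c) -> c = 0.
Proof.
move=> sc; apply/eqP; apply: contraT => c0; case: (@small1 p).
by rewrite -(rmorph1 kap) -(mulVf c0) rmorphM; apply: smallM sc; apply: reg_const.
Qed.

End PlaceTheory.

(** For [S] the regular elements this is the ring obtained by adjoining [x]; for [S] the small ones
    it is the extension of the ideal to that ring. *)
Definition ev_in (S : F -> Prop) (x y : F) :=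
  exists2 P : {poly F}, (forall i, S P`_i) & P.[x] = y.

Definition revp m (V : {poly F}) : {poly F} := \sum_(i < size V) V`_i *: 'X^(m - i).

Lemma horner_revp m (V : {poly F}) (x : F) : x != 0 -> (size V <= m.+1)%N ->
  (revp m V).[x] = x ^+ m * V.[x^-1].
Proof.
move=> x0 sV; rewrite /revp horner_sum horner_coef mulr_sumr; apply: eq_bigr => i _.
rewrite hornerZ hornerXn mulrCA; congr (_ * _).
have im : (i <= m)%N by have := ltn_ord i; lia.
by rewrite exprVn -{2}(subnK im) exprD mulfK // expf_neq0.
Qed.

Lemma coef_revp (S : F -> Prop) m (V : {poly F}) j : S 0 -> (forall x y, S x -> S y -> S (x + y)) ->
  (forall i, S V`_i) -> S (revp m V)`_j.
Proof.
move=> S0 SD SV; rewrite /revp coef_sum; elim/big_ind: _ => // i _.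
by rewrite coefZ coefXn; case: eqP => _; rewrite ?mulr1 ?mulr0.
Qed.

Lemma size_revp m (V : {poly F}) : V`_0 = 0 -> (0 < m)%N -> (size (revp m V) <= m)%N.
Proof.
move=> V0 m0; apply: (leq_trans (size_sum _ _ _)); apply/bigmax_leqP => i _.
case: (posnP i) => [->|i0]; first by rewrite V0 scale0r size_poly0.
by rewrite (leq_trans (size_scale_leq _ _)) // size_polyXn; lia.
Qed.

Section Extension.
Variables (p : place) (x : F).
Hypothesis x0 : x != 0.

(* Chevalley's argument: the longer of two polynomial relations, in x with small coefficients and
   in 1/x, is shortened by means of the other one. *)
Lemma place_descent (U V : {poly F}) l1 l2 :
  (forall i, small p U`_i) -> (forall i, reg p V`_i) -> V`_0 = 0 ->
  small p (l1 - 1) -> small p (l2 - 1) -> U.[x] = l1 -> V.[x^-1] = l2 -> False.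
Proof.
move: {2}(size U + size V)%N (leqnn (size U + size V)%N) => N.
elim: N U V l1 l2 => [|N IH] U V l1 l2 sUV sU rV V0 s1 s2 EU EV.
  case: (@small1 p); rewrite -[1]opprK; apply: smallN.
  suff -> : -1 = l1 - 1 by [].
  have U0 : U = 0 by apply/eqP; rewrite -size_poly_leq0; lia.
  by rewrite -EU U0 horner0 sub0r.
have rU i : reg p U`_i by apply: smallW.
have sm0 := small0 p.
case: (leqP (size V) 1) => sV.
  case: (@small1 p); rewrite -[1]opprK; apply: smallN.
  have V00 : V = 0 by rewrite (size1_polyC sV) V0.
  by move: s2; rewrite -EV V00 horner0 sub0r.
case: (leqP (size U) 1) => sU1.
  case: (@small1 p); have -> : 1 = l1 - (l1 - 1) by ring.
  by apply: smallB => //; rewrite -EU (size1_polyC sU1) hornerC.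
have [m Em] : exists m, size U = m.+2 by exists (size U).-2; lia.
have [n En] : exists n, size V = n.+2 by exists (size V).-2; lia.
have top (W : {poly F}) k : size W = k.+2 -> (size (W - W`_k.+1 *: 'X^(k.+1))%R <= k.+1)%N.
  move=> Ek; apply/leq_sizeP => j kj; rewrite coefB coefZ coefXn.
  case: (ltngtP j k.+1) => [|j'|->]; first by rewrite ltnNge kj.
    by rewrite nth_default ?Ek // mulr0 subr0.
  by rewrite mulr1 subrr.
have coefT (S : F -> Prop) (W : {poly F}) k : S 0 -> (forall i, S W`_i) ->
    forall i, S (W - W`_k *: 'X^k)`_i.
  move=> S0 SW i; rewrite coefB coefZ coefXn; case: eqP => [->|_].
    by rewrite mulr1 subrr.
  by rewrite mulr0 subr0.
have regl l : small p (l - 1) -> reg p l.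
  by move=> /smallW r; rewrite -(subrK 1 l); apply: regD => //; apply: reg1.
have sl l l' : small p (l - 1) -> small p (l' - 1) -> small p (l * l' - 1).
  move=> a b; have -> : l * l' - 1 = l * (l' - 1) + (l - 1) by ring.
  by apply: smallD => //; apply: smallM => //; apply: regl.
(* The relation of [U] is multiplied by [l2], and [l2 * x ^+ m.+1] is rewritten by the relation of
   [V]; as [V] has no constant term, the degree of [U] drops. The right-hand sides get multiplied,
   so they are only kept congruent to 1. *)
case: (leqP n m) => nm.
  apply: (IH (l2 *: (U - U`_m.+1 *: 'X^(m.+1)) + U`_m.+1 *: revp m.+1 V) V (l1 * l2) l2) => //.
  - suff S1 : (size (l2 *: (U - U`_m.+1 *: 'X^(m.+1)) + U`_m.+1 *: revp m.+1 V)%R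
        <= m.+1)%N by apply: leq_trans (leq_add S1 (leqnn _)) _; lia.
    rewrite (leq_trans (size_polyD _ _)) // geq_max !(leq_trans (size_scale_leq _ _)) ?top //.
    exact: size_revp.
  - move=> i; rewrite coefD !coefZ; apply: smallD.
      by apply: smallM; [apply: regl | apply: coefT].
    by apply: smallMr => //; apply: coef_revp => //; [apply: reg0|apply: regD].
  - exact: sl.
  - rewrite hornerD !hornerZ hornerD hornerN hornerZ hornerXn horner_revp // ?EV ?EU; last first.
      by rewrite En; lia.
    ring.
(* The symmetric case shortens [V]. The constant term of [U] is small, so moving it to the right
   leaves a value congruent to 1, and what remains of [U] has no constant term. *)
pose mu := l1 - U`_0; have smu : small p (mu - 1).
  by have -> : mu - 1 = (l1 - 1) - U`_0 by [rewrite /mu; ring]; apply: smallB.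
pose U1 := U - U`_0 *: 'X^0.
have U10 : U1`_0 = 0 by rewrite /U1 coefB coefZ coefXn eqxx mulr1 subrr.
have EU1 : U1.[x] = mu by rewrite /U1 hornerD hornerN hornerZ hornerXn EU mulr1.
have sU1' : (size U1 <= m.+2)%N.
  rewrite (leq_trans (size_polyD _ _)) // geq_max Em leqnn size_polyN.
  by rewrite (leq_trans (size_scale_leq _ _)) // size_polyXn.
apply: (IH U (mu *: (V - V`_n.+1 *: 'X^(n.+1)) + V`_n.+1 *: revp n.+1 U1) l1 (mu * l2)) => //.
- suff S1 : (size (mu *: (V - V`_n.+1 *: 'X^(n.+1)) + V`_n.+1 *: revp n.+1 U1)%R
        <= n.+1)%N by apply: leq_trans (leq_add (leqnn _) S1) _; lia.
  rewrite (leq_trans (size_polyD _ _)) // geq_max !(leq_trans (size_scale_leq _ _)) ?top //.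
  exact: size_revp.
- move=> i; rewrite coefD !coefZ; apply: regD.
    by apply: regM; [apply: regl | apply: coefT => //; apply: reg0].
  apply: regM => //; apply: coef_revp => //; [exact: reg0|exact: regD|].
  by apply: coefT => //; apply: reg0.
- rewrite coefD !coefZ coefB coefZ coefXn V0 mulr0 subrr mulr0 add0r.
  suff -> : (revp n.+1 U1)`_0 = 0 by rewrite mulr0.
  rewrite /revp coef_sum big1 // => i _; rewrite coefZ coefXn.
  have -> : (0%N == n.+1 - i)%N = false by have := ltn_ord i; lia.
  by rewrite mulr0.
- exact: sl.
- rewrite hornerD !hornerZ hornerD hornerN hornerZ hornerXn horner_revp ?invr_eq0 // ?invrK; last first.
    by lia.
  rewrite EV EU1 exprVn; ring.
Qed.

End Extension.

Section Adjoin.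
Variables (p : place) (x : F).

Lemma ev_in_const (S : F -> Prop) y : S 0 -> S y -> ev_in S x y.
Proof.
move=> S0 Sy; exists y%:P; last by rewrite hornerC.
by move=> i; rewrite coefC; case: eqP.
Qed.

Lemma ev_inD (S : F -> Prop) y z : (forall a b, S a -> S b -> S (a + b)) ->
  ev_in S x y -> ev_in S x z -> ev_in S x (y + z).
Proof.
move=> SD [P SP <-] [Q SQ <-]; exists (P + Q); last by rewrite hornerD.
by move=> i; rewrite coefD; apply: SD.
Qed.

Lemma coef_mul_in (S T : F -> Prop) (P Q : {poly F}) i :
  T 0 -> (forall a b, T a -> T b -> T (a + b)) ->
  (forall a b, S a -> T b -> T (a * b)) ->
  (forall i, S P`_i) -> (forall i, T Q`_i) -> T (P * Q)`_i.
Proof.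
move=> T0 TD TM SP TQ; rewrite coefM; elim/big_ind: _ => // j _; exact: TM.
Qed.

Lemma ev_inM (S T : F -> Prop) y z :
  T 0 -> (forall a b, T a -> T b -> T (a + b)) ->
  (forall a b, S a -> T b -> T (a * b)) ->
  ev_in S x y -> ev_in T x z -> ev_in T x (y * z).
Proof.
move=> T0 TD TM [P SP <-] [Q SQ <-]; exists (P * Q); last by rewrite hornerM.
by move=> i; apply: (@coef_mul_in S).
Qed.

Lemma ev_in_sub (S T : F -> Prop) y : (forall a, S a -> T a) -> ev_in S x y -> ev_in T x y.
Proof. by move=> ST [P SP <-]; exists P => // i; apply: ST. Qed.

Lemma ev_in_gen : ev_in (reg p) x x.
Proof.
exists 'X; last by rewrite hornerX.
by move=> i; rewrite coefX; case: eqP => _; [apply: reg1|apply: reg0].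
Qed.

(** The ideal generated by [x] and the small elements in the ring obtained by adjoining [x]. *)
Definition ev_mixed (y : F) :=
  exists P : {poly F}, [/\ small p P`_0, (forall i, reg p P`_i) & P.[x] = y].

Lemma ev_mixed_small y : small p y -> ev_mixed y.
Proof.
move=> sy; exists y%:P; rewrite coefC eqxx hornerC; split=> // i.
by rewrite coefC; case: eqP => _; [apply: smallW|apply: reg0].
Qed.

Let s0 : small p 0 := small0 p.

Definition adjoin (N1 : ~ ev_in (small p) x 1) : place.
Proof.
refine (@Place (ev_in (reg p) x) (ev_in (small p) x) _ _ _ _ _ _ _ N1).
- by move=> c; apply: ev_in_const; [apply: reg0|apply: reg_const].
- by move=> *; apply: ev_inD => //; apply: regD.
- by move=> *; apply: (@ev_inM (reg p)) => //; [apply: reg0|apply: regD|apply: regM].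
- exact: ev_in_const.
- by move=> y; apply: ev_in_sub; apply: smallW.
- by move=> *; apply: ev_inD => //; apply: smallD.
- by move=> *; apply: (@ev_inM (reg p)) => //; [apply: smallD|apply: smallM].
Defined.

Definition adjoin_small (N1 : ~ ev_mixed 1) : place.
Proof.
refine (@Place (ev_in (reg p) x) ev_mixed _ _ _ _ _ _ _ N1).
- by move=> c; apply: ev_in_const; [apply: reg0|apply: reg_const].
- by move=> *; apply: ev_inD => //; apply: regD.
- by move=> *; apply: (@ev_inM (reg p)) => //; [apply: reg0|apply: regD|apply: regM].
- exact: ev_mixed_small.
- by move=> y [P [_ rP <-]]; exists P.
- move=> y z [P [sP rP <-]] [Q [sQ rQ <-]]; exists (P + Q); rewrite hornerD coefD.
  by split=> // [|i]; [apply: smallD|rewrite coefD; apply: regD].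
- move=> y z [P rP <-] [Q [sQ rQ <-]]; exists (P * Q); rewrite hornerM; split=> // [|i].
    by rewrite coefM big_ord1; apply: smallM.
  by apply: (@coef_mul_in (reg p)) => //; [apply: reg0|apply: regD|apply: regM].
Defined.

Lemma adjoin_le N1 : place_le p (adjoin N1).
Proof. by split=> y H; apply: ev_in_const => //; apply: reg0. Qed.

Lemma adjoin_small_le N1 : place_le p (adjoin_small N1).
Proof.
split=> y H; first by apply: ev_in_const => //; apply: reg0.
exact: ev_mixed_small.
Qed.

Lemma adjoin_small_gen N1 : small (adjoin_small N1) x.
Proof.
exists 'X; rewrite coefX hornerX; split=> // i.
by rewrite coefX; case: eqP => _; [apply: reg1|apply: reg0].
Qed.

Lemma adjoin_small_rational N1 : rational p -> rational (adjoin_small N1).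
Proof.
move=> rat y [P rP <-]; have [c sc] := rat _ (rP 0%N).
exists c, (P - (kap c)%:P); rewrite coefB coefC eqxx hornerD hornerN hornerC; split=> // i.
by rewrite coefB coefC; apply: regB => //; case: eqP => _; [apply: reg_const|apply: reg0].
Qed.

Lemma rational_poly (P : {poly F}) : rational p -> (forall i, reg p P`_i) ->
  exists P0 : {poly K}, forall i, small p (P - map_poly kap P0)`_i.
Proof.
move=> rat; elim/poly_ind: P => [|P c IH] rP.
  by exists 0 => i; rewrite rmorph0 subrr coef0.
have [|P0 HP0] := IH.
  by move=> i; have := rP i.+1; rewrite coefD coefMX coefC addr0.
have [|c0 sc0] := rat c; first by have := rP 0%N; rewrite coefD coefMX coefC add0r.
exists (P0 * 'X + c0%:P) => i.
rewrite rmorphD rmorphM /= map_polyX map_polyC /=.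
have -> : P * 'X + c%:P - (map_poly kap P0 * 'X + (kap c0)%:P)
  = (P - map_poly kap P0) * 'X + (c - kap c0)%:P by rewrite polyCB; ring.
rewrite coefD coefMX coefC; case: i => [|i]; first by rewrite add0r.
by rewrite addr0; apply: HP0.
Qed.

(** The polynomials over [K] whose value at [x] lies in the extended ideal form a proper ideal [I]
    of K[X]. As [K] is algebraically closed, [I] has a common zero [be]; enlarging the ideal by
    [x - kap be] gives [x] the residue [be]. *)
Lemma adjoin_rational (N1 : ~ ev_in (small p) x 1) : rational p ->
  exists q, [/\ place_le (adjoin N1) q, rational q & reg q x].
Proof.
move=> rat; pose I (P : {poly K}) := ev_in (small p) x (map_poly kap P).[x].
have IM P Q : I Q -> I (P * Q).
  rewrite /I rmorphM hornerM => IQ; apply: (@ev_inM (reg p)) => //; try exact: smallD.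
    exact: smallM.
  by exists (map_poly kap P) => // i; rewrite coef_map; apply: reg_const.
have ID P Q : I P -> I Q -> I (P + Q).
  by rewrite /I rmorphD hornerD; apply: ev_inD; apply: smallD.
have [be Hbe] : exists be, forall P, I P -> P.[be] = 0.
  apply: NNPP => N.
  have N' be : exists2 P, I P & P.[be] != 0.
    apply: NNPP => N2; apply: N; exists be => P IP; apply/eqP/contraT => Pb.
    by case: N2; exists P.
  (* Without a common zero, a root of a nonconstant element [P] of [I] fails to be a root of some
     [Q] in [I], and [Q %% P] is a nonzero element of smaller size. *)
  pose sz n := exists P, [/\ I P, P != 0 & (size P <= n)%N].
  have min n : sz n -> False.
    elim: n => [|n IHn] [P [IP P0 sP]]; first by case/eqP: P0; apply/eqP; rewrite -size_poly_leq0.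
    have [s1|s1] := eqVneq (size P) 1%N.
      apply: N1; have /size_poly1P [c c0 Ec] : size P == 1%N by apply/eqP.
      have := IM (c^-1)%:P _ IP; rewrite Ec -polyCM mulVf //.
      by rewrite /I map_polyC hornerC /= rmorph1.
    have /closed_rootP [be /eqP rb] : size P != 1%N by [].
    have [Q IQ Qb] := N' be; apply: IHn; exists (Q %% P); split.
    - have -> : Q %% P = Q + (- (Q %/ P)) * P by rewrite {2}(divp_eq Q P) mulNr addrAC subrr add0r.
      by apply: ID => //; apply: IM.
    - by apply: contraNneq Qb => E; rewrite (divp_eq Q P) E addr0 hornerM rb mulr0.
    - by rewrite -ltnS (leq_trans (ltn_modpN0 _ P0)).
  have [P IP P0] := N' 0; apply: (min (size P)); exists P; split=> //.
  by apply: contraNneq P0 => ->; rewrite horner0.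
pose sm y := exists s t, [/\ ev_in (small p) x s, ev_in (reg p) x t & y = s + (x - kap be) * t].
have rx : ev_in (reg p) x (x - kap be).
  apply: ev_inD; [exact: regD|exact: ev_in_gen|].
  by apply: ev_in_const; [apply: reg0|apply/regN/reg_const].
(* Reducing the coefficients of [T] modulo small elements turns [1 = s + (x - be) T(x)] into an
   element of [I] with value 1 at [be]. *)
have sm1 : ~ sm 1.
  move=> [s [t [Hs [T rT <-] E]]].
  have [T0 HT0] := rational_poly rat rT.
  have : I (1 - ('X - be%:P) * T0).
    rewrite /I rmorphB rmorph1 rmorphM rmorphB /= map_polyX map_polyC hornerD hornerN.
    rewrite hornerM hornerD hornerN hornerC hornerX hornerC /= E.
    have -> : s + (x - kap be) * T.[x] - (x - kap be) * (map_poly kap T0).[x]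
       = s + (x - kap be) * (T - map_poly kap T0).[x].
      by rewrite hornerD hornerN; ring.
    apply: ev_inD => //; first exact: smallD.
    by apply: (@ev_inM (reg p)) => //; [exact: smallD|exact: smallM|exists (T - map_poly kap T0)].
  move/Hbe; rewrite hornerD hornerN hornerM hornerD hornerN hornerX !hornerC subrr mul0r subr0.
  by move/eqP; rewrite oner_eq0.
have rD y z : ev_in (reg p) x y -> ev_in (reg p) x z -> ev_in (reg p) x (y + z).
  by apply: ev_inD; apply: regD.
have rM y z : ev_in (reg p) x y -> ev_in (reg p) x z -> ev_in (reg p) x (y * z).
  by apply: ev_inM; [apply: reg0|apply: regD|apply: regM].
have sub y : ev_in (small p) x y -> ev_in (reg p) x y by apply: ev_in_sub; apply: smallW.
have r0 : ev_in (reg p) x 0 by apply: ev_in_const; apply: reg0.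
have sm_reg y : sm y -> ev_in (reg p) x y.
  by move=> [s [t [Hs Ht ->]]]; apply: rD; [apply: sub|apply: rM].
have sub_sm y : ev_in (small p) x y -> sm y.
  by move=> Hy; exists y, 0; split=> //; rewrite mulr0 addr0.
have smD y z : sm y -> sm z -> sm (y + z).
  move=> [s [t [Hs Ht ->]]] [s' [t' [Hs' Ht' ->]]]; exists (s + s'), (t + t'); split.
  - exact: (@smallD (adjoin N1)).
  - exact: rD.
  - ring.
have smM y z : ev_in (reg p) x y -> sm z -> sm (y * z).
  move=> Hy [s [t [Hs Ht ->]]]; exists (y * s), (y * t); split.
  - exact: (@smallM (adjoin N1)).
  - exact: rM.
  - ring.
exists (Place (@reg_const (adjoin N1)) rD rM (sub_sm _ (small0 (adjoin N1))) sm_reg smD smM sm1).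
split; last exact: ev_in_gen.
- by split.
- move=> y [P rP <-]; have [P0 HP0] := rational_poly rat rP.
  exists P0.[be], (P - map_poly kap P0).[x].
  have /factor_theorem [Q EQ] : root (P0 - P0.[be]%:P) be.
    by rewrite /root hornerD hornerN hornerC subrr.
  exists (map_poly kap Q).[x]; split.
  + by exists (P - map_poly kap P0).
  + by exists (map_poly kap Q) => // i; rewrite coef_map; apply: reg_const.
  + have := congr1 (fun R => (map_poly kap R).[x]) EQ.
    rewrite rmorphB rmorphM rmorphB /= map_polyX !map_polyC hornerM !hornerD !hornerN hornerX !hornerC /=.
    by move=> E; rewrite [(x - _) * _]mulrC -E; ring.
Qed.

End Adjoin.

(** Chevalley's extension step. If the small elements still generate a proper ideal after adjoining
    [x], then [x] becomes regular. Otherwise [place_descent] shows that 1 is not in the ideal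
    obtained by adjoining [x^-1] as a small element; the constant term of a relation in [x^-1] is
    moved to the right to fit that lemma. *)
Theorem place_ext (p : place) (x : F) : exists q,
  [/\ place_le p q, (rational p -> rational q)
    & reg q x \/ (x != 0 /\ small q x^-1)].
Proof.
have [->|x0] := eqVneq x 0; first by exists p; split=> //; left; apply: reg0.
case: (classic (ev_in (small p) x 1)) => [[U sU EU]|N1]; last first.
  case: (classic (rational p)) => [rat|nrat].
    have [q [le rq rx]] := adjoin_rational N1 rat; exists q; split=> //; last by left.
    by apply: place_le_trans le; apply: adjoin_le.
  exists (adjoin N1); split=> //; first exact: adjoin_le.
  by left; apply: ev_in_gen.
have N2 : ~ ev_mixed p x^-1 1.
  move=> [P [sP rP EP]].
  apply: (place_descent x0 (V := P - (P`_0)%:P) (l1 := 1) (l2 := 1 - P`_0) sU _ _ _ _ EU).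
  - move=> i; rewrite coefB coefC; apply: regB => //.
    by case: eqP => _; [apply: rP|apply: reg0].
  - by rewrite coefB coefC eqxx subrr.
  - by rewrite subrr; apply: small0.
  - by rewrite addrAC subrr add0r; apply: smallN.
  - by rewrite hornerD hornerN hornerC EP.
exists (adjoin_small N2); split; first exact: adjoin_small_le.
  exact: adjoin_small_rational.
by right; split=> //; apply: adjoin_small_gen.
Qed.

(** The pivot [x] is an element with the worst pole. Each further element is compared with it by
    applying [place_ext] to the quotient, and replaces it if the quotient has a pole. *)
Lemma place_pivot (p : place) (ys : seq F) : exists q,
  [/\ place_le p q, (rational p -> rational q)
    & (forall y, y \in ys -> reg q y) \/
      (exists x, [/\ x \in ys, x != 0, small q x^-1 & forall y, y \in ys -> reg q (y / x)])].
Proof.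
elim: ys => [|y ys [q [pq rpq H]]]; first by exists p; split=> //; left.
case: H => [H|[x [xys x0 sx H]]].
  have [q' [qq' rqq' H']] := place_ext q y.
  exists q'; split; [exact: place_le_trans qq'|by move=> /rpq/rqq'|].
  case: H' => [ry|[y0 sy]].
    by left=> z; rewrite inE => /orP [/eqP->|/H/(proj1 qq')].
  right; exists y; split; rewrite ?mem_head // => z; rewrite inE => /orP [/eqP->|zy].
    by rewrite divff //; apply: reg1.
  by apply: regM; [apply/(proj1 qq')/H|apply: smallW].
have [q' [qq' rqq' H']] := place_ext q (y / x).
exists q'; split; [exact: place_le_trans qq'|by move=> /rpq/rqq'|right].
case: H' => [ry|[yx0 sy]].
  exists x; split; rewrite ?inE ?xys ?orbT //; first exact: (proj2 qq').
  by move=> z; rewrite inE => /orP [/eqP->//|/H/(proj1 qq')].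
have y0 : y != 0 by apply: contraNneq yx0 => ->; rewrite mul0r.
rewrite invf_div in sy.
exists y; split; rewrite ?mem_head //.
  have -> : y^-1 = x^-1 * (x / y) by field; rewrite x0 y0.
  by apply: smallM => //; apply/smallW/(proj2 qq').
move=> z; rewrite inE => /orP [/eqP->|zy]; first by rewrite divff //; apply: reg1.
have -> : z / y = (z / x) * (x / y) by field; rewrite x0 y0.
by apply: regM; [apply/(proj1 qq')/H|apply: smallW].
Qed.

End Places.

(** * Places at which the generic group element has a pole *)

Section Bezout.
Variables (K : closedFieldType) (I : finType) (P : pred I) (c : I -> {poly K}).

(** The gcd, accumulated by Bezout relations, has no root and is therefore a nonzero constant. *)
Lemma bezout_family : (forall x, exists2 i, P i & (c i).[x] != 0) ->
  exists b : I -> {poly K}, \sum_(i | P i) b i * c i = 1.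
Proof.
move=> H.
have [b Hb] : exists b : I -> {poly K}, forall i, i \in filter P (index_enum I) ->
    (\sum_(j <- filter P (index_enum I)) b j * c j) %| c i.
  have : uniq (filter P (index_enum I)) by rewrite filter_uniq // index_enum_uniq.
  elim: (filter _ _) => [|i r IH] /=; first by exists (fun _ => 0).
  case/andP=> ir /IH [b Hb]; set D := (\sum_(j <- r) _) in Hb.
  have [[u v] /= uv] := Bezoutp (c i) D.
  exists (fun j => if j == i then u else v * b j) => j.
  have -> : \sum_(j <- i :: r) (if j == i then u else v * b j) * c j = u * c i + v * D.
    rewrite big_cons eqxx; congr (_ + _); rewrite /D mulr_sumr big_seq [RHS]big_seq.
    apply: eq_bigr => l lr; case: eqP => [E|_]; last by rewrite mulrA.
    by rewrite -E lr in ir.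
  rewrite (eqp_dvdl _ uv) inE => /orP [/eqP->|jr]; first exact: dvdp_gcdl.
  by apply: dvdp_trans (Hb _ jr); apply: dvdp_gcdr.
set D := (\sum_(j <- _) _) in Hb.
have ED : \sum_(i | P i) b i * c i = D by rewrite /D big_filter.
have sD : size D == 1%N.
  apply: contraT => /closed_rootP [x /rootP Dx]; have [i Pi] := H x.
  have /Hb /dvdpP [q ->] : i \in filter P (index_enum I) by rewrite mem_filter Pi mem_index_enum.
  by rewrite hornerM Dx mulr0 eqxx.
have [a a0 Ea] := size_poly1P _ sD.
exists (fun i => (a^-1)%:P * b i).
rewrite (eq_bigr (fun i => (a^-1)%:P * (b i * c i))) => [|i _]; last by rewrite mulrA.
by rewrite -mulr_sumr ED Ea -polyCM mulVf.
Qed.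

End Bezout.

Section ChartPolynomials.
Variables (K : closedFieldType) (d e : nat).
Implicit Types (f : 'M[K]_(d.+1, e.+1)).

Definition chart_poly f i j : {poly K} :=
  act (mx2 1 'X 0 1) (map_mx polyC f) i j.

Lemma chart_polyE (A : comNzRingType) (kap : {rmorphism K -> A}) f i j u :
  (map_poly kap (chart_poly f i j)).[u] = act (mx2 1 u 0 1) (map_mx kap f) i j.
Proof.
have -> : (map_poly kap (chart_poly f i j)).[u] =
  map_mx (horner_eval u \o map_poly kap) (act (mx2 1 'X 0 1) (map_mx polyC f)) i j.
  by rewrite mxE.
rewrite map_act map_mx2 /= /horner_eval !rmorph1 !rmorph0 map_polyX hornerX hornerC horner0.
suff -> : map_mx (fun q => (map_poly kap q).[u]) (map_mx polyC f) = map_mx kap f by [].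
by apply/matrixP => k l; rewrite !mxE map_polyC hornerC.
Qed.

(** A common zero [u] of these polynomials would make [mx2 1 u 0 1] a destabilizing matrix. *)
Lemma chart_bezout T f : ~ destab T f ->
  exists b : 'I_d.+1 * 'I_e.+1 -> {poly K},
    \sum_(i : 'I_d.+1 * 'I_e.+1 | (i.1 + i.2 < T)%N) b i * chart_poly f i.1 i.2 = 1.
Proof.
move=> N; apply: bezout_family => u; apply: NNPP => N2; apply: N.
exists (mx2 1 u 0 1); first by rewrite det_mx2 mulr1 mulr0 subr0.
move=> i j ij; apply/eqP/contraT => ne; case: N2; exists (i, j) => //=.
have := chart_polyE idfun f i j u; rewrite map_poly_id // => ->.
by rewrite map_mx_id.
Qed.

Lemma destab_act T f (g : 'M[K]_2) : \det g = 1 -> destab T (act g f) -> destab T f.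
Proof.
move=> Dg [h Dh H]; exists (h *m g); first by rewrite det_mulmx Dg Dh mulr1.
by move=> i j ij; rewrite actM; apply: H.
Qed.

End ChartPolynomials.

Section PlaceAction.
Variables (K : closedFieldType) (F : fieldType) (kap : {rmorphism K -> F}) (p : place kap).
Variables (d e : nat).

Lemma reg_sym_mx D (g : 'M[F]_2) i k : (forall i j, reg p (g i j)) -> reg p (sym_mx D g i k).
Proof.
move=> rg; rewrite mxE /sym_poly.
have rlin a b l : reg p a -> reg p b -> reg p (lin a b)`_l.
  move=> ra rb; rewrite /lin coefD coefC coefZ coefX; apply: regD.
    by case: eqP => _ //; apply: reg0.
  by apply: regM => //; case: eqP => _; [apply: reg1|apply: reg0].
have mul (P Q : {poly F}) : (forall i, reg p P`_i) -> (forall i, reg p Q`_i) ->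
    forall i, reg p (P * Q)`_i.
  by move=> rP rQ l; apply: (coef_mul_in (S := reg p)) => //; [apply: reg0|apply: regD|apply: regM].
have exp (P : {poly F}) n : (forall i, reg p P`_i) -> forall i, reg p (P ^+ n)`_i.
  move=> rP; elim: n => [|n IH]; last by rewrite exprS; apply: mul.
  by move=> l; rewrite coef1; case: eqP => _; [apply: reg1|apply: reg0].
by apply: mul; apply: exp => l; apply: rlin.
Qed.

Lemma reg_act (g : 'M[F]_2) (a : 'M[F]_(d.+1, e.+1)) i j :
  (forall i j, reg p (g i j)) -> (forall i j, reg p (a i j)) -> reg p (act g a i j).
Proof.
move=> rg ra; rewrite actE; apply: reg_sum => k _; apply: reg_sum => l _.
by apply: regM; [apply: regM => //|]; apply: reg_sym_mx.
Qed.

Lemma small_act (g : 'M[F]_2) (a : 'M[F]_(d.+1, e.+1)) i j :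
  (forall i j, reg p (g i j)) -> (forall i j, small p (a i j)) -> small p (act g a i j).
Proof.
move=> rg ra; rewrite actE; elim/big_ind: _ => [|x y|k _]; [exact: small0|exact: smallD|].
elim/big_ind: _ => [|x y|l _]; [exact: small0|exact: smallD|].
by apply: smallMr; [apply: smallMr => //|]; apply: reg_sym_mx.
Qed.

Lemma reg_mx2 a b c e' : reg p a -> reg p b -> reg p c -> reg p e' ->
  forall i j, reg p (mx2 a b c e' i j).
Proof. by move=> *; rewrite mxE; do 2!case: ifP. Qed.

(* Write g as a lower unipotent matrix times diag(g00, D / g00) times mx2 1 u 0 1.  If g00 has a
   pole, the coefficients of f moved by mx2 1 u 0 1 of index i + j < T are small, although by
   Bezout they generate the unit ideal. *)
Lemma pivot00_absurd T (f : 'M[K]_(d.+1, e.+1)) (g : 'M[F]_2) :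
  let G := act g (map_mx kap f) in
  \det g != 0 -> reg p (\det g)^-1 -> g 0 0 != 0 -> small p (g 0 0)^-1 ->
  reg p (g 0 1 / g 0 0) -> reg p (g 1 0 / g 0 0) -> ~ destab T f ->
  ((forall i j, reg p (G i j)) /\ (forall h, (h < T)%N -> (h.*2 < d + e)%N)) \/
  ((forall i j, small p (G i j)) /\ (forall h, (h < T)%N -> (h.*2 <= d + e)%N)) -> False.
Proof.
move=> G D0 rD g0 st ru rv /chart_bezout [b Eb] HG.
set u := g 0 1 / g 0 0 in ru; set v := g 1 0 / g 0 0 in rv; set D := \det g in D0 rD.
set t := (g 0 0)^-1 in st.
have main (i : 'I_d.+1) (j : 'I_e.+1) : (i + j < T)%N -> small p (map_poly kap (chart_poly f i j)).[u].
  move=> ij; rewrite chart_polyE.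
  have E : act (mx2 1 0 (- v) 1) G i j =
     g 0 0 ^+ ((d - i) + (e - j)) * (D / g 0 0) ^+ (i + j) * act (mx2 1 u 0 1) (map_mx kap f) i j.
    rewrite /G -actM.
    have -> : mx2 1 0 (- v) 1 *m g = mx2 (g 0 0) 0 0 (D / g 0 0) *m mx2 1 u 0 1.
      rewrite /D det2E [g]mx2_eta; apply/matrixP => r s; rewrite !mulmx2E.
      by case: (ord2P r) => ->; case: (ord2P s) => ->; rewrite !mxE /= /u /v; field.
    by rewrite actM act_diag ?mxE.
  have Eij : ((d - i) + (e - j) = (d + e) - (i + j))%N.
    by have := ltn_ord i; have := ltn_ord j; lia.
  have rL : forall r s, reg p (mx2 1 0 (- v) 1 r s).
    by apply: reg_mx2; [apply: reg1|apply: reg0|apply: regN|apply: reg1].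
  have h2 : ((i + j).*2 <= d + e)%N.
    by case: HG => -[_ H]; have := H _ ij; lia.
  (* The diagonal factor has weight g00^(d+e-2(i+j)) D^(i+j). Dividing by it leaves a power of [t]
     that is positive in the first alternative and nonnegative in the second, where smallness of [G]
     takes over. *)
  have -> : act (mx2 1 u 0 1) (map_mx kap f) i j =
     act (mx2 1 0 (- v) 1) G i j * (D^-1 ^+ (i + j) * t ^+ ((d + e) - (i + j).*2)).
    rewrite E Eij.
    have -> : ((d + e) - (i + j) = ((d + e) - (i + j).*2) + (i + j))%N by lia.
    rewrite exprD exprMn /t !exprVn; field.
    by rewrite !expf_neq0.
  case: HG => -[rG H].
    apply: smallM; first exact: reg_act.
    apply: smallM; first exact: regX.
    by apply: smallX => //; have := H _ ij; lia.
  apply: smallMr; first exact: small_act.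
  by apply: regM; apply: regX => //; apply: smallW.
apply: (@small1 _ _ _ p).
have := congr1 (fun P => (map_poly kap P).[u]) Eb.
rewrite rmorph1 hornerC rmorph_sum horner_sum => <-.
elim/big_ind: _ => [|x y|i ij]; [exact: small0|exact: smallD|].
rewrite rmorphM hornerM; apply: smallM; last exact: main.
rewrite horner_coef; apply: reg_sum => l _; rewrite coef_map; apply: regM; last exact: regX.
exact: reg_const.
Qed.

(** Multiplication on both sides by constant Weyl matrices moves the pivot to position [0 0] up to
    sign. It keeps the determinant, and constant matrices of determinant 1 preserve regularity,
    smallness and the hypothesis on [f]. *)
Lemma pivot_absurd T (f : 'M[K]_(d.+1, e.+1)) (g : 'M[F]_2) r s :
  let G := act g (map_mx kap f) in
  \det g != 0 -> reg p (\det g)^-1 -> g r s != 0 -> small p (g r s)^-1 ->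
  (forall i j, reg p (g i j / g r s)) -> ~ destab T f ->
  ((forall i j, reg p (G i j)) /\ (forall h, (h < T)%N -> (h.*2 < d + e)%N)) \/
  ((forall i j, small p (G i j)) /\ (forall h, (h < T)%N -> (h.*2 <= d + e)%N)) -> False.
Proof.
move=> G D0 rD grs st rg N HG.
pose W : 'M[K]_2 := mx2 0 1 (-1) 0.
have DW : \det W = 1 by rewrite det_mx2 mul0r sub0r mulrN1 opprK.
have uW : W \in unitmx by rewrite unitmxE DW unitr1.
pose w1 : 'M[K]_2 := if r == 0 then 1%:M else W.
pose w2 : 'M[K]_2 := if s == 0 then 1%:M else W.
have Dw1 : \det w1 = 1 by rewrite /w1; case: ifP; rewrite ?det1.
have Dw2 : \det w2 = 1 by rewrite /w2; case: ifP; rewrite ?det1.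
have uw2 : w2 \in unitmx by rewrite unitmxE Dw2 unitr1.
pose g' := map_mx kap w1 *m g *m map_mx kap w2.
pose f' := act (invmx w2) f.
have EG : act g' (map_mx kap f') = act (map_mx kap w1) G.
  rewrite /g' /f' map_act -actM -[_ *m map_mx kap w2 *m _]mulmxA -map_mxM mulmxV //.
  by rewrite map_mx1 mulmx1 actM.
have Dg' : \det g' = \det g.
  by rewrite /g' !det_mulmx !det_map_mx Dw1 Dw2 rmorph1 mul1r mulr1.
have rw1 i j : reg p (map_mx kap w1 i j) by rewrite mxE; apply: reg_const.
have sg (b : bool) : (-1) ^+ b != 0 :> F by rewrite signr_eq0.
have rsg (b : bool) : reg p ((-1) ^+ b) by apply: regX; apply: regN (reg1 p).
have [[b0 E00] [b1 [j1 E01]] [b2 [i2 E10]]] :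
  [/\ exists b : bool, g' 0 0 = (-1) ^+ b * g r s,
      exists (b : bool) j, g' 0 1 = (-1) ^+ b * g r j
    & exists (b : bool) i, g' 1 0 = (-1) ^+ b * g i s].
  rewrite /g' /w1 /w2 /W.
  case: (ord2P r) => ->; case: (ord2P s) => -> /=;
    rewrite ?map_mx1 ?mul1mx ?mulmx1 ?map_mx2 ?rmorphN ?rmorph1 ?rmorph0.
  - by split; [exists false|exists false, 1|exists false, 1]; rewrite mul1r.
  - split; [exists true|exists false, 0|exists true, 1];
      rewrite mulmx2E !mxE /= ?expr1 ?expr0; ring.
  - split; [exists false|exists false, 1|exists true, 0];
      rewrite mulmx2E !mxE /= ?expr1 ?expr0; ring.
  - split; [exists true|exists false, 0|exists false, 0];
      rewrite !mulmx2E !mxE /= ?expr1 ?expr0; ring.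
apply: (@pivot00_absurd T f' g'); rewrite ?Dg' ?E00 //.
- by rewrite mulf_neq0.
- by rewrite invfM invr_sign; apply: smallM.
- rewrite E01 -mulf_div; apply: regM => //.
  by apply: regM => //; rewrite invr_sign.
- rewrite E10 -mulf_div; apply: regM => //.
  by apply: regM => //; rewrite invr_sign.
- by move=> H; apply: N; apply: destab_act H; rewrite det_inv Dw2 invr1.
- rewrite EG; case: HG => -[H1 H2]; [left|right]; split=> // i j; [exact: reg_act|exact: small_act].
Qed.

End PlaceAction.

(** * The Omega functional *)

Section Grading.
Variables (A : comNzRingType) (G : nat -> A -> Prop).
Hypotheses (G0 : forall n, G n 0) (G1 : G 0 1)
  (GD : forall n x y, G n x -> G n y -> G n (x + y))
  (GM : forall n m x y, G n x -> G m y -> G (n + m) (x * y)).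

Lemma graded_sum n (I : Type) (s : seq I) (P : pred I) F :
  (forall i, P i -> G n (F i)) -> G n (\sum_(i <- s | P i) F i).
Proof. by move=> H; elim/big_ind: _ => //; apply: GD. Qed.

Lemma gradedX n x k : G n x -> G (k * n) (x ^+ k).
Proof.
move=> Gx; elim: k => [|k IH]; first by rewrite mul0n expr0.
by rewrite exprS mulSn; apply: GM.
Qed.

Lemma graded_polyM n m (P Q : {poly A}) : (forall i, G n P`_i) -> (forall i, G m Q`_i) ->
  forall i, G (n + m) (P * Q)`_i.
Proof. by move=> GP GQ i; rewrite coefM; apply: graded_sum => j _; apply: GM. Qed.

Lemma graded_polyX n (P : {poly A}) k : (forall i, G n P`_i) ->
  forall i, G (k * n) (P ^+ k)`_i.
Proof.
move=> GP; elim: k => [|k IH] i; last by rewrite exprS mulSn; apply: graded_polyM.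
by rewrite mul0n expr0 coef1; case: eqP.
Qed.

Lemma graded_sym_mx r D (g : 'M[A]_2) i k : (forall i j, G r (g i j)) ->
  G (D * r) (sym_mx D g i k).
Proof.
move=> Gg; have kD := leq_ord k; rewrite mxE /sym_poly -{1}(subnK kD) mulnDl.
have Glin a b l : G r a -> G r b -> G r (lin a b)`_l.
  move=> Ga Gb; rewrite /lin coefD coefC coefZ coefX.
  by apply: GD; [case: eqP|case: eqP; rewrite ?mulr1 ?mulr0].
by apply: graded_polyM; apply: graded_polyX => l; apply: Glin.
Qed.

(** [G] is abstract because the same bookkeeping serves homogeneous polynomials, polynomials whose
    coefficients are all homogeneous and, with [G] independent of the degree, membership in a
    subring. *)
Lemma graded_act r m d e (g : 'M[A]_2) (a : 'M[A]_(d.+1, e.+1)) i j :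
  (forall i j, G r (g i j)) -> (forall i j, G m (a i j)) ->
  G (m + d * r + e * r) (act g a i j).
Proof.
move=> Gg Ga; rewrite actE; apply: graded_sum => k _; apply: graded_sum => l _.
by apply: GM; [apply: GM => //|]; apply: graded_sym_mx.
Qed.

Lemma graded_mmap (R : nzRingType) n (j : R -> A) (x : 'I_n -> A) s m (P : {mpoly R[n]}) :
  (forall c, G 0 (j c)) -> (forall i, G s (x i)) -> P \is m.-homog -> G (m * s) (mmap j x P).
Proof.
move=> Gj Gx /dhomogP hP; rewrite /mmap big_seq; apply: graded_sum => mu /hP E.
rewrite -E -[(mdeg mu * s)%N]add0n; apply: GM => //.
rewrite /mmap1 mdegE big_distrl /=.
elim/big_rec2: _ => // i y1 y2 _ IH; apply: GM => //; exact: gradedX.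
Qed.

End Grading.

Section HomogeneousAction.
Variables (A : comNzRingType) (n : nat).
Let G m (q : {mpoly A[n]}) := q \is m.-homog.
Let GD m (x y : {mpoly A[n]}) : G m x -> G m y -> G m (x + y). Proof. exact: rpredD. Qed.
Let GM m m' (x y : {mpoly A[n]}) : G m x -> G m' y -> G (m + m') (x * y).
Proof. exact: dhomogM. Qed.

Lemma dhomogC c : (c%:MP : {mpoly A[n]}) \is 0.-homog.
Proof. by rewrite -[c]mulr1 mpolyCM mul_mpolyC rpredZ // dhomog1. Qed.

Lemma dhomog_act r m d e (g : 'M[{mpoly A[n]}]_2) (a : 'M[{mpoly A[n]}]_(d.+1, e.+1)) i j :
  (forall i j, g i j \is r.-homog) -> (forall i j, a i j \is m.-homog) ->
  act g a i j \is (m + d * r + e * r).-homog.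
Proof. by apply: (graded_act (G := G)) => // [l|]; [apply: rpred0|apply: dhomog1]. Qed.

Lemma dhomog_mmap (R : nzRingType) N (j : R -> A) (x : 'I_N -> {mpoly A[n]}) s m (P : {mpoly R[N]}) :
  (forall i, x i \is s.-homog) -> P \is m.-homog ->
  mmap (@mpolyC n A \o j) x P \is (m * s).-homog.
Proof.
apply: (graded_mmap (G := G)) => // [l||c]; [exact: rpred0|exact: dhomog1|exact: dhomogC].
Qed.

End HomogeneousAction.

Section LinearFunctional.
Variables (R : comNzRingType) (n : nat) (l : 'X_{1..n} -> R).

Definition mfun (p : {mpoly R[n]}) : R := \sum_(m <- msupp p) p@_m * l m.

Lemma mfunE k p : (msize p <= k)%N -> mfun p = \sum_(m : 'X_{1..n < k}) p@_m * l m.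
Proof.
move=> le_pi; set I : subFinType _ := 'X_{1..n < k}.
rewrite /mfun (big_mksub I) ?msupp_uniq //=; first last.
  by move=> x /msize_mdeg_lt /leq_trans; apply.
by rewrite big_rmcond //= => j /memN_msupp_eq0 ->; rewrite mul0r.
Qed.

Lemma mfun_is_linear : linear_for *%R mfun.
Proof.
move=> c p q; pose k := maxn (msize (c *: p + q)) (maxn (msize p) (msize q)).
rewrite !(@mfunE k) ?leq_max ?leqnn ?orbT // mulr_sumr -big_split /=.
by apply: eq_bigr => m _; rewrite mcoeffD mcoeffZ mulrDl mulrA.
Qed.

HB.instance Definition _ := GRing.isLinear.Build R {mpoly R[n]} R *%R mfun mfun_is_linear.

Lemma mfunX m : mfun 'X_[m] = l m.
Proof. by rewrite /mfun msuppX big_seq1 mcoeffX eqxx mul1r. Qed.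

End LinearFunctional.

Lemma linear_mpoly_eq (R : comNzRingType) n (f g : {mpoly R[n]} -> R) :
  linear_for *%R f -> linear_for *%R g -> (forall m, f 'X_[m] = g 'X_[m]) -> f =1 g.
Proof.
move=> lf lg E p; have z (h : {mpoly R[n]} -> R) : linear_for *%R h -> h 0 = 0.
  by move=> lh; have := lh (-1) 0 0; rewrite scaler0 add0r mulN1r addNr.
elim/mpolyind: p => [|c m p _ _ IH]; first by rewrite !z.
by rewrite lf lg IH E.
Qed.

(** The chain rule: the identity passes to products and linear combinations, so variables
    suffice. *)
Lemma mderiv_comp (R : comNzRingType) n k (p : {mpoly R[n]}) (t : n.-tuple {mpoly R[k]}) i :
  (p \mPo t)^`M(i) = \sum_l (p^`M(l) \mPo t) * (tnth t l)^`M(i).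
Proof.
pose P q := (q \mPo t)^`M(i) = \sum_l (q^`M(l) \mPo t) * (tnth t l)^`M(i).
have PM q r : P q -> P r -> P (q * r).
  rewrite /P rmorphM mderivM => -> ->; rewrite mulr_suml mulr_sumr -big_split /=.
  by apply: eq_bigr => l _; rewrite mderivM rmorphD !rmorphM /=; ring.
have PX l : P 'X_l.
  rewrite /P comp_mpolyXU -tnth_nth (bigD1 l) //= big1 ?addr0.
    have UU : (U_(l) - U_(l) = 0)%MM by apply/mnmP => a; rewrite mnmBE mnm0E subnn.
    by rewrite mderivX mnm1E eqxx scale1r UU mpolyX0 comp_mpoly1 mul1r.
  move=> l' /negbTE ll; rewrite mderivX mnm1E eq_sym ll scale0r comp_mpoly0 mul0r //.
have P1 : P 1.
  rewrite /P comp_mpoly1 -mpolyC1 mderivC big1 // => l _.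
  by rewrite mderivC comp_mpoly0 mul0r.
have PXm m : P 'X_[m].
  rewrite mpolyXE_id; elim/big_ind: _ => // l _.
  by elim: (m l) => [|a IH] //; rewrite exprS; apply: PM.
rewrite -/(P p); elim/mpolyind: p => [|c m p _ _ IH].
  rewrite /P comp_mpoly0 mderiv0 big1 // => l _.
  by rewrite mderiv0 comp_mpoly0 mul0r.
rewrite /P comp_mpolyD comp_mpolyZ mderivD mderivZ (PXm m) IH scaler_sumr -big_split /=.
by apply: eq_bigr => l _; rewrite mderivD mderivZ comp_mpolyD comp_mpolyZ mulrDl scalerAl.
Qed.

Definition o0 : 'I_4 := @Ordinal 4 0 isT.
Definition o1 : 'I_4 := @Ordinal 4 1 isT.
Definition o2 : 'I_4 := @Ordinal 4 2 isT.
Definition o3 : 'I_4 := @Ordinal 4 3 isT.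

Lemma ord4P (i : 'I_4) : [\/ i = o0, i = o1, i = o2 | i = o3].
Proof.
by case: i => [[|[|[|[|//]]]] ?];
  [constructor 1|constructor 2|constructor 3|constructor 4]; apply: val_inj.
Qed.

Lemma big_ord4 (V : nmodType) (F : 'I_4 -> V) :
  \sum_i F i = F o0 + F o1 + F o2 + F o3.
Proof.
rewrite !big_ord_recl big_ord0 addr0 !addrA.
by congr (F _ + F _ + F _ + F _); apply: val_inj.
Qed.

Section OmegaFunctional.
Variable R : comNzRingType.
Implicit Types (p q : {mpoly R[4]}) (m : 'X_{1..4}).

(* Up to normalisation, applying Cayley's Omega operator until a constant is
   left: the functional p |-> p(d/da, d/db, d/dc, d/dd) exp(ad - bc) at 0. *)
Definition omega_mono m : R :=
  if (m o0 == m o3) && (m o1 == m o2) then (-1) ^+ m o1 * ((m o0)`! * (m o1)`!)%:R else 0.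

Definition omega : {mpoly R[4]} -> R := mfun omega_mono.

HB.instance Definition _ := GRing.Linear.on omega.

Lemma omegaD p q : omega (p + q) = omega p + omega q.
Proof. exact: linearD. Qed.

Lemma omegaZ c p : omega (c *: p) = c * omega p.
Proof. exact: linearZ. Qed.

Lemma omegaX m : omega 'X_[m] = omega_mono m.
Proof. exact: mfunX. Qed.

(** For entries a, b, c, d, differentiating exp(ad - bc) by a multiplies it by d, and at 0 such a
    factor turns into differentiation of the symbol [p]. So multiplying by an entry amounts, up to
    sign, to differentiating by the opposite one. *)
Lemma omega_parts i i' (sg : R) p :
  (forall m, omega_mono (U_(i) + m) = sg * ((m i')%:R * omega_mono (m - U_(i')))) ->
  omega ('X_i * p) = sg * omega p^`M(i').
Proof.
move=> H; apply: (@linear_mpoly_eq _ _ (fun p => omega ('X_i * p)) (fun p => sg * omega p^`M(i'))).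
- by move=> c q r; rewrite mulrDr -scalerAr linearP.
- by move=> c q r; rewrite mderivD mderivZ linearP /= mulrDr !mulrA [sg * c]mulrC.
- by move=> m /=; rewrite -mpolyXD omegaX H mderivX linearZ /= omegaX.
Qed.

Let mE := (@mnmDE 4, @mnmBE 4, @mnm1E 4).

Lemma omega_parts0 p : omega ('X_o0 * p) = omega p^`M(o3).
Proof.
rewrite -[RHS]mul1r; apply: omega_parts => m; rewrite /omega_mono !mE /= mul1r !add0n !subn0.
case: (m o3) => [|a]; first by rewrite mul0r.
rewrite subn1 /= add1n eqSS; case: ifP => [/andP[/eqP-> _]|_]; last by rewrite mulr0.
by rewrite factS !natrM; ring.
Qed.

Lemma omega_parts3 p : omega ('X_o3 * p) = omega p^`M(o0).
Proof.
rewrite -[RHS]mul1r; apply: omega_parts => m; rewrite /omega_mono !mE /= mul1r !add0n !subn0.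
case: (m o0) => [|a]; first by rewrite mul0r.
rewrite subn1 /= add1n eqSS; case: ifP => [/andP[/eqP-> _]|_]; last by rewrite mulr0.
by rewrite factS !natrM; ring.
Qed.

Lemma omega_parts1 p : omega ('X_o1 * p) = - omega p^`M(o2).
Proof.
rewrite -mulN1r; apply: omega_parts => m; rewrite /omega_mono !mE /= !add0n !subn0.
case: (m o2) => [|a]; first by rewrite add1n andbF mul0r mulr0.
rewrite subn1 /= add1n eqSS; case: ifP => [/andP[_ /eqP->]|_]; last by rewrite !mulr0.
by rewrite factS !natrM exprS; ring.
Qed.

Lemma omega_parts2 p : omega ('X_o2 * p) = - omega p^`M(o1).
Proof.
rewrite -mulN1r; apply: omega_parts => m; rewrite /omega_mono !mE /= !add0n !subn0.
case: (m o1) => [|a]; first by rewrite add1n andbF mul0r mulr0.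
rewrite subn1 /= add1n eqSS; case: ifP => [/andP[_ /eqP->]|_]; last by rewrite !mulr0.
by rewrite factS !natrM exprS; ring.
Qed.

Definition gmx : 'M[{mpoly R[4]}]_2 := mx2 'X_o0 'X_o1 'X_o2 'X_o3.

Definition mx_entry (g : 'M[R]_2) : 'I_4 -> R :=
  fun i => [tuple g 0 0; g 0 1; g 1 0; g 1 1]`_i.

Definition right_subst (h : 'M[R]_2) : 4.-tuple {mpoly R[4]} :=
  let m := gmx *m map_mx (@mpolyC 4 R) h in [tuple m 0 0; m 0 1; m 1 0; m 1 1].

(** The exponential in Omega involves only the determinant, which right multiplication by [h]
    preserves. Formally, by induction on the degree, a variable is split off a monomial and
    integrated by parts, and the chain rule brings back the substituted derivatives, of lower
    degree. *)
Lemma omega_right_subst h p : \det h = 1 -> omega (p \mPo right_subst h) = omega p.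
Proof.
rewrite det2E => Dh.
have [s0 s1 s2 s3] : [/\ tnth (right_subst h) o0 = h 0 0 *: 'X_o0 + h 1 0 *: 'X_o1,
    tnth (right_subst h) o1 = h 0 1 *: 'X_o0 + h 1 1 *: 'X_o1,
    tnth (right_subst h) o2 = h 0 0 *: 'X_o2 + h 1 0 *: 'X_o3
  & tnth (right_subst h) o3 = h 0 1 *: 'X_o2 + h 1 1 *: 'X_o3].
  by rewrite /right_subst !(tnth_nth 0) /= !mulmx2E !mxE /= -!mul_mpolyC ![_%:MP * _]mulrC.
have dX (i l : 'I_4) : ('X_l : {mpoly R[4]})^`M(i) = (l == i)%:R.
  rewrite mderivX mnm1E; case: eqP => [->|_]; last by rewrite scale0r.
  have -> : (U_(i) - U_(i) = 0)%MM by apply/mnmP => a; rewrite mnmBE mnm0E subnn.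
  by rewrite mpolyX0 scale1r.
have dE (q : {mpoly R[4]}) : let s := right_subst h in
   [/\ (q \mPo s)^`M(o0) = h 0 0 *: (q^`M(o0) \mPo s) + h 0 1 *: (q^`M(o1) \mPo s),
       (q \mPo s)^`M(o1) = h 1 0 *: (q^`M(o0) \mPo s) + h 1 1 *: (q^`M(o1) \mPo s),
       (q \mPo s)^`M(o2) = h 0 0 *: (q^`M(o2) \mPo s) + h 0 1 *: (q^`M(o3) \mPo s)
     & (q \mPo s)^`M(o3) = h 1 0 *: (q^`M(o2) \mPo s) + h 1 1 *: (q^`M(o3) \mPo s)].
  by split; rewrite mderiv_comp big_ord4 s0 s1 s2 s3 !mderivD !mderivZ !dX /=
    -!mul_mpolyC; ring.
apply: (@linear_mpoly_eq _ _ (fun p => omega (p \mPo right_subst h)) omega).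
- by move=> c q r; rewrite comp_mpolyD comp_mpolyZ linearP.
- by move=> c q r; rewrite linearP.
move=> m; move: {2}(mdeg m) (erefl (mdeg m)) => N; elim/ltn_ind: N m => N IH m EN.
have [m0|m0] := eqVneq m 0%MM; first by rewrite m0 mpolyX0 comp_mpoly1.
have [i mi] : exists i, m i != 0%N.
  apply: NNPP => H; case/eqP: m0; apply/mnmP => i; rewrite mnm0E; apply/eqP/contraT => mi.
  by case: H; exists i.
have Em : m = (U_(i) + (m - U_(i)))%MM by rewrite addmC submK //; apply/mnm_lepP => l; rewrite mnm1E; case: eqP => // <-; rewrite lt0n.
set m' := (m - U_(i))%MM in Em; have dm' : (mdeg m' < N)%N by rewrite -EN Em mdegD mdeg1.
have IH' l : omega ('X_[m']^`M(l) \mPo right_subst h) = omega ('X_[m']^`M(l)).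
  rewrite mderivX comp_mpolyZ !linearZ /=; case: (posnP (m' l)) => [->|_]; first by rewrite !mul0r.
  congr (_ * _); apply: (IH (mdeg (m' - U_(l))%MM)) => //; apply: leq_ltn_trans dm'.
  exact: mdegB.
rewrite Em mpolyXD rmorphM /= comp_mpolyXU -tnth_nth.
pose B l := 'X_[m']^`M(l) \mPo right_subst h.
have BE l : omega 'X_[m']^`M(l) = omega (B l) by rewrite -IH'.
have := dE 'X_[m']; rewrite /= -/(B o0) -/(B o1) -/(B o2) -/(B o3).
move: B BE ('X_[m'] \mPo right_subst h) => B BE C [d0 d1 d2 d3].
(* Multiplying the right-hand side by [\det h = 1] makes both sides the same polynomial in the
   entries of [h]. *)
have D1 x : x = (h 0 0 * h 1 1 - h 0 1 * h 1 0) * x by rewrite Dh mul1r.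
case: (ord4P i) => ->; rewrite ?s0 ?s1 ?s2 ?s3 mulrDl -!scalerAl omegaD !omegaZ
  ?omega_parts0 ?omega_parts1 ?omega_parts2 ?omega_parts3 ?d0 ?d1 ?d2 ?d3
  !omegaD !omegaZ !BE [RHS]D1; ring.
Qed.

End OmegaFunctional.

Section NormalizedOmega.
Variable K : fieldType.
Hypothesis char0 : [pchar K] =i pred0.
Implicit Types (p q : {mpoly K[4]}).

(** Multiplication by the determinant multiplies [omega] by [n + 2] on monomials of degree [2 n] on
    which it is nonzero. Division by [(n + 1)!] absorbs this factor and keeps the value 1 at 1. *)
Definition omegan : {mpoly K[4]} -> K :=
  mfun (fun m => omega_mono K m / ((m o0 + m o1).+1)`!%:R).

HB.instance Definition _ := GRing.Linear.on omegan.

Lemma omeganX m : omegan 'X_[m] = omega_mono K m / ((m o0 + m o1).+1)`!%:R.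
Proof. exact: mfunX. Qed.

Lemma omeganB p q : omegan (p - q) = omegan p - omegan q.
Proof. exact: linearB. Qed.

Lemma omegan_sum (I : Type) (s : seq I) (P : pred I) (G : I -> {mpoly K[4]}) :
  omegan (\sum_(i <- s | P i) G i) = \sum_(i <- s | P i) omegan (G i).
Proof. exact: linear_sum. Qed.

Lemma natf_neq0 n : (n.+1%:R : K) != 0.
Proof. by have /pcharf0P -> := char0. Qed.

Lemma fact_neq0 n : (n`!%:R : K) != 0.
Proof. by case: (n`!) (fact_gt0 n) => // m _; apply: natf_neq0. Qed.

Lemma omegan1 : omegan 1 = 1.
Proof. by rewrite -mpolyX0 /omegan mfunX /omega_mono !mnm0E /= mul1r divr1. Qed.

Lemma omegan_det p : omegan (\det (gmx K) * p) = omegan p.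
Proof.
apply: (@linear_mpoly_eq _ _ (fun p => omegan (\det (gmx K) * p)) omegan).
- by move=> c q r; rewrite mulrDr -scalerAr linearP.
- by move=> c q r; rewrite linearP.
move=> m /=; rewrite det2E !mxE /= mulrBl -!mpolyXD omeganB !omeganX /omega_mono.
rewrite !mnmDE !mnm1E /= !(add0n, addn0, add1n) !eqSS.
case: ifP => _; last by rewrite !mul0r subr0.
rewrite !addnS !addSn !factS !natrM exprS.
have := natf_neq0 (m o0 + m o1).+1; have := natf_neq0 (m o0 + m o1); have := fact_neq0 (m o0 + m o1).
have -> : ((m o0 + m o1).+2%:R : K) = (m o0).+1%:R + (m o1).+1%:R.
  by rewrite -natrD addSn addnS.
move: ((m o0 + m o1).+1%:R) ((m o0).+1%:R) ((m o1).+1%:R) ((m o0 + m o1)`!%:R).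
move: ((m o0)`!%:R) ((m o1)`!%:R) ((-1) ^+ m o1) => A B S s x y F F0 s0 xy0.
by field; rewrite F0 s0 xy0.
Qed.

Lemma omegan_detX k p : omegan (\det (gmx K) ^+ k * p) = omegan p.
Proof. by elim: k => [|k IH]; rewrite ?mul1r // exprS -mulrA omegan_det. Qed.

(** In a single degree the normalization is a constant, so a nonzero value of [omegan] gives one of
    [omega], which is defined over every coefficient ring and can produce invariants. *)
Lemma omegan_homog D p : p \is D.-homog -> omegan p = omega p / ((D./2).+1)`!%:R.
Proof.
move/dhomogP => hp; rewrite /omegan /omega /mfun big_seq mulr_suml [RHS]big_seq.
apply: eq_bigr => m /hp E; rewrite mulrA /omega_mono.
case: ifP => [/andP [/eqP e1 /eqP e2]|_]; last by rewrite mulr0 !mul0r.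
have E2 : (m o0 + m o1 + m o2 + m o3)%N = D by rewrite -E /= mdegE (big_ord4 m).
congr (_ / (_.+1)`!%:R); rewrite -E2 -e1 -e2.
by rewrite -addnA [(m o1 + m o0)%N]addnC addnn doubleK.
Qed.

End NormalizedOmega.

Lemma rmorph_mmap (R : nzRingType) (A B : comNzRingType) n (psi : {rmorphism A -> B})
    (f : R -> A) (x : 'I_n -> A) (P : {mpoly R[n]}) :
  psi (mmap f x P) = mmap (psi \o f) (psi \o x) P.
Proof.
rewrite /mmap rmorph_sum; apply: eq_bigr => m _; rewrite rmorphM; congr (_ * _).
by rewrite /mmap1 rmorph_prod; apply: eq_bigr => i _; rewrite rmorphXn.
Qed.

Lemma mmap_ext (R : nzRingType) (A : comNzRingType) n (f f' : R -> A) (x x' : 'I_n -> A)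
    (P : {mpoly R[n]}) : f =1 f' -> x =1 x' -> mmap f x P = mmap f' x' P.
Proof.
move=> Ef Ex; apply: eq_bigr => m _; rewrite Ef; congr (_ * _).
by apply: eq_bigr => i _; rewrite Ex.
Qed.

Lemma meval_map_mpoly (R S : comNzRingType) n (j : {rmorphism R -> S}) (v : 'I_n -> S)
    (P : {mpoly R[n]}) : (map_mpoly j P).@[v] = mmap j v P.
Proof.
rewrite /map_mpoly rmorph_mmap; apply: mmap_ext => [c|i] /=; first by rewrite mevalC.
by rewrite mevalXU.
Qed.

Lemma omega_map (A B : comNzRingType) (phi : {rmorphism A -> B}) (q : {mpoly A[4]}) :
  phi (omega q) = omega (map_mpoly phi q).
Proof.
elim/mpolyind: q => [|c m q _ _ IH]; first by rewrite !raddf0.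
rewrite !rmorphD /= !linearD /= rmorphD IH; congr (_ + _).
rewrite map_mpolyZ map_mpolyX !omegaZ !omegaX rmorphM; congr (_ * _).
rewrite /omega_mono; case: ifP => _; last by rewrite rmorph0.
by rewrite rmorphM rmorphXn rmorphN1 rmorph_nat.
Qed.

(** * Invariants obtained by averaging *)

Section GenericOrbit.
Variables (d e : nat).
Local Notation N := (d.+1 * e.+1)%N.

Definition gen_orbit (A : comNzRingType) (v : 'M[A]_(d.+1, e.+1)) :
    'M[{mpoly A[4]}]_(d.+1, e.+1) :=
  act (gmx A) (map_mx (@mpolyC 4 A) v).

(** The function [g |-> P(g v)] as a polynomial in the four entries of [g]; [j] carries the
    coefficients of [P] to [A]. *)
Definition gpull (R A : comNzRingType) (j : R -> A) (P : {mpoly R[N]})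
    (v : 'M[A]_(d.+1, e.+1)) : {mpoly A[4]} :=
  mmap (@mpolyC 4 A \o j) (fun i => mxvec (gen_orbit v) 0 i) P.

Lemma map_gmx (A B : comNzRingType) (phi : {rmorphism A -> B}) :
  map_mx (map_mpoly phi) (gmx A) = gmx B.
Proof. by rewrite map_mx2 /= !map_mpolyX. Qed.

Lemma map_mxvec (A B : Type) m n (phi : A -> B) (M : 'M[A]_(m, n)) i :
  phi (mxvec M 0 i) = mxvec (map_mx phi M) 0 i.
Proof. by case/mxvec_indexP: i => a b; rewrite !mxvecE mxE. Qed.

Lemma gpull_map (R A B : comNzRingType) (phi : {rmorphism A -> B}) (j : R -> A) P v :
  map_mpoly phi (gpull j P v) = gpull (phi \o j) P (map_mx phi v).
Proof.
rewrite /gpull rmorph_mmap; apply: mmap_ext => [c|i] /=; first by rewrite map_mpolyC.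
rewrite (map_mxvec (map_mpoly phi)) /gen_orbit map_act map_gmx; congr (mxvec (act _ _) 0 i).
by apply/matrixP => a b; rewrite !mxE /= map_mpolyC.
Qed.

Lemma gmx_eval (A : comNzRingType) (g : 'M[A]_2) :
  map_mx (meval (mx_entry g)) (gmx A) = g.
Proof. by rewrite map_mx2 /= !mevalXU [RHS]mx2_eta. Qed.

Lemma gpull_eval (R A : comNzRingType) (j : R -> A) P v (g : 'M[A]_2) :
  (gpull j P v).@[mx_entry g] = mmap j (fun i => mxvec (act g v) 0 i) P.
Proof.
rewrite /gpull rmorph_mmap; apply: mmap_ext => [c|i] /=; first by rewrite mevalC.
rewrite (map_mxvec (meval _)) /gen_orbit map_act gmx_eval; congr (mxvec (act _ _) 0 i).
by apply/matrixP => a b; rewrite !mxE /= mevalC.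
Qed.

Lemma gmx_right (A : comNzRingType) (h : 'M[A]_2) :
  map_mx (fun q => q \mPo right_subst h) (gmx A) = gmx A *m map_mx (@mpolyC 4 A) h.
Proof.
rewrite [RHS]mx2_eta; apply/matrixP => i l; rewrite mxE [gmx A i l]mxE [RHS]mxE.
by case: ifP => _; case: ifP => _; rewrite comp_mpolyXU.
Qed.

(** Moving [v] by [h] is a right translation of the group variable, under which Omega is invariant
    if [\det h = 1]. *)
Lemma gpull_act (R A : comNzRingType) (j : R -> A) P v (h : 'M[A]_2) :
  gpull j P (act h v) = gpull j P v \mPo right_subst h.
Proof.
rewrite /gpull [RHS](rmorph_mmap (comp_mpoly (right_subst h))).
apply: mmap_ext => [c|i] /=; first by rewrite comp_mpolyC.
rewrite (map_mxvec (comp_mpoly _)) /gen_orbit map_act (map_act (comp_mpoly _)).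
rewrite (gmx_right h : map_mx (comp_mpoly (right_subst h)) (gmx A) = _) actM; congr (mxvec (act _ (act _ _)) 0 i).
by apply/matrixP => a b; rewrite !mxE /= comp_mpolyC.
Qed.

Variable k : fieldType.

Definition gen_vec : 'M[{mpoly k[N]}]_(d.+1, e.+1) := vec_mx (\row_i 'X_i).

(** The averaging operator of classical invariant theory, with Omega in place of an integral over
    the group. The vector is generic, so the result is a polynomial over [k]. *)
Definition invariant_of (P : {mpoly k[N]}) : {mpoly k[N]} :=
  omega (gpull (@mpolyC N k) P gen_vec).

Lemma gpull_spec (R : comNzRingType) (j : {rmorphism k -> R}) P (v : 'M[R]_(d.+1, e.+1)) :
  gpull j P v =
  map_mpoly (mmap j (fun i => mxvec v 0 i)) (gpull (@mpolyC N k) P gen_vec).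
Proof.
pose phi : {rmorphism {mpoly k[N]} -> R} := mmap j (fun i => mxvec v 0 i).
transitivity (gpull (phi \o @mpolyC N k) P (map_mx phi gen_vec)); last first.
  exact: esym (gpull_map phi _ _ _).
have E : map_mx phi gen_vec = v.
  by apply/matrixP => a b; rewrite !mxE /= mmapX mmap1U mxvecE.
by rewrite E; apply: mmap_ext => [c|i] //=; rewrite mmapC.
Qed.

Lemma invariant_of_eval (R : comNzRingType) (j : {rmorphism k -> R}) P (v : 'rV[R]_N) :
  (map_mpoly j (invariant_of P)).@[fun i => v 0 i] = omega (gpull j P (vec_mx v)).
Proof.
rewrite meval_map_mpoly gpull_spec /invariant_of.
have -> : mmap j (fun i => mxvec (vec_mx v) 0 i) = mmap j (fun i => v 0 i).
  by rewrite vec_mxK.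
exact: (omega_map (mmap j (fun i => v 0 i))).
Qed.

Lemma gpull_coef_homog m P al : P \is m.-homog ->
  (gpull (@mpolyC N k) P gen_vec)@_al \is m.-homog.
Proof.
move=> hP; pose G n (q : {mpoly {mpoly k[N]}[4]}) := forall al, q@_al \is n.-homog.
have G0 n : G n 0 by move=> be; rewrite mcoeff0 rpred0.
have GD n x y : G n x -> G n y -> G n (x + y).
  by move=> Gx Gy be; rewrite mcoeffD rpredD.
have GM n n' x y : G n x -> G n' y -> G (n + n')%N (x * y).
  by move=> Gx Gy be; rewrite mcoeffM rpred_sum // => i _; apply: dhomogM.
have GC n c : c \is n.-homog -> G n c%:MP.
  by move=> hc be; rewrite mcoeffC; case: eqP => _; rewrite ?mulr1 // mulr0 rpred0.
have GX i : G 0%N 'X_i.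
  by move=> be; rewrite mcoeffX; case: eqP => _; rewrite ?dhomog1 ?rpred0.
suff : G (m * 1)%N (gpull (@mpolyC N k) P gen_vec) by rewrite muln1; apply.
apply: (graded_mmap (G := G)) => // [|c|i].
- by rewrite -mpolyC1; apply: GC; rewrite dhomog1.
- by apply: GC; rewrite -[c]mulr1 mpolyCM mul_mpolyC rpredZ // dhomog1.
- case/mxvec_indexP: i => a b; rewrite mxvecE /gen_orbit.
  suff : G (1 + d * 0 + e * 0)%N (act (gmx _) (map_mx (@mpolyC 4 _) gen_vec) a b).
    by rewrite !muln0 !addn0.
  apply: (graded_act (G := G)) => // [|i l|i l].
  + by rewrite -mpolyC1; apply: GC; rewrite dhomog1.
  + by rewrite mxE; do 2!case: ifP => _.
  + by rewrite !mxE; apply: GC; rewrite dhomogX /= mdeg1.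
Qed.

Lemma gpull_homog (R A : comNzRingType) (j : R -> A) m P v : P \is m.-homog ->
  gpull j P v \is (m * (d + e)).-homog.
Proof.
apply: dhomog_mmap => i; case/mxvec_indexP: i => a b; rewrite mxvecE /gen_orbit.
suff : act (gmx _) (map_mx (@mpolyC 4 _) v) a b \is (0 + d * 1 + e * 1).-homog.
  by rewrite !muln1.
apply: dhomog_act => i l; rewrite mxE; last exact: dhomogC.
by do 2!case: ifP => _; rewrite dhomogX /= mdeg1.
Qed.

(** Omega commutes with base change, so invariance is tested directly over each ring [R], where it
    is right invariance of Omega. *)
Lemma invariant_of_invariant m P : P \is m.-homog -> invariant_section m (invariant_of P).
Proof.
move=> hP; split.
  rewrite /invariant_of /omega /mfun; apply: rpred_sum => al _.
  have [c ->] : exists c : k, omega_mono {mpoly k[N]} al = c%:MP.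
    rewrite /omega_mono; case: ifP => _; last by exists 0; rewrite mpolyC0.
    exists ((-1) ^+ al o1 * ((al o0)`! * (al o1)`!)%:R).
    by rewrite -(rmorph_nat (@mpolyC N k)) -(rmorphN1 (@mpolyC N k)) -rmorphXn -rmorphM.
  by rewrite mulrC mul_mpolyC rpredZ // gpull_coef_homog.
move=> R j g v Dg; rewrite !invariant_of_eval /sl2_act_coord mxvecK sl2_actE.
by rewrite gpull_act omega_right_subst.
Qed.

End GenericOrbit.

(** * Polynomials in one more variable *)

Lemma rmorph_mpoly_id (R : comNzRingType) n (psi : {rmorphism {mpoly R[n]} -> {mpoly R[n]}}) :
  (forall c, psi c%:MP = c%:MP) -> (forall i, psi 'X_i = 'X_i) -> psi =1 id.
Proof.
move=> HC HX p; rewrite -[RHS](comp_mpoly_id p) -{1}[p](comp_mpoly_id p) /comp_mpoly.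
rewrite rmorph_mmap; apply: mmap_ext => [c|i] /=; first exact: HC.
by rewrite tnth_mktuple HX.
Qed.

Section MpolyPoly.
Variables (R : comNzRingType) (n : nat).

Definition widen_last (i : 'I_n) : 'I_n.+1 := widen_ord (leqnSn n) i.

Lemma ord_lastP (i : 'I_n.+1) : (exists j, i = widen_last j) \/ i = ord_max.
Proof.
case: (unliftP ord_max i) => [j ->|->]; last by right.
by left; exists j; apply: val_inj; rewrite /= /bump leqNgt ltn_ord.
Qed.

Definition of_poly (q : {poly {mpoly R[n]}}) : {mpoly R[n.+1]} :=
  (map_poly (@mwiden n R) q).['X_ord_max].

HB.instance Definition _ := GRing.RMorphism.copy of_poly
  (horner_eval ('X_ord_max : {mpoly R[n.+1]}) \o map_poly (@mwiden n R)).

Lemma muni_widen i : muni ('X_(widen_last i) : {mpoly R[n.+1]}) = ('X_i)%:P.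
Proof.
rewrite muniE msuppX big_seq1 mcoeffX eqxx scale1r mnm1E.
have -> : (widen_last i == ord_max) = false by rewrite -val_eqE /= ltn_eqF.
rewrite expr0 alg_polyC; congr ('X_[_])%:P; apply/mnmP => j.
by rewrite mnmE !mnm1E -!val_eqE.
Qed.

Lemma muni_last : muni ('X_ord_max : {mpoly R[n.+1]}) = 'X.
Proof.
rewrite muniE msuppX big_seq1 mcoeffX eqxx scale1r mnm1E eqxx.
rewrite -[RHS]scale1r -mpolyX0; congr ('X_[_] *: _); apply/mnmP => j.
by rewrite mnmE mnm1E mnm0E -val_eqE /= gtn_eqF.
Qed.

Lemma of_polyC c : of_poly c%:P = mwiden c.
Proof. by rewrite /of_poly map_polyC hornerC. Qed.

Lemma of_polyX : of_poly 'X = 'X_ord_max.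
Proof. by rewrite /of_poly map_polyX hornerX. Qed.

Lemma mwidenU i : mwiden ('X_i : {mpoly R[n]}) = 'X_(widen_last i).
Proof. by rewrite /mwiden mmapX mmap1U. Qed.

Lemma muniK : cancel (@muni n R) of_poly.
Proof.
apply: (@rmorph_mpoly_id _ _ (of_poly \o @muni n R)) => [c|i] /=.
  by rewrite muniC of_polyC mwidenC.
case: (ord_lastP i) => [[j ->]|->]; first by rewrite muni_widen of_polyC mwidenU.
by rewrite muni_last of_polyX.
Qed.

Lemma muni_mwiden (p : {mpoly R[n]}) : muni (mwiden p) = p%:P.
Proof.
have E := @rmorph_mmap R {mpoly R[n.+1]} {poly {mpoly R[n]}} n (@muni n R).
rewrite /mwiden E {E}.
transitivity (polyC (mmap (@mpolyC n R) (fun i => 'X_i) p)).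
  rewrite (@rmorph_mmap R {mpoly R[n]} {poly {mpoly R[n]}} n (@polyC _)); apply: mmap_ext => [c|i] /=; first by rewrite muniC.
  exact: muni_widen.
by congr (_%:P); rewrite -[RHS](comp_mpoly_id p); apply: mmap_ext => // i; rewrite tnth_mktuple.
Qed.

Lemma of_polyK : cancel of_poly (@muni n R).
Proof.
elim/poly_ind => [|q c IH]; first by rewrite !rmorph0.
by rewrite !(rmorphD, rmorphM) /= IH of_polyX of_polyC muni_last muni_mwiden.
Qed.

Lemma meval_of_poly v q :
  (of_poly q).@[v] = (map_poly (meval (fun i => v (widen_last i))) q).[v ord_max].
Proof.
elim/poly_ind: q => [|q c IH]; first by rewrite !rmorph0 horner0.
rewrite !(rmorphD, rmorphM) /= IH of_polyX of_polyC map_polyX map_polyC hornerD hornerM.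
rewrite hornerX hornerC mevalXU /=; congr (_ + _).
rewrite /mwiden (rmorph_mmap (meval v)); apply: mmap_ext => [a|i] /=; first by rewrite mevalC.
by rewrite mevalXU.
Qed.

End MpolyPoly.

Lemma mpoly_eval0 (K : closedFieldType) n (p : {mpoly K[n]}) :
  (forall v, p.@[v] = 0) -> p = 0.
Proof.
elim: n p => [|n IH] p H.
  apply/mpolyP => m; rewrite mcoeff0.
  have -> : m = 0%MM by apply/mnmP; case.
  have := H (fun _ => 0); rewrite mevalE; set S := msupp p.
  have [m0|m0] := boolP (0%MM \in S); last by rewrite memN_msupp_eq0.
  rewrite (bigD1_seq 0%MM) ?msupp_uniq //= big_ord0 mulr1 big1 ?addr0 // => m' /eqP ne.
  by case: ne; apply/mnmP; case.
suff : muni p = 0 by move/(congr1 (@of_poly K n)); rewrite muniK rmorph0.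
apply/polyP => i; rewrite coef0; apply: IH => v.
suff : map_poly (meval v) (muni p) = 0 by move/(congr1 (fun q : {poly K} => q`_i)); rewrite coef_map coef0.
apply: closed_poly0 => x.
pose w (l : 'I_n.+1) := if unlift ord_max l is Some j then v j else x.
have := H w; rewrite -[p in LHS]muniK meval_of_poly /w unlift_none => E.
rewrite -[RHS]E; congr (_.[_]); apply: eq_map_poly => q; apply: meval_eq => j.
case: unliftP => [a Ea|/(congr1 val) /= Ej].
  congr v; apply: val_inj; have := congr1 val Ea; rewrite /= /bump leqNgt ltn_ord add0n; exact.
by have := ltn_ord j; rewrite Ej ltnn.
Qed.

(** * Places of the function field of GL_2 *)

Section IdealPlace.
Variables (K : closedFieldType) (F : fieldType) (kap : {rmorphism K -> F}).
Variables (A : comNzRingType) (psi : {rmorphism A -> F}) (c0 : K -> A) (Q : A -> Prop).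
Hypotheses (psic0 : forall c, psi (c0 c) = kap c).
Hypotheses (Q0 : Q 0) (QD : forall x y, Q x -> Q y -> Q (x + y))
  (QM : forall x y, Q y -> Q (x * y)) (Q1 : forall x, Q x -> psi x <> 1).

(** The subring is the image of [A] and the ideal is the image of [Q]. As [psi] may have a kernel,
    properness is the separate hypothesis [Q1]. *)
Lemma ideal_place : exists p : place kap, [/\ forall x, reg p (psi x),
  forall x, Q x -> small p (psi x) & (forall x, exists c, Q (x - c0 c)) -> rational p].
Proof.
pose rg y := exists x, y = psi x; pose sm y := exists2 x, Q x & y = psi x.
have rc c : rg (kap c) by exists (c0 c); rewrite psic0.
have rD x y : rg x -> rg y -> rg (x + y).
  by move=> [a ->] [b ->]; exists (a + b); rewrite rmorphD.
have rM x y : rg x -> rg y -> rg (x * y).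
  by move=> [a ->] [b ->]; exists (a * b); rewrite rmorphM.
have s0 : sm 0 by exists 0; rewrite // rmorph0.
have sW x : sm x -> rg x by move=> [a _ ->]; exists a.
have sD x y : sm x -> sm y -> sm (x + y).
  by move=> [a Qa ->] [b Qb ->]; exists (a + b); rewrite ?rmorphD //; apply: QD.
have sM x y : rg x -> sm y -> sm (x * y).
  by move=> [a ->] [b Qb ->]; exists (a * b); rewrite ?rmorphM //; apply: QM.
have s1 : ~ sm 1 by move=> [a /Q1 + E]; rewrite -E.
exists (Place rc rD rM s0 sW sD sM s1); split=> [x|x Qx|H y [x ->]] /=.
- by exists x.
- by exists x.
- by have [c Qc] := H x; exists c, (x - c0 c); rewrite // rmorphB psic0.
Qed.

End IdealPlace.

Section GenericPlace.
Variables (K : closedFieldType) (d e : nat).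
Local Notation N := (d.+1 * e.+1)%N.
Local Notation F := {fraction {mpoly K[4]}}.
Implicit Types (f : 'M[K]_(d.+1, e.+1)) (P H : {mpoly K[N]}).

Definition kap : {rmorphism K -> F} := @tofrac {mpoly K[4]} \o @mpolyC 4 K.

Definition gpull_at f : {mpoly K[N]} -> {mpoly K[4]} := fun P => gpull idfun P f.

HB.instance Definition _ f := GRing.RMorphism.copy (gpull_at f)
  (mmap (@mpolyC 4 K \o idfun) (fun i => mxvec (gen_orbit f) 0 i)).

Definition gen_elt : 'M[F]_2 := map_mx (@tofrac _) (gmx K).

Definition gen_det : F := tofrac (\det (gmx K)).

Lemma gen_detE : \det gen_elt = gen_det.
Proof. by rewrite /gen_elt det_map_mx. Qed.

Lemma gmx_det_neq0 : \det (gmx K) != 0.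
Proof.
apply/eqP => D0; have := congr1 (meval (mx_entry (1%:M : 'M[K]_2))) D0.
rewrite meval0 -det_map_mx gmx_eval det1 => /eqP; exact/negP/oner_neq0.
Qed.

Lemma gen_det_neq0 : gen_det != 0.
Proof. by rewrite /gen_det tofrac_eq0 gmx_det_neq0. Qed.

Lemma gen_detX n : gen_det ^+ n = tofrac (\det (gmx K) ^+ n).
Proof. by rewrite rmorphXn. Qed.

Lemma gen_orbitE f i j : tofrac (gen_orbit f i j) = act gen_elt (map_mx kap f) i j.
Proof.
have -> : tofrac (gen_orbit f i j) = map_mx (@tofrac _) (gen_orbit f) i j by rewrite [RHS]mxE.
rewrite /gen_orbit map_act; congr (act _ _ i j).
by apply/matrixP => a b; rewrite !mxE.
Qed.

Lemma gpull_atX f i j : gpull_at f 'X_(mxvec_index i j) = gen_orbit f i j.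
Proof. by rewrite /gpull_at /gpull mmapX mmap1U mxvecE. Qed.

Lemma gpull_atC f c : gpull_at f c%:MP = c%:MP.
Proof. by rewrite /gpull_at /gpull mmapC. Qed.

Section BasePlace.
Variables (f : 'M[K]_(d.+1, e.+1)) (Q : {mpoly K[N]} -> Prop).
Hypotheses (Q0 : Q 0) (QD : forall x y, Q x -> Q y -> Q (x + y))
  (QM : forall x y, Q y -> Q (x * y)).
Hypothesis char0 : [pchar K] =i pred0.

(** The ring is generated by the functions [P(g f)] and the inverse determinant, the image of ['X].
    If 1 were in the ideal, clearing denominators would write a power of the determinant as a sum of
    powers of the determinant times functions from [Q]; [omegan] takes the value 1 on the former and
    0 on each summand. *)
Lemma omegan_place : (forall H, Q H -> omegan (gpull idfun H f) = 0) ->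
  exists p : place kap, [/\ forall i j, reg p (act gen_elt (map_mx kap f) i j),
    reg p gen_det^-1 & forall H, Q H -> small p (tofrac (gpull idfun H f))].
Proof.
move=> HQ; pose psi0 : {rmorphism {mpoly K[N]} -> F} := @tofrac {mpoly K[4]} \o gpull_at f.
pose psi : {rmorphism {poly {mpoly K[N]}} -> F} := horner_eval gen_det^-1 \o map_poly psi0.
have psiC P : psi P%:P = psi0 P by rewrite /= map_polyC /horner_eval hornerC.
pose QQ (H : {poly {mpoly K[N]}}) := forall i, Q H`_i.
have QC P : Q P -> QQ P%:P by move=> QP i; rewrite coefC; case: eqP.
have [|||||p [rp sp _]] := @ideal_place K F kap {poly {mpoly K[N]}} psi (fun c => c%:MP%:P) QQ.
- by move=> c; rewrite psiC /= gpull_atC.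
- by move=> i; rewrite coef0.
- by move=> x y Qx Qy i; rewrite coefD; apply: QD.
- by move=> x y Qy i; rewrite coefM; elim/big_ind: _ => // j _; apply: QM.
- move=> H QH; rewrite /= /horner_eval horner_coef => E; set n := size _ in E.
  have E2 : \det (gmx K) ^+ n = \sum_(i < n) \det (gmx K) ^+ (n - i) * gpull_at f H`_i.
    apply/eqP; rewrite -tofrac_eq; apply/eqP.
    rewrite -gen_detX -[LHS]mulr1 -E mulr_sumr [RHS]rmorph_sum; apply: eq_bigr => i _.
    rewrite coef_map [RHS]rmorphM /= -gen_detX exprVn.
    have -> : gen_det ^+ n = gen_det ^+ (n - i) * gen_det ^+ i by rewrite -exprD subnK // ltnW.
    by rewrite mulrCA mulrA [X in X / _]mulrA mulfK ?expf_neq0 ?gen_det_neq0 // mulrC.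
  have := omegan_detX char0 n 1; rewrite mulr1 E2 omegan1 omegan_sum big1 => [/eqP|i _].
    by rewrite eq_sym oner_eq0.
  by rewrite omegan_detX // HQ.
exists p; split.
- by move=> i j; rewrite -gen_orbitE -gpull_atX -[tofrac _]psiC; apply: rp.
- by have := rp 'X; rewrite /= map_polyX /horner_eval hornerX.
- by move=> H QH; rewrite -[tofrac _]psiC; apply/sp/QC.
Qed.

End BasePlace.
End GenericPlace.

Lemma closed_root_exists (K : closedFieldType) n (a : K) : (0 < n)%N -> exists c, c ^+ n = a.
Proof.
move=> n0; have /closed_rootP [c] : size ('X^n - a%:P) != 1%N.
  by rewrite size_XnsubC // eqSS -lt0n.
by rewrite /root !hornerE subr_eq0 => /eqP; exists c.
Qed.

Lemma act_scalar (R : comNzRingType) d e (c : R) (g : 'M[R]_2) (a : 'M[R]_(d.+1, e.+1)) :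
  act (c *: g) a = c ^+ (d + e) *: act g a.
Proof.
rewrite -mul_scalar_mx actM; apply/matrixP => i j; rewrite act_diag ?mxE // !mulr1n.
rewrite -exprD; congr (_ ^+ _ * _).
by have := leq_ord i; have := leq_ord j; lia.
Qed.

Section DestabStable.
Variables (K : closedFieldType) (d e : nat).
Implicit Types (u : 'M[K]_(d.+1, e.+1)).

Lemma destab_unit T u (g : 'M[K]_2) : \det g != 0 -> destab T u -> destab T (act g u).
Proof.
move=> Dg [h Dh H]; have [c Ec] := closed_root_exists (\det g) (isT : (0 < 2)%N).
have ug : g \in unitmx by rewrite unitmxE unitfE.
exists ((c *: h) *m invmx g).
  by rewrite det_mulmx detZ Dh mulr1 Ec det_inv divff.
by move=> i j ij; rewrite -actM mulmxKV // act_scalar mxE H // mulr0.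
Qed.

End DestabStable.

Lemma mem_entries (T : eqType) (g : 'M[T]_2) i j :
  g i j \in [:: g 0 0; g 0 1; g 1 0; g 1 1].
Proof. by case: (ord2P i) => ->; case: (ord2P j) => ->; rewrite !inE eqxx ?orbT. Qed.

Lemma entriesP (T : eqType) (g : 'M[T]_2) x :
  x \in [:: g 0 0; g 0 1; g 1 0; g 1 1] -> exists r s, x = g r s.
Proof.
by rewrite !inE => /or4P [] /eqP->; [exists 0, 0|exists 0, 1|exists 1, 0|exists 1, 1].
Qed.

(** * Invariants that do not vanish at a given form *)

Section Separation.
Variables (K : closedFieldType) (d e : nat).
Local Notation N := (d.+1 * e.+1)%N.
Local Notation F := {fraction {mpoly K[4]}}.
Implicit Types (f : 'M[K]_(d.+1, e.+1)) (p : place (kap K)).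

(** Either all entries of the generic matrix become regular, or one of them is a pole dominating the
    others, which [pivot_absurd] excludes. *)
Lemma gen_pivot p T f : reg p (gen_det K)^-1 -> ~ destab T f ->
  let G := act (gen_elt K) (map_mx (kap K) f) in
  ((forall i j, reg p (G i j)) /\ (forall h, (h < T)%N -> (h.*2 < d + e)%N)) \/
  ((forall i j, small p (G i j)) /\ (forall h, (h < T)%N -> (h.*2 <= d + e)%N)) ->
  exists q, [/\ place_le p q, (rational p -> rational q)
    & forall i j, reg q (gen_elt K i j)].
Proof.
move=> rD Nf G HG; set g := gen_elt K in G HG *.
have [q [pq rq H]] := place_pivot p [:: g 0 0; g 0 1; g 1 0; g 1 1].
have mem i j : g i j \in [:: g 0 0; g 0 1; g 1 0; g 1 1] by apply: mem_entries.
exists q; split=> //; case: H => [H|[x [xin x0 sx H]]] i j; first exact/H/mem.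
have [r [s Ex]] := entriesP xin.
exfalso; apply: (@pivot_absurd K F (kap K) q d e T f g r s); rewrite -?Ex //.
- by rewrite /g gen_detE gen_det_neq0.
- by rewrite /g gen_detE; apply: (proj1 pq).
- by move=> i' j'; apply/H/mem.
- case: HG => -[H1 H2]; [left|right]; split=> // i' j'.
    exact/(proj1 pq)/H1.
  exact/(proj2 pq)/H1.
Qed.

Definition gen_inv : 'M[F]_2 :=
  let g := gen_elt K in (gen_det K)^-1 *: mx2 (g 1 1) (- g 0 1) (- g 1 0) (g 0 0).

Lemma gen_invK : gen_inv *m gen_elt K = 1%:M.
Proof.
have := gen_det_neq0 K; rewrite /gen_inv -gen_detE; set g := gen_elt K => D0.
rewrite -scalemxAl.
have -> : mx2 (g 1 1) (- g 0 1) (- g 1 0) (g 0 0) *m g = (\det g)%:M.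
  apply/matrixP => i j; rewrite mulmx2E det2E.
  by case: (ord2P i) => ->; case: (ord2P j) => ->; rewrite !mxE /= ?mulr1n ?mulr0n; ring.
by rewrite scale_scalar_mx mulVf.
Qed.

Lemma reg_gen_inv p : reg p (gen_det K)^-1 -> (forall i j, reg p (gen_elt K i j)) ->
  forall i j, reg p (gen_inv i j).
Proof.
move=> rD rg i j; rewrite mxE; apply: regM => //.
by apply: reg_mx2 => //; apply: regN.
Qed.

Hypothesis char0 : [pchar K] =i pred0.

(** Here [K] is exchanged for [k]: a monomial makes sense over either field, and being homogeneous
    it may be tested by [omega]. *)
Lemma omegan_monomial f (H : {mpoly K[N]}) : omegan (gpull idfun H f) != 0 ->
  exists2 m, m \in msupp H & omega (gpull idfun 'X_[m] f) != 0.
Proof.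
move=> H0; apply: NNPP => NN; case/eqP: H0.
rewrite -/(gpull_at f H) [H]mpolyE rmorph_sum omegan_sum big_seq big1 // => m mH.
rewrite -mul_mpolyC rmorphM /= gpull_atC mul_mpolyC /omegan linearZ /=.
rewrite -/(omegan _) (@omegan_homog _ (mdeg m * (d + e))); last first.
  by apply: gpull_homog; rewrite dhomogX.
have [->|ne] := eqVneq (omega (gpull_at f 'X_[m])) 0; first by rewrite mul0r mulr0.
by case: NN; exists m.
Qed.

(** If [omegan] killed all polynomials without constant term, there would be a place at which all
    coefficients of [g f] are small. By [gen_pivot] it extends to one where [g] and its inverse are
    regular, so the constants [f i j], the coefficients of g^-1 (g f), would be small and hence
    0. *)
Lemma semistable_monomial f : f != 0 -> ~ destab (d + e)./2.+1 f ->
  exists2 m : 'X_{1..N}, m != 0%MM & omega (gpull idfun 'X_[m] f) != 0.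
Proof.
move=> f0 Nf.
have [H QH HO] : exists2 H : {mpoly K[N]}, H@_0 = 0 & omegan (gpull idfun H f) != 0.
  apply: NNPP => NN; case/eqP: f0.
  have [||||p [rG rD1 sQ]] := @omegan_place K d e f (fun H => H@_0 = 0) _ _ _ char0.
  - exact: mcoeff0.
  - by move=> x y Qx Qy; rewrite mcoeffD Qx Qy addr0.
  - by move=> x y Qy; rewrite (rmorphM (mcoeff 0%MM)) /= Qy mulr0.
  - by move=> H QH; apply/eqP/contraT => ne; case: NN; exists H.
  have sG i j : small p (act (gen_elt K) (map_mx (kap K) f) i j).
    rewrite -gen_orbitE -gpull_atX; apply: sQ; rewrite mcoeffX.
    by case: eqP => // /(congr1 (@mdeg _)); rewrite mdeg1 mdeg0.
  have [|q [pq _ rg]] := gen_pivot rD1 Nf.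
    by right; split=> // h; lia.
  apply/matrixP => i j; rewrite mxE; apply: (@small_const _ _ _ q).
  have -> : kap K (f i j) = act gen_inv (act (gen_elt K) (map_mx (kap K) f)) i j.
    by rewrite -actM gen_invK act1 mxE.
  apply: small_act => [a b|a b]; last exact/(proj2 pq)/sG.
  by apply: reg_gen_inv => //; apply: (proj1 pq).
have [m mH Hm] := omegan_monomial HO; exists m => //.
by apply: contraTneq mH => ->; rewrite mcoeff_msupp QH eqxx.
Qed.

Variables (k : fieldType) (iota : {rmorphism k -> K}).

(** These coefficients are defined over [k]. At a point over [K] they all vanish exactly when [P]
    vanishes at every [g v], so they generate a group-stable ideal. *)
Definition gpull_coef (P : {mpoly k[N]}) (al : 'X_{1..4}) : {mpoly k[N]} :=
  (gpull (@mpolyC N k) P (gen_vec d e k))@_al.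

Lemma mmap_gpull_coef (R : comNzRingType) (j : {rmorphism k -> R}) P al (v : 'M[R]_(d.+1, e.+1)) :
  mmap j (fun i => mxvec v 0 i) (gpull_coef P al) = (gpull j P v)@_al.
Proof. by rewrite gpull_spec mcoeff_map_mpoly. Qed.

(** The argument of [semistable_monomial] for the ideal generated by all [gpull_coef P al]. If
    [omegan] killed it, [P(f) = P(g^-1 (g f))] would be a combination of small values with regular
    coefficients, hence zero. A nonzero value then passes to a single generator times a single
    monomial, which is homogeneous and defined over [k]. *)
Lemma stable_monomial T f mP (P : {mpoly k[N]}) : P \is mP.-homog ->
  (forall h, (h < T)%N -> (h.*2 < d + e)%N) -> ~ destab T f ->
  mmap iota (fun i => mxvec f 0 i) P != 0 ->
  exists (m : 'X_{1..N}) al, omega (gpull iota ('X_[m] * gpull_coef P al) f) != 0.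
Proof.
move=> hP HT Nf Pf; pose Pa al := map_mpoly iota (gpull_coef P al).
pose Q H := exists s : seq ('X_{1..4} * {mpoly K[N]}), H = \sum_(x <- s) x.2 * Pa x.1.
have [H [s QH] HO] : exists2 H : {mpoly K[N]}, Q H & omegan (gpull idfun H f) != 0.
  apply: NNPP => NN; case/eqP: Pf.
  have [||||p [rG rD1 sQ]] := @omegan_place K d e f Q _ _ _ char0.
  - by exists [::]; rewrite big_nil.
  - by move=> x y [s ->] [t ->]; exists (s ++ t); rewrite big_cat.
  - move=> x y [s ->]; exists [seq (z.1, x * z.2) | z <- s].
    by rewrite big_map mulr_sumr; apply: eq_bigr => z _; rewrite mulrA.
  - by move=> H QH; apply/eqP/contraT => ne; case: NN; exists H.
  have [|q [pq _ rg]] := gen_pivot rD1 Nf; first by left.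
  set G := act (gen_elt K) (map_mx (kap K) f) in rG.
  have sP al : small q (mmap (kap K \o iota) (fun i => mxvec G 0 i) (gpull_coef P al)).
    apply: (proj2 pq).
    have -> : mmap (kap K \o iota) (fun i => mxvec G 0 i) (gpull_coef P al)
       = tofrac (gpull idfun (Pa al) f).
      rewrite /gpull (@rmorph_mmap _ {mpoly K[4]} F _ (@tofrac _)) /Pa /map_mpoly.
      rewrite (@rmorph_mmap k {mpoly K[N]} F _ (mmap (@tofrac _ \o (@mpolyC 4 K \o idfun)) _)).
      apply: mmap_ext => [c|i] /=; first by rewrite mmapC.
      rewrite mmapX mmap1U /=; case/mxvec_indexP: i => a b; rewrite !mxvecE.
      by rewrite gen_orbitE.
    apply: sQ; exists [:: (al, 1)]; by rewrite big_seq1 mul1r.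
  apply: (@small_const _ _ _ q).
  (* [P(f)] is the value at g^-1 of the polynomial [h |-> P(h G)], whose coefficients are the small
     elements [sP]. *)
  have -> : kap K (mmap iota (fun i => mxvec f 0 i) P) =
     (gpull (kap K \o iota) P G).@[mx_entry gen_inv].
    rewrite gpull_eval /G -actM gen_invK act1 rmorph_mmap; apply: mmap_ext => // i /=.
    exact: map_mxvec.
  rewrite gpull_spec mevalE; elim/big_ind: _ => [|x y|al _]; [exact: small0|exact: smallD|].
  rewrite mcoeff_map_mpoly; apply: smallMr; first exact: sP.
  elim/big_ind: _ => [|x y|i _]; [exact: reg1|exact: regM|].
  apply: regX; have ri := reg_gen_inv (proj1 pq _ rD1) rg.
  by case: (ord4P i) => ->; rewrite /mx_entry /=; apply: ri.
have [x xs Hx] : exists2 x, x \in s & omegan (gpull idfun (x.2 * Pa x.1) f) != 0.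
  apply: NNPP => NN; case/eqP: HO; rewrite QH -/(gpull_at f _) rmorph_sum omegan_sum big_seq.
  by rewrite big1 // => x xs; apply/eqP/contraT => ne; case: NN; exists x.
have : exists2 m, m \in msupp x.2 & omegan (gpull idfun ('X_[m] * Pa x.1) f) != 0.
  apply: NNPP => NN; case/eqP: Hx.
  rewrite [x.2]mpolyE mulr_suml -/(gpull_at f _) rmorph_sum omegan_sum big_seq big1 // => m mH.
  rewrite -mul_mpolyC -mulrA rmorphM /= gpull_atC mul_mpolyC /omegan linearZ /= -/(omegan _).
  have [->|ne] := eqVneq (omegan (gpull_at f ('X_[m] * Pa x.1))) 0; first by rewrite mulr0.
  by case: NN; exists m.
move=> [m _ Hm]; exists m, x.1.
have E : gpull iota ('X_[m] * gpull_coef P x.1) f = gpull idfun ('X_[m] * Pa x.1) f.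
  rewrite /gpull !rmorphM /= !mmapX; congr (_ * _).
  rewrite /Pa /map_mpoly (@rmorph_mmap k {mpoly K[N]} {mpoly K[4]} _ (mmap _ _)).
  apply: mmap_ext => [c|i] /=; first by rewrite mmapC.
  by rewrite mmapX mmap1U.
apply: contraNneq Hm => Hm; rewrite -E (@omegan_homog _ ((mdeg m + mP) * (d + e))).
  by rewrite Hm mul0r.
by apply: gpull_homog; apply: dhomogM; [rewrite dhomogX|apply: gpull_coef_homog].
Qed.

End Separation.

(** * Principal open sets are affine *)

Lemma dhomog_map (R S : nzRingType) n (j : {rmorphism R -> S}) m (p : {mpoly R[n]}) :
  p \is m.-homog -> map_mpoly j p \is m.-homog.
Proof.
move=> hp; apply/dhomogP => mu; rewrite mcoeff_msupp mcoeff_map_mpoly => ne.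
apply/eqP; by apply: contraNT ne => ne; rewrite (dhomog_nemf_coeff hp ne) raddf0.
Qed.

Section PrincipalOpen.
Variables (K : closedFieldType) (n m : nat) (s : {mpoly K[n]}).
Hypotheses (hs : s \is m.-homog) (m0 : (0 < m)%N).

Let J := 'X_{1..n < m.+1}.
Let M (j : 'I_#|{: J}|) : 'X_{1..n} := bmnm (enum_val j).

Let idx mu (H : (mdeg mu < m.+1)%N) : 'I_#|{: J}| := enum_rank (BMultinom H).

Lemma M_idx mu (H : (mdeg mu < m.+1)%N) : M (idx H) = mu.
Proof. by rewrite /M /idx enum_rankK. Qed.

Lemma pow_deg (i : 'I_n) : (mdeg (U_(i) *+ m)%MM < m.+1)%N.
Proof. by rewrite mdegMn mdeg1 mul1n. Qed.

Lemma mix_deg (i l : 'I_n) : (mdeg (U_(i) *+ m.-1 + U_(l))%MM < m.+1)%N.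
Proof. by rewrite mdegD mdegMn !mdeg1 mul1n addn1 prednK. Qed.

Let pw i := idx (pow_deg i).
Let mix i l := idx (mix_deg i l).

Let mono (mu : 'X_{1..n}) (v : 'rV[K]_n) : K := \prod_l v 0 l ^+ mu l.

(** The Veronese coordinates of degree [m], divided by [s]. They are indexed by the finite type of
    all monomials of degree at most [m]; the coordinates of lower degree are set to 0. *)
Let phi (j : 'I_#|{: J}|) (v : 'rV[K]_n) : K :=
  if mdeg (M j) == m then mono (M j) v / peval s v else 0.

Lemma peval_sum v : peval s v = \sum_j s@_(M j) * mono (M j) v.
Proof.
rewrite /peval /meval (@mmapE _ _ _ _ _ _ m.+1) /=; last first.
  rewrite msizeE; apply/bigmax_leqP_seq => mu mum _.
  by rewrite ltnS (dhomogP _ _ _ hs _ mum).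
rewrite (eq_bigl (mem {: J})) //.
exact: (@big_enum_val _ _ _ J {: J} (fun mu => s@_(bmnm mu) * mono (bmnm mu) v)).
Qed.

Lemma mono_pow i v : mono (U_(i) *+ m)%MM v = v 0 i ^+ m.
Proof.
rewrite /mono (bigD1 i) //= mulmnE mnm1E eqxx mul1n big1 ?mulr1 // => l li.
by rewrite mulmnE mnm1E eq_sym (negbTE li) mul0n.
Qed.

Lemma monoD mu nu v : mono (mu + nu)%MM v = mono mu v * mono nu v.
Proof. by rewrite /mono -big_split; apply: eq_bigr => l _; rewrite mnmDE exprD. Qed.

Lemma mono_mix i l v : mono (U_(i) *+ m.-1 + U_(l))%MM v = v 0 i ^+ m.-1 * v 0 l.
Proof.
rewrite monoD; congr (_ * _).
  rewrite /mono (bigD1 i) //= mulmnE mnm1E eqxx mul1n big1 ?mulr1 // => l' li.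
  by rewrite mulmnE mnm1E eq_sym (negbTE li) mul0n.
rewrite /mono (bigD1 l) //= mnm1E eqxx big1 ?mulr1 // => l' li.
by rewrite mnm1E eq_sym (negbTE li).
Qed.

Lemma phi_pow i v : phi (pw i) v = v 0 i ^+ m / peval s v.
Proof. by rewrite /phi M_idx mdegMn mdeg1 mul1n eqxx mono_pow. Qed.

Lemma phi_mix i l v : phi (mix i l) v = v 0 i ^+ m.-1 * v 0 l / peval s v.
Proof. by rewrite /phi M_idx mdegD mdegMn !mdeg1 mul1n addn1 prednK // eqxx mono_mix. Qed.

Let rel_sum : {mpoly K[#|{: J}|]} := \sum_j s@_(M j) *: 'X_j - 1.
Let rel_pow j : {mpoly K[#|{: J}|]} :=
  if mdeg (M j) == m then 'X_j ^+ m - \prod_l 'X_(pw l) ^+ M j l else 'X_j.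
Let rel_mix ij : {mpoly K[#|{: J}|]} :=
  if mdeg (M ij.2) == m then
    'X_(pw ij.1) ^+ m.-1 * 'X_ij.2 - \prod_l 'X_(mix ij.1 l) ^+ M ij.2 l else 0.

Let rels := rel_sum :: [seq rel_pow j | j <- enum 'I_#|{: J}|]
  ++ [seq rel_mix ij | ij <- enum {: 'I_n * 'I_#|{: J}|}].

Lemma peval_homog0 : peval s 0 = 0.
Proof.
rewrite peval_sum big1 // => j _.
have [E|ne] := eqVneq (mdeg (M j)) m; last by rewrite (dhomog_nemf_coeff hs) ?mul0r.
have [l Ml] : exists l, M j l != 0%N.
  apply: NNPP => NN; move: m0; rewrite -E mdegE big1 // => l _.
  by apply/eqP/contraT => H; case: NN; exists l.
by rewrite /mono (bigD1 l) //= mxE expr0n (negbTE Ml) mul0r mulr0.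
Qed.

(** The equations of the image are s/s = 1 and two kinds of monomial relations. The relations
    [rel_pow] force some x_i^m / s to be nonzero, and [rel_mix] then expresses all coordinates
    through x_i^(m-1) x_l / s, which also gives the local inverse. *)
Lemma affine_principal_open : affine_open (fun v => v != 0 /\ peval s v != 0).
Proof.
exists #|{: J}|, phi; split.
- move=> j v [v0 sv]; exists m, (if mdeg (M j) == m then 'X_[M j] else 0), s; split=> //.
    by case: ifP => // E; rewrite ?dhomogX ?rpred0.
  move=> w [w0 sw] _; rewrite /phi /peval; case: ifP => _; last by rewrite meval0 mul0r.
  by rewrite mevalX.
- exists rels => y; split=> [[v [v0 sv] Ey] t|H].
    rewrite inE mem_cat => /orP [/eqP->|/orP [] /mapP].
    + rewrite /rel_sum mevalB meval1 raddf_sum /=; apply/eqP; rewrite subr_eq0; apply/eqP.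
      rewrite -[RHS](divff sv) {1}peval_sum mulr_suml; apply: eq_bigr => j _.
      rewrite mevalZ mevalXU -Ey /phi -mulrA.
      case: eqP => [//|/eqP ne]; by rewrite (dhomog_nemf_coeff hs) // !mul0r.
    + move=> [j _ ->]; rewrite /rel_pow; case: eqP => [E|ne]; last first.
        by rewrite mevalXU -Ey /phi; case: eqP.
      rewrite mevalB rmorphXn rmorph_prod /= mevalXU -Ey.
      rewrite (eq_bigr (fun l => (v 0 l ^+ M j l) ^+ m * (peval s v)^-1 ^+ M j l)); last first.
        by move=> l _; rewrite rmorphXn /= mevalXU -Ey phi_pow exprMn exprAC.
      rewrite big_split /= prodrXl prodrXr -mdegE E /phi E eqxx /mono exprMn.
      by rewrite subrr.
    + move=> [[i j] _ ->]; rewrite /rel_mix /=; case: eqP => [E|ne]; last by rewrite meval0.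
      rewrite mevalB rmorphM rmorphXn rmorph_prod /= !mevalXU -!Ey.
      rewrite (eq_bigr (fun l => (v 0 i ^+ m.-1 / peval s v) ^+ M j l * v 0 l ^+ M j l)); last first.
        by move=> l _; rewrite rmorphXn /= mevalXU -Ey phi_mix -exprMn mulrAC.
      rewrite big_split /= prodrXr -mdegE E phi_pow /phi E eqxx /mono.
      have SS : (peval s v)^-1 ^+ m = (peval s v)^-1 ^+ m.-1 * (peval s v)^-1.
        by rewrite -exprSr prednK.
      rewrite !exprMn SS -!exprM [(m.-1 * m)%N]mulnC; apply/eqP; rewrite subr_eq0; apply/eqP.
      ring.
  have rel t : t \in rels -> t.@[y] = 0 by apply: H.
  have relS : \sum_j s@_(M j) * y j = 1.
    have := rel rel_sum (mem_head _ _); rewrite /rel_sum mevalB meval1 raddf_sum /=.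
    move/eqP; rewrite subr_eq0 => /eqP <-; apply: eq_bigr => j _.
    by rewrite mevalZ mevalXU.
  have relP j : (rel_pow j).@[y] = 0.
    by apply: rel; rewrite inE mem_cat map_f ?orbT // mem_enum.
  have relM i j : (rel_mix (i, j)).@[y] = 0.
    by apply: rel; rewrite inE mem_cat (map_f rel_mix) ?orbT // mem_enum.
  have [j yj] : exists j, y j != 0.
    apply: NNPP => NN; have : (1 : K) != 0 := oner_neq0 _.
    rewrite -relS big1 ?eqxx // => j _.
    by have [->|ne] := eqVneq (y j) 0; [rewrite mulr0|case: NN; exists j].
  have dj : mdeg (M j) == m.
    apply: contraNT yj => ne; have := relP j.
    by rewrite /rel_pow (negbTE ne) mevalXU => ->.
  have [i yi] : exists i, y (pw i) != 0.
    have := relP j; rewrite /rel_pow dj mevalB rmorphXn rmorph_prod /= mevalXU.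
    move/eqP; rewrite subr_eq0 => /eqP E.
    have [l Ml] : exists l, M j l != 0%N.
      apply: NNPP => NN; move: m0; rewrite -(eqP dj) mdegE big1 // => l _.
      by apply/eqP/contraT => Hl; case: NN; exists l.
    exists l; have := expf_neq0 m yj; rewrite E (bigD1 l) //= mulf_eq0 negb_or => /andP [].
    by rewrite rmorphXn /= mevalXU expf_eq0 lt0n Ml.
  (* If [y] comes from a point x, this vector is x times x_i^(m-1) / s(x), and the value of [s] on
     it is [c], the power (x_i^m / s(x))^(m-1). *)
  pose v : 'rV[K]_n := \row_l y (mix i l).
  pose c := y (pw i) ^+ m.-1; have c0 : c != 0 by rewrite expf_neq0.
  have mv j' : mdeg (M j') == m -> mono (M j') v = c * y j'.
    move=> dj'; have := relM i j'; rewrite /rel_mix /= dj' mevalB rmorphM rmorphXn rmorph_prod /= !mevalXU.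
    move/eqP; rewrite subr_eq0 => /eqP ->; rewrite /mono; apply: eq_bigr => l _.
    by rewrite rmorphXn /= mevalXU mxE.
  have sv : peval s v = c.
    rewrite peval_sum -[RHS]mulr1 -relS mulr_sumr; apply: eq_bigr => j' _.
    case: (eqVneq (mdeg (M j')) m) => [/eqP E|ne]; first by rewrite mv // mulrCA.
    by rewrite (dhomog_nemf_coeff hs) // !mul0r mulr0.
  exists v.
    by split; rewrite ?sv //; apply: contraNneq c0 => v0; rewrite -sv v0 peval_homog0.
  move=> j'; rewrite /phi; case: ifP => dj'; first by rewrite mv // sv mulrAC divff // mul1r.
  by have := relP j'; rewrite /rel_pow dj' mevalXU.
- move=> v [v0 sv].
  have [i vi] : exists i, v 0 i != 0.
    apply: NNPP => NN; case/eqP: v0; apply/rowP => i; rewrite mxE; apply/eqP/contraT => ne.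
    by case: NN; exists i.
  exists (fun l => 'X_(mix i l)) => inv.
  have invE w : inv w = (w 0 i ^+ m.-1 / peval s w) *: w.
    by apply/rowP => l; rewrite !mxE mevalXU phi_mix mulrAC.
  have cv w : inv w != 0 -> w 0 i ^+ m.-1 / peval s w != 0.
    by rewrite invE; apply: contraNneq => ->; rewrite scale0r.
  split; last by move=> w Uw /cv iw; exists (w 0 i ^+ m.-1 / peval s w).
  by rewrite invE scaler_eq0 negb_or v0 andbT mulf_neq0 ?invr_eq0 // expf_neq0.
Qed.

End PrincipalOpen.

(** * Unique factorization of multivariate polynomials *)

Lemma classic_min (P : nat -> Prop) : (exists n, P n) ->
  exists n, P n /\ forall m, (m < n)%N -> ~ P m.
Proof.
move=> [n Pn]; apply: NNPP => N.
have H m : forall l, (l < m)%N -> ~ P l.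
  elim: m => [|m IH] l //; rewrite ltnS leq_eqVlt => /orP [/eqP->|/IH//] Pm.
  by apply: N; exists m.
exact: H n.+1 n (ltnSn n) Pn.
Qed.

Lemma prod_rem (A : comNzRingType) (q : A) ps : q \in ps ->
  \prod_(r <- ps) r = q * \prod_(r <- rem q ps) r.
Proof. by move=> qps; rewrite (perm_big _ (perm_to_rem qps)) big_cons. Qed.

Section Divisibility.
Variable A : idomainType.
Implicit Types (x y p : A).

Definition divides x y := exists c, y = c * x.

Definition prime_elt p :=
  [/\ p != 0, ~ divides p 1 & forall a b, divides p (a * b) -> divides p a \/ divides p b].

Definition factored x := exists ps u,
  [/\ forall p, p \in ps -> prime_elt p, divides u 1 & x = u * \prod_(p <- ps) p].

Definition factorial := forall x, x != 0 -> factored x.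

Lemma dividesM x y z : divides x y -> divides x (z * y).
Proof. by move=> [c ->]; exists (z * c); rewrite mulrA. Qed.

Lemma dividesMr x y z : divides x y -> divides x (y * z).
Proof. by rewrite mulrC; apply: dividesM. Qed.

Lemma divides_refl x : divides x x.
Proof. by exists 1; rewrite mul1r. Qed.

Lemma dividesD x y z : divides x y -> divides x z -> divides x (y + z).
Proof. by move=> [c ->] [c' ->]; exists (c + c'); rewrite mulrDl. Qed.

Lemma divides0 x : divides x 0.
Proof. by exists 0; rewrite mul0r. Qed.

Lemma divides_sum x (I : Type) (s : seq I) (P : pred I) F :
  (forall i, P i -> divides x (F i)) -> divides x (\sum_(i <- s | P i) F i).
Proof. by move=> H; elim/big_ind: _ => //; [apply: divides0|apply: dividesD]. Qed.

Lemma factoredM x y : factored x -> factored y -> factored (x * y).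
Proof.
move=> [ps [u [Hp [c Ec] ->]]] [qs [v [Hq [c' Ec'] ->]]].
exists (ps ++ qs), (u * v); split.
- by move=> p; rewrite mem_cat => /orP [/Hp|/Hq].
- by exists (c * c'); rewrite -[1]mul1r {1}Ec Ec'; ring.
- by rewrite big_cat /=; ring.
Qed.

Lemma factored_prime p : prime_elt p -> factored p.
Proof.
move=> pp; exists [:: p], 1; split; last by rewrite big_seq1 mul1r.
  by move=> q; rewrite inE => /eqP ->.
exact: divides_refl.
Qed.

Lemma prime_prod p u ps : prime_elt p -> divides u 1 ->
  divides p (u * \prod_(q <- ps) q) -> exists2 q, q \in ps & divides p q.
Proof.
move=> [_ p1 pp] [c Ec]; elim: ps => [|q ps IH].
  by rewrite big_nil mulr1 => pu; case: p1; rewrite Ec; apply: dividesM.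
rewrite big_cons mulrCA => /pp [pq|/IH [r rps pr]]; first by exists q; rewrite ?mem_head.
by exists r; rewrite ?inE ?rps ?orbT.
Qed.

Lemma prime_assoc p q : prime_elt p -> prime_elt q -> divides p q -> divides q p.
Proof.
move=> [p0 p1 _] [q0 q1 qq] [c Ec].
have [[d Ed]|//] : divides q c \/ divides q p by apply: qq; rewrite -Ec; apply: divides_refl.
case: p1; exists d; apply: (mulIf q0); rewrite mul1r {1}Ec Ed; ring.
Qed.

Lemma prime_cancel p x u ps : prime_elt p -> divides u 1 ->
  (forall q, q \in ps -> prime_elt q) -> p * x = u * \prod_(q <- ps) q ->
  exists v qs, [/\ divides v 1, (forall q, q \in qs -> prime_elt q), (size qs < size ps)%N
    & x = v * \prod_(q <- qs) q].
Proof.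
move=> pp u1 Hps E.
have [q qps pq] : exists2 q, q \in ps & divides p q.
  by apply: (prime_prod pp u1); rewrite -E; apply/dividesMr/divides_refl.
have [d Ed] := prime_assoc pp (Hps _ qps) pq; have [c Ec] := pq.
have p0 : p != 0 by case: pp.
have q0 : q != 0 by case: (Hps _ qps).
have dc : d * c = 1 by apply: (mulIf p0); rewrite mul1r -mulrA -Ec -Ed.
exists (u * c), (rem q ps); split.
- by have [b Eb] := u1; exists (b * d); rewrite [1]Eb -[b * u]mulr1 -dc; ring.
- by move=> r /mem_rem/Hps.
- by rewrite size_rem // prednK //; case: (ps) qps.
- apply: (mulfI p0); rewrite E (prod_rem qps) Ec; ring.
Qed.

(** Lowest terms in the form needed for regular functions: the reduced denominator divides every
    denominator of the same fraction. *)
Definition reduced_fractions := forall a b, b != 0 ->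
  exists a0 b0, [/\ b0 != 0, a * b0 = a0 * b
    & forall a' b', a * b' = a' * b -> divides b0 b'].

(** Primes common to [a] and [b] are cancelled one at a time. When none is left, every prime of [b]
    divides [a * b'] but not [a], hence divides [b']. *)
Lemma factorial_reduced : factorial -> reduced_fractions.
Proof.
move=> H a b b0; have [ps [u [Hps u1 Eb]]] := H _ b0.
elim: {ps}(size ps) {-2}ps (leqnn (size ps)) a b u Hps u1 Eb b0 => [|k IH] ps sps a b u Hps u1 Eb b0.
  exists a, b; split=> // a' b' E; have [c Ec] := u1.
  exists (b' * c); case: ps sps Eb {Hps} => // _; rewrite big_nil mulr1 => ->.
  by rewrite -mulrA -Ec mulr1.
case: (classic (exists2 p, p \in ps & divides p a)) => [[p pps [a1 Ea]]|N].
  have p0 : p != 0 by case: (Hps _ pps).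
  pose b1 := u * \prod_(q <- rem p ps) q.
  have Eb1 : b = b1 * p by rewrite Eb (prod_rem pps) /b1; ring.
  have [|||a0 [b0' [b0'0 E1 E2]]] := IH (rem p ps) _ a1 b1 u _ u1 erefl.
  - by rewrite size_rem //; case: (ps) sps pps => //= q s; rewrite ltnS.
  - by move=> q /mem_rem/Hps.
  - by apply: contraNneq b0 => E; rewrite Eb1 E mul0r.
  exists a0, b0'; split=> //; first by rewrite Ea Eb1 mulrA -E1; ring.
  by move=> a' b' E; apply: (E2 a'); apply: (mulIf p0); transitivity (a * b');
    [rewrite Ea|rewrite E Eb1]; ring.
exists a, b; split=> // a' b'; rewrite Eb.
have {}N p : p \in ps -> ~ divides p a by move=> pps pa; apply: N; exists p.
elim: ps {sps Eb} Hps N b' => [|p ps IHp] Hps N b' E.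
  by have [c Ec] := u1; exists (b' * c); rewrite big_nil mulr1 -mulrA -Ec mulr1.
have [p0 _ pp] := Hps _ (mem_head _ _).
have [|pa|[b1 Eb1]] := pp a b'.
- by rewrite E big_cons; exists (a' * (u * \prod_(q <- ps) q)); ring.
- by case: (N _ (mem_head _ _)).
have [|||b2 Eb2] := IHp _ _ b1.
- by move=> q qps; apply: Hps; rewrite inE qps orbT.
- by move=> q qps; apply: N; rewrite inE qps orbT.
- by apply: (mulIf p0); transitivity (a * b'); [rewrite Eb1|rewrite E big_cons]; ring.
by exists b2; rewrite Eb1 Eb2 big_cons; ring.
Qed.

End Divisibility.

Lemma factorial_iso (A B : idomainType) (phi : {rmorphism A -> B}) (psi : {rmorphism B -> A}) :
  cancel phi psi -> cancel psi phi -> factorial A -> factorial B.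
Proof.
move=> K1 K2 HA x x0.
have dphi a b : divides a b -> divides (phi a) (phi b).
  by move=> [c ->]; exists (phi c); rewrite rmorphM.
have dpsi a b : divides a b -> divides (psi a) (psi b).
  by move=> [c ->]; exists (psi c); rewrite rmorphM.
have [|ps [u [Hps u1 E]]] := HA (psi x).
  by apply: contraNneq x0 => E; rewrite -[x]K2 E rmorph0.
exists (map phi ps), (phi u); split.
- move=> _ /mapP [p /Hps [p0 p1 pp] ->]; split.
  + by apply: contraNneq p0 => E0; rewrite -[p]K1 E0 rmorph0.
  + by move/dpsi; rewrite K1 rmorph1.
  + move=> a b /dpsi; rewrite K1 rmorphM => /pp [] /dphi; rewrite K2; by [left|right].
- by rewrite -(rmorph1 phi); apply: dphi.
- by rewrite -[LHS]K2 E rmorphM rmorph_prod big_map.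
Qed.

Section FactorialPoly.
Variable R : idomainType.
Hypothesis UR : factorial R.
Implicit Types (f g h q r : {poly R}).

Lemma divides_polyC (a : R) f : divides a%:P f <-> forall i, divides a f`_i.
Proof.
split=> [[c ->] i|]; first by exists c`_i; rewrite coefMC.
elim/poly_ind: f => [|f c IH] H; first exact: divides0.
have [|q ->] := IH.
  by move=> i; have := H i.+1; rewrite coefD coefMX coefC addr0.
have [b Eb] : divides a c by have := H 0%N; rewrite coefD coefMX coefC add0r.
by exists (q * 'X + b%:P); rewrite Eb polyCM; ring.
Qed.

(** Gauss's lemma, by the lowest coefficients of [f] and [g] not divisible by [p]. *)
Lemma prime_polyC (p : R) : prime_elt p -> prime_elt p%:P.
Proof.
move=> [p0 p1 pp]; split; first by rewrite polyC_eq0.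
  by move/divides_polyC => /(_ 0%N); rewrite coef1.
move=> f g /divides_polyC fg; apply: NNPP => /not_or_and [Nf Ng].
have min h : ~ divides p%:P h -> exists i, ~ divides p h`_i /\ forall j, (j < i)%N -> divides p h`_j.
  move=> Nh; have [|i [Hi Hj]] := @classic_min (fun i => ~ divides p h`_i).
    by apply: not_all_ex_not => H; apply: Nh; apply/divides_polyC.
  by exists i; split=> // j /Hj/NNPP.
have [i [Ni Hi]] := min _ Nf; have [j [Nj Hj]] := min _ Ng.
have := fg (i + j)%N; rewrite coefM.
have ij : (i < (i + j).+1)%N by rewrite ltnS leq_addr.
rewrite (bigD1 (Ordinal ij)) //= addKn => H.
have : divides p (f`_i * g`_j).
  set S := (\sum_(_ | _) _) in H; have SS : divides p S.
    apply: divides_sum => l /negbTE; rewrite -val_eqE /= => li.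
    case: (ltngtP l i) => [/Hi|il|E]; [exact: dividesMr| |by rewrite E eqxx in li].
    by apply/dividesM/Hj; have := ltn_ord l; lia.
  have -> : f`_i * g`_j = (f`_i * g`_j + S) + (-1) * S by ring.
  by apply: dividesD => //; apply: dividesM.
by case/pp.
Qed.

Lemma factored_polyC (c : R) : c != 0 -> factored c%:P.
Proof.
move=> /UR [ps [u [Hps [b Eb] ->]]]; exists (map polyC ps), u%:P; split.
- by move=> _ /mapP [p /Hps pp ->]; apply: prime_polyC.
- by exists b%:P; rewrite -polyCM -Eb.
- by rewrite polyCM rmorph_prod big_map.
Qed.

(* A relation c f = q r over R becomes a factorization of f once the primes of c are cancelled. *)
Lemma cancel_const (c : R) f q r : c != 0 -> c%:P * f = q * r ->
  exists q1 r1 a b, [/\ f = q1 * r1, q = a%:P * q1, r = b%:P * r1, a != 0 & b != 0].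
Proof.
move=> /UR [ps [u [Hps [b Eb] ->]]]; elim: ps Hps f q r => [|p ps IH] Hps f q r.
  rewrite big_nil mulr1 => E.
  have u0 : u != 0 by apply: contra_eq_neq Eb => ->; rewrite mulr0 oner_eq0.
  exists (b%:P * q), r, u, 1; split; rewrite ?mul1r ?oner_neq0 //.
    by rewrite -mulrA -E mulrA -polyCM -Eb mul1r.
  by rewrite mulrA -polyCM [u * b]mulrC -Eb mul1r.
rewrite big_cons mulrCA polyCM -mulrA => E.
have Hp := Hps _ (mem_head _ _); have [p0 _ pp] := prime_polyC Hp.
have Hps' s : s \in ps -> prime_elt s by move=> sps; apply: Hps; rewrite inE sps orbT.
have p0' : p != 0 by rewrite -polyC_eq0.
have [[q' Eq]|[r' Er]] : divides p%:P q \/ divides p%:P r.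
- by apply: pp; rewrite -E; apply/dividesMr/divides_refl.
- have [|q1 [r1 [a [d [Ef Eq1 Er1 a0 d0]]]]] := IH Hps' f q' r.
    by apply: (mulfI p0); rewrite E Eq; ring.
  by exists q1, r1, (p * a), d; split; rewrite ?mulf_neq0 // Eq Eq1 polyCM; ring.
- have [|q1 [r1 [a [d [Ef Eq1 Er1 a0 d0]]]]] := IH Hps' f q r'.
    by apply: (mulfI p0); rewrite E Er; ring.
  by exists q1, r1, a, (p * d); split; rewrite ?mulf_neq0 // Er Er1 polyCM; ring.
Qed.

Definition primitive f := forall p : R, prime_elt p -> ~ divides p%:P f.

Lemma cancel_primitive (c : R) f q h : c != 0 -> primitive f -> c%:P * h = q * f -> divides f h.
Proof.
move=> /UR [ps [u [Hps [b Eb] ->]]] prim; elim: ps Hps h q => [|p ps IH] Hps h q.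
  by rewrite big_nil mulr1 => E; exists (b%:P * q); rewrite -mulrA -E mulrA -polyCM -Eb mul1r.
rewrite big_cons mulrCA polyCM -mulrA => E.
have Hp := Hps _ (mem_head _ _); have [p0 _ pp] := prime_polyC Hp.
have [[q' Eq]|/(prim _ Hp)//] : divides p%:P q \/ divides p%:P f.
  by apply: pp; rewrite -E; apply/dividesMr/divides_refl.
apply: (IH _ h q'); first by move=> s sps; apply: Hps; rewrite inE sps orbT.
by apply: (mulfI p0); rewrite E Eq; ring.
Qed.

Lemma primitive_const (a : R) r : a != 0 -> primitive (a%:P * r) -> divides a 1.
Proof.
move=> /UR [[|p ps] [u [Hps u1 ->]]] prim; first by rewrite big_nil mulr1.
case: (prim p (Hps _ (mem_head _ _))).
by rewrite big_cons mulrCA polyCM -mulrA; apply/dividesMr/divides_refl.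
Qed.

(** Let [f] divide [g * h] and let [r] be a nonzero element of least degree in the ideal [(f, g)].
    Pseudo-division shows that constant multiples of [f] and [g] are multiples of [r]. If [r] is
    constant, a constant multiple of [h] is a multiple of [f]; otherwise [f] and [r] agree up to
    constants and a constant multiple of [g] is one. Primitivity removes the constants. *)
Lemma irreducible_prime f : (1 < size f)%N -> primitive f ->
  (forall g h, f = g * h -> (size g < size f)%N -> (size h < size f)%N -> False) ->
  prime_elt f.
Proof.
move=> sf prim irr; have f0 : f != 0 by rewrite -size_poly_gt0 ltnW.
split=> // [[c Ec]|g h [q Eq]].
  have c0 : c != 0 by apply: contra_eq_neq Ec => ->; rewrite mul0r oner_eq0.
  have := size_poly1 R; rewrite Ec size_mul //; move: sf; rewrite -size_poly_gt0 in c0; lia.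
apply: NNPP => /not_or_and [Ng Nh].
pose I r := exists u v, r = u * f + v * g.
have [|n [[r [[u [v Er]] r0 sr]] min]] :=
  @classic_min (fun n => exists r, [/\ I r, r != 0 & size r = n]).
  by exists (size f), f; split=> //; exists 1, 0; rewrite mul1r mul0r addr0.
have rem w : I w -> exists c q', c != 0 /\ c%:P * w = q' * r.
  move=> [u' [v' Ew]].
  exists (lead_coef r ^+ scalp w r), (w %/ r).
  rewrite expf_neq0 ?lead_coef_eq0 //; split=> //.
  rewrite mul_polyC Pdiv.Idomain.divp_eq.
  have [->|m0] := eqVneq (w %% r) 0; first by rewrite addr0.
  case: (min (size (w %% r))); first by rewrite -sr ltn_modp.
  exists (w %% r); split=> //.
  have := Pdiv.Idomain.divp_eq w r; rewrite -mul_polyC.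
  set c := _%:P; move=> E; exists (c * u' - (w %/ r) * u), (c * v' - (w %/ r) * v).
  have -> : w %% r = c * w - (w %/ r) * r by rewrite E addrAC subrr add0r.
  by rewrite Ew {2}Er; ring.
have [c1 [q1 [c10 E1]]] : exists c q', c != 0 /\ c%:P * f = q' * r.
  by apply: rem; exists 1, 0; rewrite mul1r mul0r addr0.
have [c2 [q2 [c20 E2]]] : exists c q', c != 0 /\ c%:P * g = q' * r.
  by apply: rem; exists 0, 1; rewrite mul1r mul0r add0r.
have [s1|s1] := eqVneq (size r) 1%N.
  have /size_poly1P [c c0 Ec] : size r == 1%N by rewrite s1.
  apply: Nh; apply: (@cancel_primitive c f (u * h + v * q)) => //.
  by rewrite -Ec Er mulrDl [v * g * h]mulrC; have -> : h * (v * g) = v * (g * h) by [ring]; rewrite Eq; ring.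
have [q3 [r3 [a [b [Ef Eq1 Er3 a0 b0]]]]] := cancel_const c10 E1.
have q30 : q3 != 0 by apply: contraNneq f0 => E; rewrite Ef E mul0r.
have r30 : r3 != 0 by apply: contraNneq f0 => E; rewrite Ef E mulr0.
have sr3 : size r = size r3 by rewrite Er3 size_Cmul.
have sfE : size f = (size q3 + size r3).-1 by rewrite Ef size_mul.
have r1 : (1 < size r3)%N by move: r30; rewrite -size_poly_gt0; lia.
have [sq|sq] := eqVneq (size q3) 1%N; last first.
  apply: (irr q3 r3 Ef); rewrite sfE; move: q30; rewrite -size_poly_gt0; lia.
have /size_poly1P [c c0 Ec] : size q3 == 1%N by rewrite sq.
have [c' Ec'] : divides c 1 by apply: (@primitive_const c r3) => //; rewrite -Ec -Ef.
apply: Ng; apply: (@cancel_primitive c2 f (q2 * b%:P * c'%:P)) => //.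
rewrite E2 Er3 Ef Ec; have -> : q2 * b%:P * c'%:P * (c%:P * r3) = q2 * b%:P * (c' * c)%:P * r3.
  by rewrite polyCM; ring.
by rewrite -Ec'; ring.
Qed.

(** Induction on the degree, and inside it on the number of primes in the leading coefficient, which
    bounds how often a prime constant can be split off. *)
Lemma factorial_poly : factorial {poly R}.
Proof.
move=> f; elim: {f}(size f) {-2}f (leqnn (size f)) => [|n IH] f sf f0.
  by case/eqP: f0; apply/eqP; rewrite -size_poly_leq0.
have prim_case g : (size g <= n.+1)%N -> g != 0 -> primitive g -> factored g.
  move=> sg g0 prim; case: (leqP (size g) 1) => [s1|s1].
    by rewrite (size1_polyC s1); apply: factored_polyC; rewrite -polyC_eq0 -size1_polyC.
  case: (classic (exists h q, [/\ g = h * q, (size h < size g)%N & (size q < size g)%N])).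
    move=> [h [q [Eg sh sq]]]; rewrite Eg; apply: factoredM; apply: IH.
    - by rewrite -ltnS (leq_trans sh).
    - by apply: contraNneq g0 => E0; rewrite Eg E0 mul0r.
    - by rewrite -ltnS (leq_trans sq).
    - by apply: contraNneq g0 => E0; rewrite Eg E0 mulr0.
  move=> N; apply/factored_prime/irreducible_prime => // h q Eg sh sq.
  by apply: N; exists h, q.
have lf : lead_coef f != 0 by rewrite lead_coef_eq0.
have [ps [u [Hps u1 E]]] := UR lf; clear lf.
elim: {ps}(size ps).+1 {-2}ps (ltnSn (size ps)) u f sf f0 Hps u1 E => [//|k IHk] ps sps u f sf f0 Hps u1 E.
case: (classic (primitive f)) => [prim|nprim]; first exact: prim_case.
have [p [pp [f' Ef]]] : exists p, prime_elt p /\ divides p%:P f.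
  by apply: NNPP => N; apply: nprim => p pp pf; apply: N; exists p.
have f'0 : f' != 0 by apply: contraNneq f0 => E0; rewrite Ef E0 mul0r.
have Ep : p * lead_coef f' = u * \prod_(q <- ps) q.
  by rewrite -E Ef lead_coefM lead_coefC mulrC.
have [v [qs [v1 Hqs sqs El]]] := prime_cancel pp u1 Hps Ep.
rewrite Ef; apply: factoredM; last exact/factored_prime/prime_polyC.
apply: (IHk qs _ v) => //; first by apply: leq_trans sqs _; rewrite -ltnS.
by rewrite (leq_trans _ sf) // Ef mulrC size_Cmul //; case: pp.
Qed.

End FactorialPoly.

Lemma factorial_mpoly (K : fieldType) n : factorial {mpoly K[n]}.
Proof.
elim: n => [|n IH]; last first.
  apply: (@factorial_iso {poly {mpoly K[n]}} _ (@of_poly K n) (@muni n K)).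
  - exact: of_polyK.
  - exact: muniK.
  - exact: factorial_poly.
move=> x x0; exists [::], x; split=> //; last by rewrite big_nil mulr1.
exists (x@_0)^-1%:MP; rewrite {2}[x]nvar0_mpolyC -mpolyCM mulVf //.
by apply: contraNneq x0 => E; rewrite [x]nvar0_mpolyC E mpolyC0.
Qed.

(** * Regular functions and limits along curves *)

Section Evaluation.
Variables (K : closedFieldType) (n : nat).
Implicit Types (v w : 'rV[K]_n) (p A B : {mpoly K[n]}).

Lemma peval_eq0 p : (forall v, peval p v = 0) -> p = 0.
Proof.
move=> H; apply: mpoly_eval0 => v; rewrite -[RHS](H (\row_i v i)).
by apply: meval_eq => i; rewrite mxE.
Qed.

Lemma pevalM A B v : peval (A * B) v = peval A v * peval B v.
Proof. exact: mevalM. Qed.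

Lemma peval_scale m p c v : p \is m.-homog -> peval p (c *: v) = c ^+ m * peval p v.
Proof.
move/dhomogP => hp; rewrite /peval !mevalE mulr_sumr big_seq [RHS]big_seq.
apply: eq_bigr => mu /hp <-; rewrite mulrCA; congr (_ * _).
rewrite /= mdegE -prodrXr -big_split; apply: eq_bigr => i _ /=.
by rewrite mxE exprMn.
Qed.

Definition path_eval p (g : 'rV[{poly K}]_n) : {poly K} := mmap (@polyC K) (fun i => g 0 i) p.

Lemma path_evalE p (g : 'rV[{poly K}]_n) t :
  (path_eval p g).[t] = peval p (\row_i (g 0 i).[t]).
Proof.
rewrite /path_eval -[_.[t]]/(horner_eval t _) rmorph_mmap /peval; apply: mmap_ext => [c|i] /=.
  by rewrite /horner_eval hornerC.
by rewrite mxE.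
Qed.

End Evaluation.

Lemma nonroot_const (K : closedFieldType) (q : {poly K}) :
  (forall x, q.[x] != 0) -> forall x y, q.[x] = q.[y].
Proof.
move=> H x y; have /eqP/size_poly1P [c _ ->] : size q = 1%N.
  by apply/eqP; apply: contraT => /closed_rootP [z /rootP qz]; have := H z; rewrite qz eqxx.
by rewrite !hornerC.
Qed.

Section RegularFunctions.
Variables (K : closedFieldType) (n : nat) (U : 'rV[K]_n -> Prop).
Hypothesis openU : forall v, U v -> exists2 s, peval s v != 0 & forall w, peval s w != 0 -> U w.

(** Any two local fractions agree on a dense set, hence as fractions of polynomials. The reduced
    denominator divides all local ones, so it vanishes nowhere on [U]. *)
Lemma regular_fraction phi v0 : U v0 -> regular_on U phi ->
  exists A B, forall v, U v -> peval B v != 0 /\ phi v = peval A v / peval B v.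
Proof.
move=> U0 reg; have [m1 [A1 [B1 [_ _ B1v E1]]]] := reg _ U0.
have nz (p : {mpoly K[n]}) v : peval p v != 0 -> p != 0.
  by apply: contraNneq => ->; rewrite /peval meval0.
have B10 := nz _ _ B1v.
have [A0 [B0 [B00 E0 red]]] := factorial_reduced (@factorial_mpoly K n) A1 B10.
exists A0, B0 => v Uv; have [m2 [A2 [B2 [_ _ B2v E2]]]] := reg _ Uv.
have B20 := nz _ _ B2v; have [s sv sU] := openU U0; have s0 := nz _ _ sv.
have E12 : A1 * B2 = A2 * B1.
  have : s * B1 * B2 * (A1 * B2 - A2 * B1) = 0.
    apply: peval_eq0 => w; rewrite !pevalM.
    have [->|sw] := eqVneq (peval s w) 0; first by rewrite !mul0r.
    have [->|B1w] := eqVneq (peval B1 w) 0; first by rewrite mulr0 !mul0r.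
    have [->|B2w] := eqVneq (peval B2 w) 0; first by rewrite mulr0 mul0r.
    have Uw := sU _ sw; have := E1 _ Uw B1w; rewrite (E2 _ Uw B2w) => E.
    rewrite /peval mevalB !mevalM -!/(peval _ w); apply/eqP; rewrite mulf_eq0; apply/orP; right.
    by rewrite subr_eq0 eq_sym -eqr_div //; apply/eqP.
  by move/eqP; rewrite !mulf_eq0 (negbTE s0) (negbTE B10) (negbTE B20) /= subr_eq0 => /eqP.
have [c Ec] := red _ _ E12.
have EA : A2 = c * A0.
  by apply: (mulIf B10); rewrite -E12 Ec -mulrA -E0; ring.
move: B2v; rewrite Ec pevalM mulf_eq0 negb_or => /andP [cv B0v]; split=> //.
rewrite E2 // ?Ec ?EA !pevalM; last by rewrite mulf_neq0.
by rewrite -mulf_div divff // mul1r.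
Qed.

End RegularFunctions.

Section RationalAtZero.
Variable K : closedFieldType.

(** The values of [h] are prescribed only where [Q] is nonzero, which includes 0. *)
Definition rational_at0 (h : K -> K) := exists P Q : {poly K},
  Q.[0] != 0 /\ forall t, Q.[t] != 0 -> h t = P.[t] / Q.[t].

Lemma rational_at0_const c : rational_at0 (fun _ => c).
Proof. by exists c%:P, 1; rewrite hornerC oner_neq0; split=> // t _; rewrite !hornerC divr1. Qed.

Lemma rational_at0_poly (P : {poly K}) : rational_at0 (fun t => P.[t]).
Proof. by exists P, 1; rewrite hornerC oner_neq0; split=> // t _; rewrite !hornerC divr1. Qed.

Lemma rational_at0D h h' : rational_at0 h -> rational_at0 h' ->
  rational_at0 (fun t => h t + h' t).
Proof.
move=> [P [Q [Q0 E]]] [P' [Q' [Q'0 E']]]; exists (P * Q' + P' * Q), (Q * Q').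
rewrite hornerM mulf_neq0 //; split=> // t; rewrite hornerM mulf_eq0 negb_or => /andP [Qt Q't].
by rewrite E // E' // hornerD !hornerM; field; rewrite Qt Q't.
Qed.

Lemma rational_at0M h h' : rational_at0 h -> rational_at0 h' ->
  rational_at0 (fun t => h t * h' t).
Proof.
move=> [P [Q [Q0 E]]] [P' [Q' [Q'0 E']]]; exists (P * P'), (Q * Q').
rewrite hornerM mulf_neq0 //; split=> // t; rewrite hornerM mulf_eq0 negb_or => /andP [Qt Q't].
by rewrite E // E' // !hornerM; field; rewrite Qt Q't.
Qed.

Lemma rational_at0_ext h h' : h =1 h' -> rational_at0 h -> rational_at0 h'.
Proof. by move=> E [P [Q [Q0 EQ]]]; exists P, Q; split=> // t Qt; rewrite -E EQ. Qed.

Lemma rational_at0_meval n (p : {mpoly K[n]}) (y : 'I_n -> K -> K) :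
  (forall i, rational_at0 (y i)) -> rational_at0 (fun t => p.@[fun i => y i t]).
Proof.
move=> Hy; have HX i k : rational_at0 (fun t => y i t ^+ k).
  elim: k => [|k IH]; first exact: (rational_at0_const 1).
  by apply: (rational_at0_ext (fun t => esym (exprS (y i t) k))); apply: rational_at0M.
have HM (m : 'X_{1..n}) : rational_at0 (fun t => \prod_i y i t ^+ m i).
  elim: (index_enum _) => [|i r IH].
    by apply: rational_at0_ext (rational_at0_const 1) => t; rewrite big_nil.
  by apply: rational_at0_ext (rational_at0M (HX i (m i)) IH) => t; rewrite big_cons.
apply: (@rational_at0_ext (fun t => \sum_(m <- msupp p) p@_m * \prod_i y i t ^+ m i)).
  by move=> t; rewrite mevalE.
elim: (msupp p : seq _) => [|m r IH].
  by apply: rational_at0_ext (rational_at0_const 0) => t; rewrite big_nil.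
apply: rational_at0_ext (rational_at0D (rational_at0M (rational_at0_const p@_m) (HM m)) IH) => t.
by rewrite big_cons.
Qed.

Lemma rational_at0_eq0 h : rational_at0 h -> (forall t, t != 0 -> h t = 0) -> h 0 = 0.
Proof.
move=> [P [Q [Q0 E]]] H; rewrite E //.
have Qn : Q != 0 by apply: contraNneq Q0 => ->; rewrite horner0.
have : P * (Q * 'X) = 0.
  apply: closed_poly0 => t; rewrite !hornerM hornerX.
  have [->|t0] := eqVneq t 0; first by rewrite !mulr0.
  have [->|Qt] := eqVneq Q.[t] 0; first by rewrite mul0r mulr0.
  by have := E t Qt; rewrite H // => /esym/eqP; rewrite mulf_eq0 invr_eq0 (negbTE Qt) orbF => /eqP ->; rewrite mul0r.
move/eqP; rewrite !mulf_eq0 (negbTE Qn) polyX_eq0 !orbF => /eqP ->.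
by rewrite horner0 mul0r.
Qed.

End RationalAtZero.

Section PathLimit.
Variables (K : closedFieldType) (n : nat) (U : 'rV[K]_n -> Prop).
Hypothesis openU : forall v, U v -> exists2 s, peval s v != 0 & forall w, peval s w != 0 -> U w.
Hypothesis affU : affine_open U.

(* Affine open sets have no codimension two holes: if functions without zeros on U do not vanish
   at the limit of a path in U, the coordinate functions extend to the limit. *)
Lemma path_limit (g : 'rV[{poly K}]_n) :
  let at_ t := \row_i (g 0 i).[t] in
  at_ 0 != 0 -> (forall t, t != 0 -> U (at_ t)) ->
  (forall B, (forall v, U v -> peval B v != 0) -> peval B (at_ 0) != 0) ->
  exists2 v, U v & same_point v (at_ 0).
Proof.
move=> at_ g0 Ug nv; have [m [phi [reg [T HT] Hpsi]]] := affU.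
have U1 := Ug 1 (oner_neq0 _).
have fr i : exists AB, forall v, U v -> peval AB.2 v != 0 /\ phi i v = peval AB.1 v / peval AB.2 v.
  by have [A [B H]] := regular_fraction openU U1 (reg i); exists (A, B).
have [AB HAB] := fin_all_exists fr.
pose y i t := peval (AB i).1 (at_ t) / peval (AB i).2 (at_ t).
have yr i : rational_at0 (y i).
  exists (path_eval (AB i).1 g), (path_eval (AB i).2 g); rewrite path_evalE; split.
    by apply: nv => v /(HAB i) [].
  by move=> t _; rewrite !path_evalE.
have yE i t : t != 0 -> phi i (at_ t) = y i t by move=> /Ug /(HAB i) [_ ->].
(* The image of [phi] is closed, so the limit of the image points is again the image of a point of
   [U]. *)
have [v Uv Ev] : exists2 v, U v & forall i, phi i v = y i 0.
  apply/HT => t tT; apply: (rational_at0_eq0 (rational_at0_meval t yr)) => x x0.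
  apply: ((HT (fun i => y i x)).1 _ _ tT); exists (at_ x); first exact: Ug.
  by move=> i; apply: yE.
have [psi [inv0 Hinv]] := Hpsi v Uv.
pose inv (w : 'rV[K]_n) : 'rV[K]_n := \row_i (psi i).@[fun l => phi l w].
rewrite -/(inv v) in inv0.
have {}Hinv w : U w -> inv w != 0 -> same_point w (inv w) by apply: Hinv.
have invy t i : t != 0 -> inv (at_ t) 0 i = (psi i).@[fun l => y l t].
  by move=> t0; rewrite mxE; apply: meval_eq => l; apply: yE.
have invv i : inv v 0 i = (psi i).@[fun l => y l 0].
  by rewrite mxE; apply: meval_eq => l; apply: Ev.
(* For [t != 0] the local inverse gives a vector proportional to [at_ t], or zero; the 2x2 minors
   therefore vanish, also in the limit. *)
have prop i j : at_ 0 0 i * inv v 0 j = at_ 0 0 j * inv v 0 i.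
  rewrite !invv; apply/eqP; rewrite -subr_eq0 -mulrN; apply/eqP.
  pose h t := (g 0 i).[t] * (psi j).@[fun l => y l t]
              + (-1) * ((g 0 j).[t] * (psi i).@[fun l => y l t]).
  have hr : rational_at0 h.
    apply: rational_at0D; first by apply: rational_at0M; [apply: rational_at0_poly|apply: rational_at0_meval].
    apply: rational_at0M; first exact: rational_at0_const.
    by apply: rational_at0M; [apply: rational_at0_poly|apply: rational_at0_meval].
  have := rational_at0_eq0 hr; rewrite /h !mulN1r mulrN !mxE; apply=> t t0.
  rewrite -!invy //; have [->|it] := eqVneq (inv (at_ t)) 0; first by rewrite !mxE; ring.
  have [c _ Ec] := Hinv _ (Ug _ t0) it.
  have Ei l : inv (at_ t) 0 l = c * (g 0 l).[t] by rewrite Ec !mxE.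
  by rewrite !Ei; ring.
exists v => //; have [c c0 Ec] := Hinv v Uv inv0.
have [j vj] : exists j, inv v 0 j != 0.
  apply: NNPP => NN; case/eqP: inv0; apply/rowP => j; rewrite [RHS]mxE; apply/eqP/contraT => ne.
  by case: NN; exists j.
pose a := at_ 0 0 j / inv v 0 j.
have Ea : at_ 0 = a *: inv v.
  by apply/rowP => i; rewrite [RHS]mxE /a mulrAC -prop mulfK.
have a0 : a != 0 by apply: contraNneq g0 => a0; rewrite Ea a0 scale0r.
by exists (a * c); [rewrite mulf_neq0|rewrite Ea {1}Ec scalerA].
Qed.

End PathLimit.

(** * Stability forbids destabilizing flags *)

(** Needed because a section of degree 0 is constant, with all of projective space as its locus. A
    denominator without zeros is constant along lines avoiding the origin, so it is nonzero at the
    origin too; regular functions are then constant on rays with a common limit at the origin, hence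
    constant. Constants cannot separate the points [E a] and [E b]. *)
Lemma projective_space_not_affine (K : closedFieldType) n (U : 'rV[K]_n -> Prop) (a b : 'I_n) :
  a != b -> (forall v, U v <-> v != 0) -> affine_open U -> False.
Proof.
move=> ab HU [m [phi [reg _ Hpsi]]].
pose E (l : 'I_n) : 'rV[K]_n := delta_mx 0 l.
have En l : E l != 0.
  by apply/eqP => /rowP /(_ l); rewrite !mxE !eqxx => /eqP; rewrite oner_eq0.
have openU v : U v -> exists2 s, peval s v != 0 & forall w, peval s w != 0 -> U w.
  move/HU => v0; have [l vl] : exists l, v 0 l != 0.
    apply: NNPP => NN; case/eqP: v0; apply/rowP => l; rewrite mxE; apply/eqP/contraT => ne.
    by case: NN; exists l.
  exists 'X_l; rewrite /peval ?mevalXU // => w; rewrite mevalXU => wl; apply/HU.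
  by apply: contraNneq wl => ->; rewrite mxE.
have scE (s t : K) : (s != 0) || (t != 0) -> s *: E a + t *: E b != 0.
  move=> st; apply/eqP => /rowP H; move: (H a) (H b); rewrite !mxE !eqxx (negbTE ab).
  rewrite eq_sym (negbTE ab) !mulr1 !mulr0 addr0 add0r => s0 t0.
  by move: st; rewrite s0 t0 !eqxx.
have B0 B : (forall v, U v -> peval B v != 0) -> peval B 0 != 0.
  move=> HB.
  have line s t t' : s != 0 -> peval B (s *: E a + t *: E b) = peval B (s *: E a + t' *: E b).
    move=> s0; pose g' : 'rV[{poly K}]_n := \row_i (((s *: E a) 0 i)%:P + (E b 0 i) *: 'X).
    have gE x : \row_i (g' 0 i).[x] = s *: E a + x *: E b.
      by apply/rowP => i; rewrite !mxE hornerD hornerC hornerZ hornerX [x * _]mulrC.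
    rewrite -!gE -!path_evalE; apply: nonroot_const => x; rewrite path_evalE gE.
    by apply/HB/HU/scE; rewrite s0.
  have line' s t s' : t != 0 -> peval B (s *: E a + t *: E b) = peval B (s' *: E a + t *: E b).
    move=> t0; pose g' : 'rV[{poly K}]_n := \row_i (((t *: E b) 0 i)%:P + (E a 0 i) *: 'X).
    have gE x : \row_i (g' 0 i).[x] = x *: E a + t *: E b.
      by apply/rowP => i; rewrite !mxE hornerD hornerC hornerZ hornerX [x * _]mulrC addrC.
    rewrite -!gE -!path_evalE; apply: nonroot_const => x; rewrite path_evalE gE.
    by apply/HB/HU/scE; rewrite t0 orbT.
  have cst s : s != 0 -> peval B (s *: E a) = peval B (E b).
    move=> s0; have := line s 0 1 s0; rewrite scale0r addr0 scale1r => ->.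
    by have := line' s 1 0 (oner_neq0 _); rewrite scale0r add0r scale1r.
  pose g : 'rV[{poly K}]_n := \row_i (E a 0 i *: 'X).
  have gE x : \row_i (g 0 i).[x] = x *: E a.
    by apply/rowP => i; rewrite !mxE hornerZ hornerX mulrC.
  have := @rational_at0_eq0 K (fun t => (path_eval B g).[t] + - peval B (E b)).
  rewrite path_evalE gE scale0r => H; suff : peval B 0 + - peval B (E b) = 0.
    by move/eqP; rewrite subr_eq0 => /eqP ->; apply/HB/HU/En.
  apply: H => [|t t0]; last by rewrite path_evalE gE cst // subrr.
  by apply: rational_at0D; [apply: rational_at0_poly|apply: rational_at0_const].
have phic i x y : U x -> U y -> phi i x = phi i y.
  have [A [B H]] := regular_fraction openU ((HU _).2 (En a)) (reg i).
  have B00 : peval B 0 != 0 by apply: B0 => v /H [].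
  suff P z : U z -> phi i z = peval A 0 / peval B 0 by move=> /P -> /P ->.
  move=> Uz; have z0 := (HU _).1 Uz.
  pose g : 'rV[{poly K}]_n := \row_i (z 0 i *: 'X).
  have gE t : \row_i (g 0 i).[t] = t *: z.
    by apply/rowP => l; rewrite !mxE hornerZ hornerX mulrC.
  have r : rational_at0 (fun t => peval A (t *: z) / peval B (t *: z)).
    exists (path_eval A g), (path_eval B g); rewrite path_evalE gE scale0r; split=> // t _.
    by rewrite !path_evalE gE.
  have := rational_at0_eq0 (rational_at0D r (rational_at0_const (- phi i z))).
  rewrite /= scale0r => H0; apply/eqP; rewrite eq_sym -subr_eq0; apply/eqP; apply: H0 => t t0.
  have Utz : U (t *: z) by apply/HU; rewrite scaler_eq0 negb_or t0.
  rewrite -(proj2 (H _ Utz)); have [k [A' [B' [hA hB Bz Ez]]]] := reg i _ Uz.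
  rewrite !Ez // ?(peval_scale _ _ hA) ?(peval_scale _ _ hB); last first.
    by rewrite mulf_neq0 // expf_neq0.
  by rewrite -mulf_div divff ?mul1r ?subrr // expf_neq0.
have [psi [inv0 Hinv]] := Hpsi _ ((HU _).2 (En a)).
pose inv (w : 'rV[K]_n) : 'rV[K]_n := \row_i (psi i).@[fun l => phi l w].
have invE w : U w -> inv w = inv (E a).
  move=> Uw; apply/rowP => i; rewrite !mxE; apply: meval_eq => l.
  by apply: phic => //; apply/HU/En.
have sp l : same_point (E l) (inv (E a)).
  have Ul : U (E l) by apply/HU/En.
  by rewrite -(invE _ Ul); apply: Hinv => //; rewrite -/(inv _) invE.
have [c c0 Ec] := sp a; have [c' _ Ec'] := sp b.
have := congr1 (fun M : 'rV[K]_n => M 0 a) Ec'; rewrite Ec !mxE !eqxx (negbTE ab) mulr1 mulr0.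
by move/eqP; rewrite (negbTE c0).
Qed.

Lemma sl2_generation (K : fieldType) (P : 'M[K]_2 -> Prop) :
  (forall t, P (mx2 1 t 0 1)) -> (forall t, P (mx2 1 0 t 1)) ->
  (forall g h, \det g = 1 -> \det h = 1 -> P g -> P h -> P (g *m h)) ->
  forall g, \det g = 1 -> P g.
Proof.
move=> PU PL PM.
have dU t : \det (mx2 1 t 0 1 : 'M[K]_2) = 1 by rewrite det_mx2 mulr0 subr0 mulr1.
have dL t : \det (mx2 1 0 t 1 : 'M[K]_2) = 1 by rewrite det_mx2 mul0r subr0 mulr1.
have main (g : 'M[K]_2) : \det g = 1 -> g 1 0 != 0 -> P g.
  move=> Dg c0; have -> : g = mx2 1 ((g 0 0 - 1) / g 1 0) 0 1 *m (mx2 1 0 (g 1 0) 1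
      *m mx2 1 ((g 1 1 - 1) / g 1 0) 0 1).
    move: Dg; rewrite det2E => /eqP; rewrite subr_eq => /eqP D.
    have E : g 0 1 = (g 0 0 * g 1 1 - 1) / g 1 0 by rewrite D; field.
    apply/matrixP => i j; rewrite !mulmx2E.
    by case: (ord2P i) => ->; case: (ord2P j) => ->; rewrite !mxE /= ?E; field.
  apply: (PM) => //; last by apply: PM.
  by rewrite det_mulmx dU dL mulr1.
move=> g Dg; have [c0|c0] := eqVneq (g 1 0) 0; last exact: main.
have -> : g = mx2 1 0 (-1) 1 *m (mx2 1 0 1 1 *m g).
  rewrite mulmxA; have -> : mx2 1 0 (-1) 1 *m mx2 1 0 1 1 = 1%:M :> 'M[K]_2.
    apply/matrixP => i j; rewrite mulmx2E.
    by case: (ord2P i) => ->; case: (ord2P j) => ->; rewrite !mxE /=; ring.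
  by rewrite mul1mx.
have D2 : \det (mx2 1 0 1 1 *m g) = 1 by rewrite det_mulmx dL Dg mulr1.
apply: PM => //; apply: (main) => //; rewrite mulmx2E !mxE /= c0 mulr0 addr0 mul1r.
apply: contra_eq_neq Dg => g0; rewrite det2E g0 c0 mul0r mulr0 subr0 eq_sym; exact: oner_neq0.
Qed.

Section ForwardDirection.
Variables (K : closedFieldType) (d e : nat).
Local Notation N := (d.+1 * e.+1)%N.
Implicit Types (f : 'M[K]_(d.+1, e.+1)) (U : 'rV[K]_N -> Prop).

Lemma sl2_act_coordE (g : 'M[K]_2) (v : 'rV[K]_N) :
  sl2_act_coord g v = mxvec (act g (vec_mx v)).
Proof. by rewrite /sl2_act_coord sl2_actE. Qed.

Lemma path_act (M : 'M[{poly K}]_2) f t :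
  \row_i (mxvec (act M (map_mx polyC f)) 0 i).[t]
    = mxvec (act (map_mx (horner_eval t) M) f).
Proof.
apply/rowP => i; rewrite mxE -[_.[t]]/(horner_eval t _) map_mxvec map_act.
congr (mxvec (act _ _) 0 i); apply/matrixP => a b.
by rewrite !mxE /= /horner_eval hornerC.
Qed.

(** Along a unipotent one-parameter subgroup [B] is a polynomial in the parameter without zeros,
    hence constant; the unipotent matrices generate the group. *)
Lemma nonvanishing_invariant U B : sl2_stable U -> (forall v, U v -> peval B v != 0) ->
  forall (g : 'M[K]_2) f, \det g = 1 -> U (mxvec f) -> peval B (mxvec (act g f)) = peval B (mxvec f).
Proof.
move=> SU HB.
have St (g : 'M[K]_2) f : \det g = 1 -> U (mxvec f) -> U (mxvec (act g f)).
  by move=> Dg /(SU g _ Dg); rewrite sl2_act_coordE mxvecK.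
have path (M : 'M[{poly K}]_2) f : (forall t, \det (map_mx (horner_eval t) M) = 1) ->
    U (mxvec f) -> forall t t', peval B (mxvec (act (map_mx (horner_eval t) M) f))
      = peval B (mxvec (act (map_mx (horner_eval t') M) f)).
  move=> DM Uf t t'; rewrite -!path_act -!path_evalE; apply: nonroot_const => x.
  by rewrite path_evalE path_act; apply/HB/St.
have map2 (a b c l : {poly K}) t : map_mx (horner_eval t) (mx2 a b c l) = mx2 a.[t] b.[t] c.[t] l.[t].
  by rewrite map_mx2.
move=> g f Dg; move: g Dg f; apply: sl2_generation => [t f Uf|t f Uf|g h Dg Dh Hg Hh f Uf].
- have := path (mx2 1 'X 0 1) f _ Uf t 0; rewrite !map2 !hornerE => ->.
    by have -> : mx2 1 0 0 1 = 1%:M :> 'M[K]_2 by [apply/matrixP => i j; rewrite !mxE;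
      case: (ord2P i) => ->; case: (ord2P j) => ->]; rewrite act1.
  by move=> x; rewrite map2 det_mx2 !hornerE; ring.
- have := path (mx2 1 0 'X 1) f _ Uf t 0; rewrite !map2 !hornerE => ->.
    by have -> : mx2 1 0 0 1 = 1%:M :> 'M[K]_2 by [apply/matrixP => i j; rewrite !mxE;
      case: (ord2P i) => ->; case: (ord2P j) => ->]; rewrite act1.
  by move=> x; rewrite map2 det_mx2 !hornerE; ring.
- by rewrite actM Hg ?Hh //; apply: St.
Qed.

Definition torus (t : K) : 'M[K]_2 := mx2 t^-1 0 0 t.

Lemma det_torus t : t != 0 -> \det (torus t) = 1.
Proof. by move=> t0; rewrite det_mx2 mulVf // mulr0 subr0. Qed.

(** The orbit map of the torus. Subtraction truncates where the exponent would be negative; the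
    entries there are zero in all uses, so the path extends to [t = 0]. *)
Definition torus_path f : 'rV[{poly K}]_N :=
  mxvec (\matrix_(i, j) ((f i j)%:P * 'X^((i + j).*2 - (d + e)))).

Lemma torus_pathE f t : \row_i (torus_path f 0 i).[t] =
  mxvec (\matrix_(i, j) (f i j * t ^+ ((i + j).*2 - (d + e)))).
Proof.
apply/rowP => i; rewrite mxE /torus_path; case/mxvec_indexP: i => a b.
by rewrite !mxvecE !mxE hornerM hornerC hornerXn.
Qed.

Lemma torus_path_act T f t : (forall h, (T <= h)%N -> (d + e <= h.*2)%N) ->
  (forall (i : 'I_d.+1) (j : 'I_e.+1), (i + j < T)%N -> f i j = 0) -> t != 0 ->
  \row_i (torus_path f 0 i).[t] = mxvec (act (torus t) f).
Proof.
move=> HT Hf t0; rewrite torus_pathE; congr mxvec; apply/matrixP => i j.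
rewrite mxE act_diag ?mxE //=; case: (ltnP (i + j) T) => [/Hf->|ij].
  by rewrite mul0r mulr0.
rewrite mulrC; congr (_ * _); have := HT _ ij; have := leq_ord i; have := leq_ord j => je id nij.
have -> : t ^+ (i + j) = t ^+ ((d - i) + (e - j)) * t ^+ ((i + j).*2 - (d + e)).
  by rewrite -exprD; congr (_ ^+ _); lia.
by rewrite mulrA -exprMn mulVf // expr1n mul1r.
Qed.

Definition torus_limit f : 'M[K]_(d.+1, e.+1) :=
  \matrix_(i, j) if (i + j).*2 == (d + e)%N then f i j else 0.

Lemma torus_path0 T f : (forall h, (T <= h)%N -> (d + e <= h.*2)%N) ->
  (forall (i : 'I_d.+1) (j : 'I_e.+1), (i + j < T)%N -> f i j = 0) ->
  \row_i (torus_path f 0 i).[0] = mxvec (torus_limit f).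
Proof.
move=> HT Hf; rewrite torus_pathE; congr mxvec; apply/matrixP => i j; rewrite !mxE expr0n.
case: (ltnP (i + j) T) => [/Hf->|ij]; first by rewrite mul0r if_same.
have := HT _ ij; rewrite subn_eq0 => nij; case: eqP => [->|ne]; first by rewrite leqnn mulr1.
by have -> : ((i + j).*2 <= d + e)%N = false by [lia]; rewrite mulr0.
Qed.

Lemma torus_limit_fixed f t : t != 0 -> act (torus t) (torus_limit f) = torus_limit f.
Proof.
move=> t0; apply/matrixP => i j; rewrite act_diag ?mxE //=; case: eqP => [ij|_]; last by rewrite mulr0.
have := leq_ord i; have := leq_ord j => je id.
have -> : ((d - i) + (e - j) = i + j)%N by lia.
by rewrite -exprMn mulVf // expr1n mul1r.
Qed.

Lemma torus_limit_in U f T : (forall v, U v -> exists2 s, peval s v != 0 & forall w, peval s w != 0 -> U w) ->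
  affine_open U -> sl2_stable U -> U (mxvec f) ->
  (forall h, (T <= h)%N -> (d + e <= h.*2)%N) ->
  (forall (i : 'I_d.+1) (j : 'I_e.+1), (i + j < T)%N -> f i j = 0) ->
  torus_limit f != 0 -> exists2 v, U v & same_point v (mxvec (torus_limit f)).
Proof.
move=> oU aU sU Uf HT Hf f0.
have Ut t : t != 0 -> U (\row_i (torus_path f 0 i).[t]).
  move=> t0; rewrite (torus_path_act HT Hf t0) -[f]mxvecK -sl2_act_coordE.
  by apply: sU => //; apply: det_torus.
rewrite -(torus_path0 HT Hf); apply: path_limit => //.
  by rewrite (torus_path0 HT Hf) mxvec_eq0.
move=> B HB; rewrite -path_evalE.
have r := rational_at0D (rational_at0_poly (path_eval B (torus_path f)))
   (rational_at0_const (- peval B (mxvec f))).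
have /eqP : (path_eval B (torus_path f)).[0] + - peval B (mxvec f) = 0.
  apply: (rational_at0_eq0 r) => t t0.
  rewrite path_evalE (torus_path_act HT Hf t0) (nonvanishing_invariant sU HB) ?subrr //.
  exact: det_torus.
by rewrite subr_eq0 => /eqP ->; apply: HB.
Qed.

Variables (k : fieldType) (iota : {rmorphism k -> K}).

Lemma invariant_peval m s (g : 'M[K]_2) f : invariant_section m s -> \det g = 1 ->
  peval (map_mpoly iota s) (mxvec (act g f)) = peval (map_mpoly iota s) (mxvec f).
Proof.
move=> [_ /(_ K iota g (mxvec f)) inv] Dg; have := inv Dg.
by rewrite sl2_act_coordE mxvecK.
Qed.

(** For this threshold only positive weights survive, so the limit is the zero vector, where
    sections of positive degree vanish; an invariant keeps its value along the path. *)
Lemma semistable_not_destab f : f != 0 -> semistable iota f -> ~ destab (d + e)./2.+1 f.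
Proof.
move=> f0 [m [s [inv [_ sf] aff]]] [g Dg Hg]; set f' := act g f in Hg.
have HT h : ((d + e)./2.+1 <= h)%N -> (d + e <= h.*2)%N by lia.
have f'0 : f' != 0 by apply: contraNneq f0 => E; rewrite -(act_inj f Dg) -/f' E act0.
have sf' : peval (map_mpoly iota s) (mxvec f') = peval (map_mpoly iota s) (mxvec f).
  exact: (invariant_peval f inv Dg).
have hs := dhomog_map iota (proj1 inv).
have [m0|m0] := posnP m; last first.
  have r := rational_at0D (rational_at0_poly (path_eval (map_mpoly iota s) (torus_path f')))
     (rational_at0_const (- peval (map_mpoly iota s) (mxvec f))).
  have E : (path_eval (map_mpoly iota s) (torus_path f')).[0]
      + - peval (map_mpoly iota s) (mxvec f) = 0.
    apply: (rational_at0_eq0 r) => t t0; rewrite path_evalE (torus_path_act HT Hg t0).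
    by rewrite (invariant_peval f' inv (det_torus t0)) sf' subrr.
  have E0 : torus_limit f' = 0.
    apply/matrixP => i j; rewrite mxE [RHS]mxE; case: eqP => // ij; apply: Hg; lia.
  move/eqP: E; rewrite path_evalE (torus_path0 HT Hg) E0 linear0 (peval_homog0 hs m0) add0r.
  by rewrite oppr_eq0 (negbTE sf).
(* Degree 0: the locus is the whole projective space, of positive dimension since a nonzero
   destabilized form requires [0 < d + e]. *)
have [a [b ab]] : exists a b : 'I_N, a != b.
  have : (0 < d + e)%N.
    rewrite lt0n; apply: contraNneq f'0 => n0; apply/eqP/matrixP => i j; rewrite [RHS]mxE.
    by apply: Hg; rewrite n0 /=; have := leq_ord i; have := leq_ord j; lia.
  move=> n0; have N1 : (1 < N)%N by nia.
  by exists (Ordinal (ltnW N1)), (Ordinal N1).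
apply: (projective_space_not_affine ab _ aff) => v; split=> [[]//|v0]; split=> //.
apply: contraNneq sf => s0; have := peval_scale 0 v hs; have := peval_scale 0 (mxvec f) hs.
by rewrite !scale0r m0 !expr0 !mul1r => <- ->; rewrite s0.
Qed.

Lemma stable_not_destab f : f != 0 -> stable iota f -> ~ destab (uphalf (d + e)) f.
Proof.
move=> f0 [ss [[S HS] [U [oU aU sU cU Uf]]]] [g Dg Hg]; set f' := act g f in Hg.
have HT h : (uphalf (d + e) <= h)%N -> (d + e <= h.*2)%N.
  by rewrite leq_uphalf_double.
have Uf' : U (mxvec f') by have := sU g _ Dg Uf; rewrite sl2_act_coordE mxvecK.
(* A zero limit would mean that the entries of weight zero vanish as well, so that [f] is
   destabilized for the semistable threshold. *)
have l0 : torus_limit f' != 0.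
  apply/eqP => E; case: (semistable_not_destab f0 ss); exists g => // i j ij.
  case: (ltnP (i + j) (uphalf (d + e))) => [/Hg//|ij'].
  have := congr1 (fun M : 'M_(_, _) => M i j) E; rewrite mxE [RHS]mxE.
  by have := HT _ ij'; case: eqP => // ne ge; lia.
have [T hT UT] := oU.
have scaleU v c : c != 0 -> U v -> U (c *: v).
  move=> c0 /UT [s sT [v0 sv]]; apply/UT; exists s => //; split.
    by rewrite scaler_eq0 negb_or c0.
  have [m hs] := hT _ sT; rewrite (peval_scale _ _ (dhomog_map iota hs)).
  by rewrite mulf_neq0 // expf_neq0.
have openU v : U v -> exists2 s, peval s v != 0 & forall w, peval s w != 0 -> U w.
  move/UT => [s sT [v0 sv]]; have [l vl] : exists l, v 0 l != 0.
    apply: NNPP => NN; case/eqP: v0; apply/rowP => l; rewrite mxE; apply/eqP/contraT => ne.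
    by case: NN; exists l.
  exists ('X_l * map_mpoly iota s) => [|w].
    by rewrite pevalM mulf_neq0 // /peval mevalXU.
  rewrite pevalM mulf_eq0 negb_or {1}/peval mevalXU => /andP [wl sw]; apply/UT; exists s => //; split=> //.
  by apply: contraNneq wl => ->; rewrite mxE.
have [v Uv [c c0 Ec]] := torus_limit_in openU aU sU Uf' HT Hg l0.
have Ul : U (mxvec (torus_limit f')) by rewrite Ec; apply: scaleU.
have [TT _ HTT] := cU _ Uf.
(* The equations of the closed orbit vanish on the path for [t != 0], hence at its limit, which lies
   in [U]. *)
have [g1 Dg1 [b b0 Eb]] : sl2_orbit (mxvec f) (mxvec (torus_limit f')).
  apply/HTT; split=> // h hTT; rewrite -(torus_path0 HT Hg) -path_evalE.
  apply: (rational_at0_eq0 (rational_at0_poly _)) => t t0.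
  rewrite path_evalE (torus_path_act HT Hg t0); apply: (proj2 ((HTT _).1 _)) => //.
  exists (torus t *m g); first by rewrite det_mulmx det_torus // Dg mulr1.
  by exists 1; rewrite ?oner_neq0 // scale1r sl2_act_coordE mxvecK actM.
have {}Eb : torus_limit f' = b *: act g1 f.
  by apply: (can_inj mxvecK); rewrite Eb sl2_act_coordE mxvecK linearZ.
have ug1 : g1 \in unitmx by rewrite unitmxE Dg1 unitr1.
(* A conjugate of the torus fixes [f], while the finite list [S] would leave only finitely many
   values of [t]. *)
have inS t : t != 0 -> invmx g1 *m torus t *m g1 \in S.
  move=> t0; apply: HS; first by rewrite !det_mulmx det_inv Dg1 det_torus // invr1 !mulr1.
  exists 1; rewrite ?oner_neq0 // scale1r sl2_act_coordE mxvecK; congr mxvec.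
  have E : act (torus t) (act g1 f) = act g1 f.
    have := torus_limit_fixed f' t0; rewrite Eb act_scale; exact: (scalerI b0).
  by rewrite -mulmxA actM actM E act_inj.
pose S' := [seq (g1 *m s *m invmx g1) 1 1 | s <- S].
have inS' t : t != 0 -> t \in S'.
  move=> t0; apply/mapP; exists (invmx g1 *m torus t *m g1); first exact: inS.
  by rewrite !mulmxA mulmxV // mul1mx mulmxK // mxE.
have : 'X * \prod_(s <- S') ('X - s%:P) = 0 :> {poly K}.
  apply: closed_poly0 => t; rewrite hornerM hornerX.
  have [->|t0] := eqVneq t 0; first by rewrite mul0r.
  have : root (\prod_(s <- S') ('X - s%:P)) t by rewrite root_prod_XsubC inS'.
  by move/rootP => ->; rewrite mulr0.
by apply/eqP; rewrite mulf_neq0 ?polyX_eq0 // monic_neq0 // monic_prod_XsubC.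
Qed.

End ForwardDirection.

(** * Equations of the destabilized locus *)

Section PlaceCongruence.
Variables (K : closedFieldType) (F : fieldType) (kap : {rmorphism K -> F}) (p : place kap).
Variables (d e : nat).

(* The pairs of regular elements with the same residue form a subring of F * F. *)
Lemma small_act_sub (g g' : 'M[F]_2) (a a' : 'M[F]_(d.+1, e.+1)) i j :
  (forall r s, [/\ reg p (g r s), reg p (g' r s) & small p (g r s - g' r s)]) ->
  (forall r s, [/\ reg p (a r s), reg p (a' r s) & small p (a r s - a' r s)]) ->
  small p (act g a i j - act g' a' i j).
Proof.
move=> Hg Ha; pose A := (F * F)%type.
pose G (n : nat) (x : A) := [/\ reg p x.1, reg p x.2 & small p (x.1 - x.2)].
pose pg : 'M[A]_2 := \matrix_(r, s) (g r s, g' r s).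
pose pa : 'M[A]_(d.+1, e.+1) := \matrix_(r, s) (a r s, a' r s).
have : G (0 + d * 0 + e * 0)%N (act pg pa i j).
  apply: (graded_act (G := G)) => [n||n x y|n m x y|r s|r s].
  - by split; rewrite /= ?subrr; [exact: reg0|exact: reg0|exact: small0].
  - by split; rewrite /= ?subrr; [exact: reg1|exact: reg1|exact: small0].
  - move=> [a1 a2 a3] [b1 b2 b3]; split=> /=; try exact: regD.
    by rewrite opprD addrACA; apply: smallD.
  - move=> [a1 a2 a3] [b1 b2 b3]; split=> /=; try exact: regM.
    have -> : x.1 * y.1 - x.2 * y.2 = x.1 * (y.1 - y.2) + y.2 * (x.1 - x.2) by ring.
    by apply: smallD; apply: smallM.
  - by rewrite mxE; apply: Hg.
  - by rewrite mxE; apply: Ha.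
have -> : g = map_mx fst pg by apply/matrixP => r s; rewrite !mxE.
have -> : g' = map_mx snd pg by apply/matrixP => r s; rewrite !mxE.
have -> : a = map_mx fst pa by apply/matrixP => r s; rewrite !mxE.
have -> : a' = map_mx snd pa by apply/matrixP => r s; rewrite !mxE.
have -> : act (map_mx fst pg) (map_mx fst pa) i j = fst (act pg pa i j).
  by rewrite -map_act mxE.
have -> : act (map_mx snd pg) (map_mx snd pa) i j = snd (act pg pa i j).
  by rewrite -map_act mxE.
by case.
Qed.

End PlaceCongruence.

(** Such a substitution sends x_1 and y_1 to multiples of themselves, so it does not lower the order
    of vanishing at [1 : 0]. *)
Lemma act_lower (R : comNzRingType) d e T (h : 'M[R]_2) (a : 'M[R]_(d.+1, e.+1)) :
  h 0 1 = 0 -> (forall (i : 'I_d.+1) (j : 'I_e.+1), (i + j < T)%N -> a i j = 0) ->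
  forall (i : 'I_d.+1) (j : 'I_e.+1), (i + j < T)%N -> act h a i j = 0.
Proof.
move=> h01 a0 i j ij.
have tri D (r s : 'I_D.+1) : (r < s)%N -> sym_mx D h r s = 0.
  move=> rs; rewrite mxE /sym_poly h01 /lin add0r exprZn mulrC -scalerAl -mulrC coefZ.
  by rewrite [_ * 'X^s]mulrC coefXnM rs mulr0.
rewrite actE big1 // => k _; rewrite big1 // => l _.
have [ki|ki] := ltnP i k; first by rewrite (tri _ _ _ ki) mulr0 mul0r.
have [lj|lj] := ltnP j l; first by rewrite (tri _ _ _ lj) mulr0.
by rewrite a0 ?mul0r //; apply: leq_ltn_trans ij; apply: leq_add.
Qed.

(* In a shortest combination with coefficients in K annihilated by E, every term is annihilated. *)
Lemma relation_descent (k : fieldType) (K : fieldType) (iota : {rmorphism k -> K}) n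
    (V : zmodType) (sc : k -> V -> V) (E : V -> {mpoly k[n]}) (phi : V -> K) :
  (forall x y a, E (x - sc a y) = E x - a *: E y) ->
  (forall x y a, phi (x - sc a y) = phi x - iota a * phi y) ->
  (forall x, E x = 0 -> phi x = 0) ->
  forall s : seq (K * V),
    \sum_(c <- s) c.1 *: map_mpoly iota (E c.2) = 0 -> \sum_(c <- s) c.1 * phi c.2 = 0.
Proof.
move=> El phil H s; have [r] := ubnP (size s); elim: r s => // r IH s sr Hs.
case: (classic (exists2 x : K * V, x \in s & E x.2 <> 0)) => [[x xs Ex]|N]; last first.
  rewrite big_seq big1 // => x xs; rewrite H ?mulr0 //.
  by apply: NNPP => Ex; apply: N; exists x.
have [m am] : exists m, (E x.2)@_m != 0.
  apply: NNPP => N; apply: Ex; apply/mpolyP => m; rewrite mcoeff0.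
  by apply/eqP/contraT => ne; case: N; exists m.
set a := (E x.2)@_m in am.
pose b (c : K * V) := (E c.2)@_m / a.
pose s' := [seq (c.1, c.2 - sc (b c) x.2) | c <- rem x s].
have Ec : \sum_(c <- rem x s) c.1 * iota (b c) = - x.1.
  have := congr1 (mcoeff m) Hs; rewrite (big_rem x) //= mcoeffD mcoeff0 mcoeffZ mcoeff_map_mpoly.
  rewrite raddf_sum /= -/a => E0.
  have ia : iota a != 0 by rewrite fmorph_eq0.
  apply: (mulIf ia); apply/eqP; rewrite mulNr -addr_eq0 -[X in _ == X]E0 addrC; apply/eqP.
  congr (_ + _); rewrite mulr_suml; apply: eq_bigr => c _.
  by rewrite mcoeffZ mcoeff_map_mpoly /= /b -mulrA -rmorphM divfK.
have Hs' : \sum_(c <- s') c.1 *: map_mpoly iota (E c.2) = 0.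
  rewrite /s' big_map -[X in _ = X]Hs [X in _ = X](big_rem x) //=.
  under eq_bigr do rewrite El rmorphB /= map_mpolyZ scalerBr scalerA.
  by rewrite big_split /= sumrN -scaler_suml Ec scaleNr opprK addrC.
have /IH /(_ Hs') : (size s' < r)%N.
  by rewrite size_map size_rem //; move: sr; case: (s) xs.
rewrite /s' big_map => {Hs'} Hs'.
transitivity (\sum_(c <- rem x s) c.1 * phi (c.2 - sc (b c) x.2)) => //.
rewrite (big_rem x) //=.
under [X in _ = X]eq_bigr do rewrite phil mulrBr mulrA.
by rewrite big_split /= sumrN -mulr_suml Ec mulNr opprK addrC.
Qed.

Lemma graded_components (R S : comNzRingType) n n' (psi : {rmorphism {mpoly R[n]} -> {mpoly S[n']}}) s P :
  (0 < s)%N -> (forall m Q, Q \is m.-homog -> psi Q \is (m * s).-homog) ->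
  psi P = 0 -> forall m, psi (pihomog mdeg m P) = 0.
Proof.
move=> s0 H E m; pose r := maxn (msize P) m.+1.
have mr : (m < r)%N by rewrite leq_max leqnn orbT.
have Pr : (msize P <= r)%N by rewrite leq_max leqnn.
have := congr1 (pihomog mdeg (m * s)) E.
rewrite pihomog0 (pihomog_partitionE Pr) rmorph_sum raddf_sum /=.
rewrite (bigD1 (Ordinal mr)) //= pihomog_dE; last exact/H/pihomogP.
rewrite big1 ?addr0 -?(pihomog_partitionE Pr) // => i ne.
apply: pihomog_ne0 (H _ _ (pihomogP _ _ _)).
by rewrite eqn_pmul2r // -val_eqE in ne *.
Qed.

Lemma shear_mx2_eq0 (F : fieldType) (g : 'M[F]_2) : g 1 1 != 0 ->
  (mx2 1 (- g 0 1 / g 1 1) 0 1 *m g) 0 1 = 0.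
Proof. by move=> g11; rewrite mulmx2E !mxE /= mul1r divfK // subrr. Qed.

Lemma weyl_mx2_eq0 (F : fieldType) (g : 'M[F]_2) : g 0 1 != 0 ->
  (mx2 (- g 0 1 / g 1 1)^-1 1 (-1) 0 *m g) 0 1 = 0.
Proof.
by move=> g01; rewrite mulmx2E !mxE /= mul1r invf_div invrN mulrN mulNr divfK // addNr.
Qed.

Lemma mx2_rel (A : nzRingType) (P : A -> A -> Prop) a b c e a' b' c' e' :
  P a a' -> P b b' -> P c c' -> P e e' -> forall r s, P (mx2 a b c e r s) (mx2 a' b' c' e' r s).
Proof. by move=> *; rewrite !mxE; do 2!case: ifP. Qed.

Section DestabilizedLocus.
Variables (k : fieldType) (K : closedFieldType) (iota : {rmorphism k -> K}) (d e T : nat).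
Local Notation N := (d.+1 * e.+1)%N.
Implicit Types (f w : 'M[K]_(d.+1, e.+1)).

Definition gen_group (R : comNzRingType) : 'M[{mpoly R[4 + N]}]_2 :=
  mx2 'X_(lshift N o0) 'X_(lshift N o1) 'X_(lshift N o2) 'X_(lshift N o3).

Definition gen_flag (R : comNzRingType) : 'M[{mpoly R[4 + N]}]_(d.+1, e.+1) :=
  \matrix_(i, j) if (i + j < T)%N then 0 else 'X_(rshift 4 (mxvec_index i j)).

(* The generic form with a point of multiplicity T on the diagonal. *)
Definition gen_destab (R : comNzRingType) : 'M[{mpoly R[4 + N]}]_(d.+1, e.+1) :=
  act (gen_group R) (gen_flag R).

(** Pullback along the parametrization [(g, w) |-> g w] of the destabilized locus; its kernel
    consists of equations of that locus. *)
Definition flag_pull (R : comNzRingType) (P : {mpoly R[N]}) : {mpoly R[4 + N]} :=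
  mmap (@mpolyC (4 + N) R) (fun i => mxvec (gen_destab R) 0 i) P.

HB.instance Definition _ (R : comNzRingType) := GRing.RMorphism.copy (@flag_pull R)
  (mmap (@mpolyC (4 + N) R) (fun i => mxvec (gen_destab R) 0 i)).

Lemma map_gen_group (R S : comNzRingType) (phi : {rmorphism R -> S}) :
  map_mx (map_mpoly phi) (gen_group R) = gen_group S.
Proof. by rewrite map_mx2 /= !map_mpolyX. Qed.

Lemma map_gen_flag (R S : comNzRingType) (phi : {rmorphism R -> S}) :
  map_mx (map_mpoly phi) (gen_flag R) = gen_flag S.
Proof.
by apply/matrixP => r s; rewrite !mxE; case: ifP => _; rewrite ?map_mpolyX ?rmorph0.
Qed.

Lemma flag_pull_map (R S : comNzRingType) (phi : {rmorphism R -> S}) P :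
  flag_pull (map_mpoly phi P) = map_mpoly phi (flag_pull P).
Proof.
rewrite /flag_pull [RHS]rmorph_mmap /map_mpoly [LHS](@rmorph_mmap _ {mpoly S[N]} _ _ (mmap _ _)).
apply: mmap_ext => [c|i] /=; first by rewrite mmapC map_mpolyC.
rewrite mmapX mmap1U (map_mxvec (map_mpoly phi)) /gen_destab map_act.
by rewrite map_gen_group map_gen_flag.
Qed.

Lemma flag_pull_homog (R : comNzRingType) m (P : {mpoly R[N]}) :
  P \is m.-homog -> flag_pull P \is (m * (1 + d + e)).-homog.
Proof.
apply: (@dhomog_mmap R _ R _ idfun) => i; case/mxvec_indexP: i => a b; rewrite mxvecE /gen_destab.
suff : act (gen_group R) (gen_flag R) a b \is (1 + d * 1 + e * 1).-homog by rewrite !muln1.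
apply: dhomog_act => r s; rewrite mxE; last first.
  by case: ifP => _; rewrite ?rpred0 // dhomogX /= mdeg1.
by do 2!case: ifP => _; rewrite dhomogX /= mdeg1.
Qed.

Lemma flag_pull_eval (R : comNzRingType) (P : {mpoly R[N]}) (g : 'M[R]_2) (w : 'M[R]_(d.+1, e.+1)) :
  (forall (i : 'I_d.+1) (j : 'I_e.+1), (i + j < T)%N -> w i j = 0) -> exists v, (flag_pull P).@[v] = P.@[fun i => mxvec (act g w) 0 i].
Proof.
move=> w0; exists (fun i => match split i with inl a => mx_entry g a | inr b => mxvec w 0 b end).
set v := (fun i : 'I_(4 + N) => _).
have vl a : v (lshift N a) = mx_entry g a.
  by rewrite /v (_ : lshift N a = unsplit (inl a)) // unsplitK.
have vr b : v (rshift 4 b) = mxvec w 0 b.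
  by rewrite /v (_ : rshift 4 b = unsplit (inr b)) // unsplitK.
rewrite /flag_pull rmorph_mmap [RHS]/meval; apply: mmap_ext => [c|i] /=; first by rewrite mevalC.
rewrite (map_mxvec (meval v)) /gen_destab map_act.
have -> : map_mx (meval v) (gen_group R) = g.
  by rewrite map_mx2 /= !mevalXU !vl [RHS]mx2_eta.
suff -> : map_mx (meval v) (gen_flag R) = w by [].
apply/matrixP => r s; rewrite !mxE; case: ifP => rs; first by rewrite rmorph0 w0.
by rewrite mevalXU vr mxvecE.
Qed.

Lemma flag_pull_destab m (P : {mpoly k[N]}) w : P \is m.-homog -> flag_pull P = 0 -> destab T w ->
  mmap iota (fun i => mxvec w 0 i) P = 0.
Proof.
move=> hP E [g Dg H]; rewrite -(act_inj w Dg).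
have [v] := flag_pull_eval (map_mpoly iota P) (invmx g) H.
by rewrite flag_pull_map E rmorph0 meval0 meval_map_mpoly => <-.
Qed.

(** The pullback is defined over [k], so by [relation_descent] evaluation at [f] kills its kernel
    over [K] as soon as it kills the kernel over [k]. The latter is generated by its homogeneous
    elements. *)
Lemma flag_pull_specialize f :
  (forall m (P : {mpoly k[N]}), P \is m.-homog -> flag_pull P = 0 ->
    mmap iota (fun i => mxvec f 0 i) P = 0) ->
  forall Q : {mpoly K[N]}, flag_pull Q = 0 -> Q.@[fun i => mxvec f 0 i] = 0.
Proof.
move=> H Q EQ; pose phi : {rmorphism {mpoly k[N]} -> K} := mmap iota (fun i => mxvec f 0 i).
have H1 (P : {mpoly k[N]}) : flag_pull P = 0 -> phi P = 0.
  move=> EP; rewrite (pihomog_partitionE (leqnn (msize P))) rmorph_sum big1 // => i _.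
  apply: (H i); first exact: pihomogP.
  by apply: (graded_components (psi := @flag_pull k) _ (@flag_pull_homog k)).
pose s := [seq (Q@_m, 'X_[m] : {mpoly k[N]}) | m <- msupp Q].
have Es : \sum_(c <- s) c.1 *: map_mpoly iota c.2 = Q.
  by rewrite big_map [RHS]mpolyE; apply: eq_bigr => m _; rewrite /= map_mpolyX.
have ev (P : {mpoly k[N]}) : (map_mpoly iota P).@[fun i => mxvec f 0 i] = phi P.
  exact: meval_map_mpoly.
rewrite -Es raddf_sum /=; under eq_bigr do rewrite mevalZ ev.
apply: (relation_descent (iota := iota) (sc := fun a y => a *: y) (E := @flag_pull k)) => //.
- by move=> x y a; rewrite -!mul_mpolyC rmorphB rmorphM /= /flag_pull mmapC.
- by move=> x y a; rewrite -!mul_mpolyC rmorphB rmorphM /= /phi mmapC.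
rewrite -[RHS]EQ -Es raddf_sum /=; apply: eq_bigr => c _.
by rewrite -flag_pull_map -!mul_mpolyC rmorphM /= /flag_pull mmapC.
Qed.

(** The locus is closed because the projective line is complete. If all its equations vanish at [f],
    the generic destabilized form specializes to [f] at a rational place. Some matrix [h] with
    regular entries makes [h *m g] lower triangular, so [h] carries the generic form into the flag,
    and the residue of [h] destabilizes [f]. *)
Lemma destab_equation f : ~ destab T f ->
  exists m (P : {mpoly k[N]}), [/\ P \is m.-homog, mmap iota (fun i => mxvec f 0 i) P != 0
    & forall w, destab T w -> mmap iota (fun i => mxvec w 0 i) P = 0].
Proof.
move=> Nf; apply: NNPP => NN; apply: Nf.
have /flag_pull_specialize H : forall m (P : {mpoly k[N]}), P \is m.-homog -> flag_pull P = 0 ->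
    mmap iota (fun i => mxvec f 0 i) P = 0.
  move=> m P hP E; apply/eqP/contraT => ne; case: NN; exists m, P; split=> // w.
  exact: (flag_pull_destab hP E).
pose F := {fraction {mpoly K[4 + N]}}.
pose kp : {rmorphism K -> F} := @tofrac {mpoly K[4 + N]} \o @mpolyC (4 + N) K.
pose psi : {rmorphism {mpoly K[N]} -> F} := @tofrac {mpoly K[4 + N]} \o @flag_pull K.
pose Q (P : {mpoly K[N]}) := P.@[fun i => mxvec f 0 i] = 0.
have [|||||p [rp sp ratp]] := @ideal_place K F kp {mpoly K[N]} psi (@mpolyC N K) Q.
- by move=> c; rewrite /= /flag_pull mmapC.
- exact: meval0.
- by move=> x y Qx Qy; rewrite /Q mevalD Qx Qy addr0.
- by move=> x y Qy; rewrite /Q mevalM Qy mulr0.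
- move=> P QP /eqP; rewrite -(rmorph1 psi) /= tofrac_eq => /eqP E.
  have /H : flag_pull (P - 1) = 0 by rewrite rmorphB /= E rmorph1 subrr.
  by rewrite mevalB QP meval1 sub0r => /eqP; rewrite oppr_eq0 oner_eq0.
have {}ratp : rational p.
  apply: ratp => P; exists (P.@[fun i => mxvec f 0 i]).
  by rewrite /Q mevalB mevalC subrr.
pose g := map_mx (@tofrac _) (gen_group K); pose l := map_mx (@tofrac _) (gen_flag K).
pose G := act g l.
have GE i j : G i j = psi 'X_(mxvec_index i j).
  by rewrite /G /g /l -map_act mxE /= /flag_pull mmapX mmap1U mxvecE.
have l0 (i : 'I_d.+1) (j : 'I_e.+1) : (i + j < T)%N -> l i j = 0.
  by move=> ij; rewrite !mxE ij tofrac0.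
have rG q i j : place_le p q -> [/\ reg q (G i j), reg q (map_mx kp f i j)
    & small q (G i j - map_mx kp f i j)].
  move=> [r1 s1]; have -> : map_mx kp f i j = kp (f i j) by rewrite mxE.
  rewrite GE; split; [exact/r1/rp|exact: reg_const|].
  have -> : kp (f i j) = psi (f i j)%:MP by rewrite /= /flag_pull mmapC.
  rewrite -rmorphB; apply/s1/sp.
  by rewrite /Q mevalB mevalXU mevalC mxvecE subrr.
have g11 : g 1 1 != 0.
  rewrite !mxE /= tofrac_eq0; apply/eqP => /(congr1 (mcoeff U_(lshift N o3))) /eqP.
  by rewrite mcoeffX eqxx mcoeff0 oner_eq0.
(* The generic [g] may have poles, but only a point of the projective line has to specialize: either
   this ratio or its inverse is regular, which leads to the shear or the Weyl matrix. *)
have [q [pq rq]] := place_ext p (- g 0 1 / g 1 1).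
have destab_of (h : 'M[F]_2) (h0 : 'M[K]_2) : \det h0 = 1 -> (h *m g) 0 1 = 0 ->
    (forall r s, [/\ reg q (h r s), reg q (map_mx kp h0 r s) & small q (h r s - map_mx kp h0 r s)]) ->
    destab T f.
  move=> Dh0 hg Hh; exists h0 => // i j ij; apply: (@small_const _ _ _ q).
  have -> : kp (act h0 f i j) = act (map_mx kp h0) (map_mx kp f) i j by rewrite -(map_act kp) [RHS]mxE.
  have aux (y z : F) : y = 0 -> small q (y - z) -> small q z.
    by move=> ->; rewrite sub0r => /smallN; rewrite opprK.
  apply: (aux (act h G i j)).
    have EM : act (h *m g) l = act h G := actM h g l.
    by rewrite -EM; exact: (act_lower hg l0 ij).
  by apply: small_act_sub => r s; [exact: Hh|exact: rG].
pose cg x y := [/\ reg q x, reg q y & small q (x - y)].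
have cst c x : kp c = x -> cg x (kp c).
  by move=> <-; split; rewrite ?subrr; [exact: reg_const|exact: reg_const|exact: small0].
have k0 := rmorph0 kp; have k1 := rmorph1 kp; have kN1 := rmorphN1 kp.
case=> [ru|[u0 su]].
  have [u0 su] := rq ratp _ ru.
  apply: (destab_of (mx2 1 (- g 0 1 / g 1 1) 0 1) (mx2 1 u0 0 1)).
  - by rewrite det_mx2 mulr1 mulr0 subr0.
  - exact: shear_mx2_eq0.
  - move=> r s; rewrite map_mx2; apply: (mx2_rel (P := cg)).
    + exact: cst.
    + by split=> //; apply: reg_const.
    + exact: cst.
    + exact: cst.
apply: (destab_of (mx2 (- g 0 1 / g 1 1)^-1 1 (-1) 0) (mx2 0 1 (-1) 0)).
- by rewrite det_mx2 mul0r sub0r mulrN1 opprK.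
- have g01 : g 0 1 != 0 by apply: contraNneq u0 => ->; rewrite oppr0 mul0r.
  exact: weyl_mx2_eq0.
- move=> r s; rewrite map_mx2; apply: (mx2_rel (P := cg)).
  + by rewrite k0; split; rewrite ?subr0 //; [apply: smallW|apply: reg0].
  + exact: cst.
  + exact: cst.
  + exact: cst.
Qed.

End DestabilizedLocus.

(** * An invariant vanishing on the destabilized locus *)

Section StableInvariant.
Variables (k : fieldType) (K : closedFieldType) (iota : {rmorphism k -> K}) (d e : nat).
Local Notation N := (d.+1 * e.+1)%N.
Implicit Types (f w : 'M[K]_(d.+1, e.+1)).

Lemma mpoly_unit_eval0 (q : {mpoly K[4]}) :
  (forall h : 'M[K]_2, \det h != 0 -> q.@[mx_entry h] = 0) -> q = 0.
Proof.
move=> H; suff /eqP : \det (gmx K) * q = 0.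
  by rewrite mulf_eq0 (negPf (gmx_det_neq0 K)) => /eqP.
apply: mpoly_eval0 => v; pose h : 'M[K]_2 := mx2 (v o0) (v o1) (v o2) (v o3).
have Ev : v =1 mx_entry h by move=> i; case: (ord4P i) => ->; rewrite /mx_entry !mxE.
rewrite (meval_eq _ Ev) mevalM -det_map_mx gmx_eval.
by have [->|/H ->] := eqVneq (\det h) 0; rewrite ?mul0r ?mulr0.
Qed.

Lemma gpull_destab T (P : {mpoly k[N]}) w :
  (forall u, destab T u -> mmap iota (fun i => mxvec u 0 i) P = 0) ->
  destab T w -> gpull iota P w = 0.
Proof.
move=> H Hw; apply: mpoly_unit_eval0 => h Dh.
by rewrite gpull_eval H //; apply: destab_unit.
Qed.

(** The locus is stable under invertible matrices, so every [gpull_coef] of its equation vanishes on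
    it, and so does the average of a multiple of such a coefficient. *)
Lemma stable_invariant (char0 : [pchar K] =i pred0) T f :
  (forall h, (h < T)%N -> (h.*2 < d + e)%N) -> ~ destab T f ->
  exists m (s : {mpoly k[N]}), [/\ (0 < m)%N, invariant_section m s,
    peval (map_mpoly iota s) (mxvec f) != 0
    & forall w, destab T w -> peval (map_mpoly iota s) (mxvec w) = 0].
Proof.
move=> HT Nf; have [mP [P [hP Pf HP]]] := destab_equation iota Nf.
have [mu [al Hs]] := stable_monomial char0 hP HT Nf Pf.
pose s := invariant_of ('X_[mu] * gpull_coef P al).
have es w : peval (map_mpoly iota s) (mxvec w) = omega (gpull iota ('X_[mu] * gpull_coef P al) w).
  by rewrite /peval invariant_of_eval mxvecK.
have Is : invariant_section (mdeg mu + mP) s.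
  by apply: invariant_of_invariant; apply: dhomogM; [rewrite dhomogX|apply: gpull_coef_homog].
have sf : peval (map_mpoly iota s) (mxvec f) != 0 by rewrite es.
have sw w : destab T w -> peval (map_mpoly iota s) (mxvec w) = 0.
  move=> Hw; rewrite es /gpull rmorphM /= -/(gpull iota (gpull_coef P al) w).
  rewrite (@gpull_destab T) ?mulr0 // => [|u Hu]; first by rewrite /omega raddf0.
  by rewrite mmap_gpull_coef (gpull_destab _ Hu) ?mcoeff0.
(* In degree 0 the section would be constant, but it vanishes at the zero form, which is
   destabilized. *)
exists (mdeg mu + mP)%N, s; split=> //; rewrite lt0n; apply/eqP => m0.
have := peval_scale 0 (mxvec f) (dhomog_map iota (proj1 Is)).
rewrite m0 expr0 mul1r -linearZ /= scale0r sw => [E|]; first by rewrite -E eqxx in sf.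
by exists 1%:M => [|i j _]; rewrite ?det1 // act1 mxE.
Qed.

End StableInvariant.

(** * Noetherian rings of polynomials *)

Definition ideal_pred (R : comNzRingType) (Q : R -> Prop) :=
  [/\ Q 0, forall x y, Q x -> Q y -> Q (x + y) & forall x y, Q y -> Q (x * y)].

(** Finite generation, with the ideal generated by [s] expressed through its universal property. *)
Definition noetherian (R : comNzRingType) := forall Q : R -> Prop, ideal_pred Q ->
  exists2 s : seq R, (forall x, x \in s -> Q x) &
    forall Q', ideal_pred Q' -> (forall x, x \in s -> Q' x) -> forall y, Q y -> Q' y.

Section Hilbert.
Variable R : comNzRingType.

(** Hilbert's basis theorem. [L Q n] is the ideal of degree [n] coefficients of elements of degree
    at most [n]; it grows with [n] and is constant from some [M] on. [T] collects elements realizing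
    generators of these ideals for [n <= M]. *)
Lemma noetherian_poly : noetherian R -> noetherian {poly R}.
Proof.
move=> NR Q [Q0 QD QM].
pose L (P : {poly R} -> Prop) n a := exists p : {poly R}, [/\ P p, (size p <= n.+1)%N & p`_n = a].
have idL P n : ideal_pred P -> ideal_pred (L P n).
  move=> [P0 PD PM]; split.
  - by exists 0; rewrite size_poly0 coef0.
  - move=> x y [p [Pp sp <-]] [q [Pq sq <-]]; exists (p + q); rewrite coefD; split=> //.
      exact: PD.
    by apply: leq_trans (size_polyD _ _) _; rewrite geq_max sp.
  - move=> x y [p [Pp sp <-]]; exists (x%:P * p); rewrite coefCM; split=> //; first exact: PM.
    by rewrite mul_polyC; apply: leq_trans (size_scale_leq _ _) _.
have LS n l a : L Q n a -> L Q (l + n)%N a.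
  move=> [p [Qp sp <-]]; exists ('X^l * p); split; first exact: QM.
    apply: leq_trans (size_polyMleq _ _) _; rewrite size_polyXn /= -addnS; exact: leq_add.
  by rewrite coefXnM ltnNge leq_addr addKn.
pose Li a := exists n, L Q n a.
have idLi : ideal_pred Li.
  split; first by exists 0%N; have [] := idL Q 0%N (And3 Q0 QD QM).
  - move=> x y [n Lx] [m Ly]; exists (n + m)%N.
    have [_ HD _] := idL Q (n + m)%N (And3 Q0 QD QM); apply: HD; last exact: LS.
    by rewrite addnC; apply: LS.
  - by move=> x y [n Ly]; exists n; have [_ _ HM] := idL Q n (And3 Q0 QD QM); apply: HM.
have [s Hs Gs] := NR _ idLi.
have [M HM] : exists M, forall x, x \in s -> L Q M x.
  elim: s {Gs} Hs => [|x s IH] Hs; first by exists 0%N.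
  have [|M HM] := IH; first by move=> y ys; apply: Hs; rewrite inE ys orbT.
  have [n Hn] := Hs x (mem_head _ _); exists (n + M)%N => y; rewrite inE => /orP [/eqP->|/HM].
    by rewrite addnC; apply: LS.
  exact: LS.
have LiM a : Li a -> L Q M a by apply: Gs => //; apply: idL.
have Gn n : exists2 t : seq {poly R}, (forall p, p \in t -> Q p /\ (size p <= n.+1)%N) &
    forall Q', ideal_pred Q' -> (forall p, p \in t -> Q' p`_n) -> forall a, L Q n a -> Q' a.
  have [u Hu Gu] := NR _ (idL Q n (And3 Q0 QD QM)).
  have [t Ht Et] : exists2 t : seq {poly R}, (forall p, p \in t -> Q p /\ (size p <= n.+1)%N) &
      u = [seq p`_n | p : {poly R} <- t].
    elim: u {Gu} Hu => [|x u IH] Hu; first by exists [::].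
    have [|t Ht ->] := IH; first by move=> y yu; apply: Hu; rewrite inE yu orbT.
    have [p [Qp sp <-]] := Hu x (mem_head _ _); exists (p :: t) => // q.
    by rewrite inE => /orP [/eqP->|/Ht].
  exists t => // Q' idQ' H a; apply: Gu => // x; rewrite Et => /mapP [p pt ->].
  exact: H.
have [T HT GT] : exists2 T : seq {poly R}, (forall p, p \in T -> Q p) &
    forall n, (n <= M)%N -> forall Q', ideal_pred Q' ->
      (forall p, p \in T -> (size p <= n.+1)%N -> Q' p`_n) -> forall a, L Q n a -> Q' a.
  elim: {LiM HM} M => [|M [T HT GT]].
    have [t Ht Gt] := Gn 0%N; exists t => [p /Ht []//|n]; rewrite leqn0 => /eqP-> Q' idQ' H.
    by apply: Gt => // p pt; apply: H => //; case: (Ht p pt).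
  have [t Ht Gt] := Gn M.+1; exists (t ++ T) => [p|n].
    by rewrite mem_cat => /orP [/Ht []|/HT].
  rewrite leq_eqVlt => /orP [/eqP->|nM] Q' idQ' H.
    apply: Gt => // p pt; apply: H; first by rewrite mem_cat pt.
    by case: (Ht p pt).
  by apply: GT => // p pT; apply: H; rewrite mem_cat pT orbT.
exists T => // Q' idQ' HQ' y; have [Q'0 Q'D Q'M] := idQ'.
have [r] := ubnP (size y); elim: r y => // r IH y; rewrite ltnS leq_eqVlt => /orP [/eqP sy Qy|]; last exact: IH.
case: r IH sy => [|r] IH sy.
  by have /eqP-> : y == 0 by rewrite -size_poly_eq0 sy.
(* The leading coefficient of [y] occurs already in degree at most [M], for an element lying in both
   [Q] and [Q']; subtracting its shift lowers the degree. *)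
pose n := minn r M.
have Ln : L Q n y`_r.
  have Lr : L Q r y`_r by exists y; rewrite sy.
  by rewrite /n; case: leqP => _ //; apply: LiM; exists r.
pose QQ p := Q p /\ Q' p.
have idQQ : ideal_pred QQ.
  split; first by [].
    by move=> p q [Qp Q'p] [Qq Q'q]; split; [apply: QD|apply: Q'D].
  by move=> p q [Qq Q'q]; split; [apply: QM|apply: Q'M].
have [q [[Qq Q'q] sq Eq]] : L QQ n y`_r.
  apply: (GT n (geq_minr _ _) (L QQ n)) => //; first exact: idL.
  by move=> p pT sp; exists p; split=> //; split; [apply: HT|apply: HQ'].
have rn : r = ((r - n) + n)%N by rewrite subnK // geq_minl.
rewrite -[y](subrK ('X^(r - n) * q)); apply: Q'D; last exact: Q'M.
apply: IH; last by apply: QD => //; rewrite -mulNr; apply: QM.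
rewrite ltnS; apply/leq_sizeP => j; rewrite leq_eqVlt => /orP [/eqP<-|rj].
  by rewrite coefB coefXnM ltnNge leq_subr /= {2}rn addKn Eq subrr.
rewrite coefB nth_default ?sy // coefXnM; case: ltnP => [_|le]; first by rewrite subr0.
rewrite nth_default ?subr0 //; apply: leq_trans sq _; lia.
Qed.

Lemma noetherian_surj (A : comNzRingType) (phi : {rmorphism R -> A}) (psi : A -> R) :
  cancel psi phi -> noetherian R -> noetherian A.
Proof.
move=> K NR Q [Q0 QD QM].
have pre (P : A -> Prop) : ideal_pred P -> ideal_pred (P \o phi).
  move=> [P0 PD PM]; split=> [|x y Px Py|x y Py] /=; first by rewrite rmorph0.
    by rewrite rmorphD; apply: PD.
  by rewrite rmorphM; apply: PM.
have [s Hs Gs] := NR _ (pre _ (And3 Q0 QD QM)).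
exists (map phi s) => [x /mapP [y ys ->]|Q' idQ' H y Qy]; first exact: (Hs y ys).
rewrite -(K y); apply: (Gs (Q' \o phi)) => [|x xs|] /=; first exact: pre.
  by apply: H; apply: map_f.
by rewrite K.
Qed.

End Hilbert.

Lemma noetherian_field (F : fieldType) : noetherian F.
Proof.
move=> Q [Q0 QD QM]; case: (classic (exists2 x, Q x & x != 0)) => [[x Qx x0]|N].
  exists [:: 1] => [y|Q' [_ _ QM'] H y _].
    by rewrite inE => /eqP->; rewrite -(mulVf x0); apply: QM.
  by rewrite -[y]mulr1; apply: QM'; apply: H; rewrite mem_head.
exists [::] => // Q' [Q'0 _ _] _ y Qy; suff -> : y = 0 by [].
by apply/eqP/contraT => y0; case: N; exists y.
Qed.

Lemma noetherian_mpoly (F : fieldType) n : noetherian {mpoly F[n]}.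
Proof.
elim: n => [|n IH].
  apply: (noetherian_surj (phi := @mpolyC 0 F) (psi := fun p => p@_0%MM)); last exact: noetherian_field.
  move=> p; apply/mpolyP => m; rewrite mcoeffC (_ : m = 0%MM); first by rewrite eqxx mulr1.
  by apply/mnmP; case.
exact: noetherian_surj (@muniK F n) (noetherian_poly IH).
Qed.

(** * Homogeneous equations of cones *)

Section ConeEquations.
Variables (K : closedFieldType) (n : nat) (Z : 'rV[K]_n -> Prop).
Hypothesis coneZ : forall c v, c != 0 -> Z v -> Z (c *: v).

Lemma cone_component (P : {mpoly K[n]}) i :
  (forall v, Z v -> peval P v = 0) -> forall v, Z v -> peval (pihomog mdeg i P) v = 0.
Proof.
move=> HP v Zv; pose r := maxn (msize P) i.+1.
have ir : (i < r)%N by rewrite leq_max leqnn orbT.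
have Pr : (msize P <= r)%N by rewrite leq_max leqnn.
pose q : {poly K} := \poly_(j < r) peval (pihomog mdeg j P) v.
have q0 : 'X * q = 0.
  apply: closed_poly0 => c; rewrite hornerM hornerX.
  have [->|c0] := eqVneq c 0; first by rewrite mul0r.
  rewrite horner_poly; have := HP _ (coneZ c0 Zv).
  rewrite {1}(pihomog_partitionE Pr) /peval raddf_sum /= => E.
  rewrite -[X in _ = X](mulr0 c) -[X in _ = _ * X]E; congr (_ * _); apply: eq_bigr => j _.
  by rewrite -/(peval _ (c *: v)) (peval_scale _ _ (pihomogP _ _ _)) mulrC.
move/eqP: q0; rewrite mulf_eq0 polyX_eq0 /= => /eqP q0.
by have := congr1 (coefp i) q0; rewrite /= coef_poly ir coef0.
Qed.

(** [closed_in] asks for finitely many homogeneous equations. The ideal of [Z] is finitely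
    generated, and on a cone the homogeneous components of its generators vanish as well. *)
Lemma cone_equations : exists T : seq {mpoly K[n]},
  [/\ all_homog T, forall h v, h \in T -> Z v -> peval h v = 0
    & forall w, (forall h, h \in T -> peval h w = 0) ->
      forall P : {mpoly K[n]}, (forall v, Z v -> peval P v = 0) -> peval P w = 0].
Proof.
have idQ (Y : 'rV[K]_n -> Prop) : ideal_pred (fun P : {mpoly K[n]} => forall v, Y v -> peval P v = 0).
  split=> [v _|x y Hx Hy v Yv|x y Hy v Yv]; first exact: meval0.
    by rewrite /peval mevalD -!/(peval _ _) Hx // Hy // addr0.
  by rewrite pevalM Hy // mulr0.
have [s Hs Gs] := noetherian_mpoly (idQ Z).
exists (flatten [seq [seq pihomog mdeg i p | i <- iota 0 (msize p)] | p : {mpoly K[n]} <- s]); split.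
- by move=> h /flatten_mapP [p _ /mapP [i _ ->]]; exists i; apply: pihomogP.
- move=> h v /flatten_mapP [p ps /mapP [i _ ->]] Zv.
  by apply: cone_component Zv => u; apply: (Hs p).
move=> w Hw P HP; apply: (Gs _ (idQ (eq w)) _ P HP w erefl) => p ps v <-.
rewrite (pihomog_partitionE (leqnn (msize p))) /peval raddf_sum /= big1 // => i _.
apply: Hw; apply/flatten_mapP; exists p => //; apply/mapP; exists (i : nat) => //.
by rewrite mem_iota add0n; exact: (ltn_ord i).
Qed.

End ConeEquations.

(** * Closed orbits *)

Section ClosedOrbits.
Variables (k : fieldType) (K : closedFieldType) (iota : {rmorphism k -> K}) (d e : nat).
Local Notation N := (d.+1 * e.+1)%N.
Local Notation F := {fraction {mpoly K[4]}}.
Implicit Types (v w : 'M[K]_(d.+1, e.+1)).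

Lemma scale_to_sl2 (g : 'M[K]_2) : \det g != 0 ->
  exists c (h : 'M[K]_2), [/\ c != 0, \det h = 1, c ^+ 2 = \det g & g = c *: h].
Proof.
move=> Dg; have [c Ec] := closed_root_exists (\det g) (isT : (0 < 2)%N).
have c0 : c != 0 by apply: contraNneq Dg => c0; rewrite -Ec c0 expr0n.
exists c, (c^-1 *: g); split=> //; last by rewrite scalerA divff // scale1r.
by rewrite detZ -Ec -exprMn mulVf ?expr1n.
Qed.

Variables (m : nat) (s : {mpoly k[N]}).
Hypotheses (Is : invariant_section m s) (m0 : (0 < m)%N).
Let S := map_mpoly iota s.

(** An invariant is scaled on invertible matrices by the power [m (d + e) / 2] of the determinant;
    squaring keeps the exponent integral. *)
Lemma gpull_invariant v :
  gpull_at v S ^+ 2 = \det (gmx K) ^+ (m * (d + e)) * (peval S (mxvec v) ^+ 2)%:MP.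
Proof.
apply/eqP; rewrite -subr_eq0; apply/eqP; apply: mpoly_unit_eval0 => h Dh.
have mX (q : {mpoly K[4]}) n : (q ^+ n).@[mx_entry h] = q.@[mx_entry h] ^+ n.
  exact: (rmorphXn (meval (mx_entry h))).
rewrite mevalB mX mevalM mX mevalC -det_map_mx gmx_eval gpull_eval.
have [c [g [c0 Dg Ec Eh]]] := scale_to_sl2 Dh.
have -> : mmap idfun (fun i : 'I_N => mxvec (act h v) 0 i) S = c ^+ (m * (d + e)) * peval S (mxvec v).
  rewrite -(invariant_peval iota v Is Dg) [(m * (d + e))%N]mulnC exprM -peval_scale; last exact: dhomog_map (proj1 Is).
  by rewrite -linearZ /= -act_scalar -Eh.
by rewrite -Ec exprMn -!exprM [(m * _ * 2)%N]mulnC mulrC subrr.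
Qed.

Lemma orbit_cone v c (w : 'rV[K]_N) : c != 0 -> sl2_orbit (mxvec v) w -> sl2_orbit (mxvec v) (c *: w).
Proof.
move=> c0 [g Dg [b b0 ->]]; exists g => //; exists (c * b); first by rewrite mulf_neq0.
by rewrite scalerA.
Qed.

Lemma gpull_at_orbit v (P : {mpoly K[N]}) : (0 < d + e)%N -> gpull_at v P = 0 ->
  forall w : 'rV[K]_N, sl2_orbit (mxvec v) w -> peval P w = 0.
Proof.
move=> de E w [g Dg [b b0 ->]]; have [c Ec] := closed_root_exists b de.
rewrite sl2_act_coordE mxvecK -linearZ /= -Ec -act_scalar.
have := congr1 (meval (mx_entry (c *: g))) E.
by rewrite meval0 gpull_eval.
Qed.

(** Since the equations of the orbit of [v] vanish at [w], the assignment [P(g v) |-> P(w)] is a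
    rational place. After extension the generic matrix is regular there, its residue carries [v] to
    [w], and it is invertible because the inverse determinant is regular too. *)
Lemma orbit_of_equations T v w : (forall h, (h < T)%N -> (h.*2 < d + e)%N) -> ~ destab T v ->
  peval S (mxvec v) != 0 -> peval S (mxvec w) != 0 ->
  (forall P : {mpoly K[N]}, (forall u, sl2_orbit (mxvec v) u -> peval P u = 0) ->
     peval P (mxvec w) = 0) ->
  sl2_orbit (mxvec v) (mxvec w).
Proof.
move=> HT Nv Sv Sw HP.
have de : (0 < d + e)%N.
  rewrite lt0n; apply/eqP => de0; case: Nv; exists 1%:M; first exact: det1.
  by move=> i j /HT; rewrite de0.
pose psi : {rmorphism {mpoly K[N]} -> F} := @tofrac {mpoly K[4]} \o gpull_at v.
pose Q (P : {mpoly K[N]}) := peval P (mxvec w) = 0.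
have [|||||p [rp sp ratp]] := @ideal_place K F (kap K) {mpoly K[N]} psi (@mpolyC N K) Q.
- by move=> c; rewrite /= gpull_atC.
- exact: meval0.
- by move=> x y Qx Qy; rewrite /Q /peval mevalD -!/(peval _ _) Qx Qy addr0.
- by move=> x y Qy; rewrite /Q pevalM Qy mulr0.
- move=> P QP /eqP; rewrite -(rmorph1 psi) /= tofrac_eq => /eqP E.
  have /(gpull_at_orbit de)/HP : gpull_at v (P - 1) = 0 by rewrite rmorphB /= E rmorph1 subrr.
  rewrite /peval mevalB -/(peval P _) QP meval1 sub0r => /eqP; rewrite oppr_eq0; exact/negP/oner_neq0.
have {}ratp : rational p.
  apply: ratp => P; exists (peval P (mxvec w)).
  by rewrite /Q /peval mevalB mevalC subrr.
have cong q P : place_le p q -> small q (psi P - kap K (peval P (mxvec w))).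
  move=> pq; have -> : kap K (peval P (mxvec w)) = psi (peval P (mxvec w))%:MP by rewrite /= gpull_atC.
  by rewrite -rmorphB; apply/(proj2 pq)/sp; rewrite /Q /peval mevalB mevalC subrr.
have [q [pq rq HD]] := place_ext p (gen_det K)^-1.
have rD : reg q (gen_det K)^-1.
  (* A small determinant would make the square of [S(g v)] small by [gpull_invariant], although its
     residue is the square of the nonzero [S(w)]. *)
  case: HD => // -[_]; rewrite invrK => sD; case/eqP: Sw.
  apply/eqP; rewrite -sqrf_eq0; apply/eqP; apply: (@small_const _ _ _ q).
  have -> : kap K (peval S (mxvec w) ^+ 2) =
    psi (S ^+ 2) - (psi (S ^+ 2) - kap K (peval (S ^+ 2) (mxvec w))).
    by rewrite subKr; apply: (congr1 (kap K)); rewrite /peval (rmorphXn (meval _)).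
  apply: smallB; last exact: cong.
  rewrite /= rmorphXn gpull_invariant rmorphM rmorphXn; apply: smallMr; last exact: (reg_const q).
  by apply: smallX => //; rewrite muln_gt0 m0.
have rG i j q' : place_le p q' -> [/\ reg q' (act (gen_elt K) (map_mx (kap K) v) i j),
     reg q' (map_mx (kap K) w i j) &
     small q' (act (gen_elt K) (map_mx (kap K) v) i j - map_mx (kap K) w i j)].
  move=> pq'; have -> : map_mx (kap K) w i j = kap K (peval 'X_(mxvec_index i j) (mxvec w)).
    by rewrite mxE /peval mevalXU mxvecE.
  rewrite -gen_orbitE -gpull_atX; split; [exact/(proj1 pq')/rp|exact: reg_const|exact: cong].
have [|q' [qq' rq' rg]] := gen_pivot rD Nv.
  by left; split=> // i j; case: (rG i j q pq).
have [g Hg] : exists g : 'M[K]_2, forall i j, small q' (gen_elt K i j - kap K (g i j)).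
  have rat' := rq' (rq ratp).
  have [a Ha] := rat' _ (rg 0 0); have [b Hb] := rat' _ (rg 0 1).
  have [c Hc] := rat' _ (rg 1 0); have [f Hf] := rat' _ (rg 1 1).
  exists (mx2 a b c f) => i j; rewrite [mx2 a b c f i j]mxE.
  by case: (ord2P i) => ->; case: (ord2P j) => ->.
have pq' := place_le_trans pq qq'.
have Ew : w = act g v.
  apply/matrixP => i j; apply/eqP; rewrite -subr_eq0; apply/eqP; apply: (@small_const _ _ _ q').
  have [_ _ s1] := rG i j q' pq'.
  have s2 : small q' (act (gen_elt K) (map_mx (kap K) v) i j - act (map_mx (kap K) g) (map_mx (kap K) v) i j).
    apply: small_act_sub => r t.
      by split; [exact: rg|rewrite mxE; exact: reg_const|rewrite [map_mx _ g r t]mxE; exact: Hg].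
    by rewrite subrr; split; [rewrite mxE; exact: reg_const|rewrite mxE; exact: reg_const|exact: small0].
  have sub4 (x y z : F) : z - y = (x - y) - (x - z) by ring.
  rewrite rmorphB; have E1 : kap K (act g v i j) = act (map_mx (kap K) g) (map_mx (kap K) v) i j.
    by rewrite -(map_act (kap K)) [RHS]mxE.
  have E2 : kap K (w i j) = map_mx (kap K) w i j by rewrite [RHS]mxE.
  rewrite E1 E2 (sub4 (act (gen_elt K) (map_mx (kap K) v) i j)); exact: smallB.
have Dg : \det g != 0.
  apply/eqP => D0; apply: (@small1 _ _ _ q').
  rewrite -(mulVf (gen_det_neq0 K)); apply: smallM; first exact: (proj1 qq').
  have -> : gen_det K = \det (gen_elt K) - \det (map_mx (kap K) g).
    by rewrite (det_map_mx (kap K)) D0 rmorph0 subr0 gen_detE.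
  have congM (x y x' y' : F) : reg q' x -> reg q' y' -> small q' (x - x') -> small q' (y - y') ->
      small q' (x * y - x' * y').
    move=> rx ry sx sy; have -> : x * y - x' * y' = x * (y - y') + (x - x') * y' by ring.
    by apply: smallD; [apply: smallM|apply: smallMr].
  have reorder (x y x' y' : F) : x - y - (x' - y') = (x - x') - (y - y') by ring.
  rewrite !det2E reorder.
  have Hk i j : small q' (gen_elt K i j - map_mx (kap K) g i j) by rewrite [map_mx _ g i j]mxE.
  have rk i j : reg q' (map_mx (kap K) g i j) by rewrite mxE; apply: reg_const.
  by apply: smallB; apply: congM.
have [c [h [c0 Dh _ Eg]]] := scale_to_sl2 Dg.
exists h => //; exists (c ^+ (d + e)); first by rewrite expf_neq0.
by rewrite sl2_act_coordE mxvecK Ew Eg act_scalar linearZ.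
Qed.

End ClosedOrbits.

(** * Finite stabilizers *)

Lemma finite_roots (K : closedFieldType) (p : {poly K}) : p != 0 ->
  exists L : seq K, forall x, p.[x] = 0 -> x \in L.
Proof.
move=> p0; have [r Ep] := closed_field_poly_normal p; exists r => x.
rewrite Ep hornerZ => /eqP; rewrite mulf_eq0 lead_coef_eq0 (negPf p0) /= => px.
by rewrite -root_prod_XsubC /root.
Qed.

Section FiniteStabilizer.
Variables (K : closedFieldType) (d e : nat).
Local Notation F := {fraction {mpoly K[4]}}.
Implicit Types (f : 'M[K]_(d.+1, e.+1)).

Section Entry.
Variables (f : 'M[K]_(d.+1, e.+1)) (c : K).

(* The entries of the generic matrix are integral over the functions which are constant on the
   matrices mapping f to c f: a place at which an entry has a pole would contradict gen_pivot. *)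
Definition stab_value (a : {mpoly K[4]}) (z : K) :=
  forall g : 'M[K]_2, \det g = 1 -> act g f = c *: f -> a.@[mx_entry g] = z.

Definition stab_reg (x : F) :=
  exists a n z, stab_value a z /\ x * gen_det K ^+ n = tofrac a.

Lemma stab_value_detX n : stab_value (\det (gmx K) ^+ n) 1.
Proof.
move=> g Dg _; rewrite (rmorphXn (meval _)) /= -det_map_mx gmx_eval Dg expr1n //.
Qed.

Lemma stab_valueM a b y z : stab_value a y -> stab_value b z -> stab_value (a * b) (y * z).
Proof. by move=> Ha Hb g Dg Eg; rewrite mevalM Ha ?Hb. Qed.

Lemma stab_valueD a b y z : stab_value a y -> stab_value b z -> stab_value (a + b) (y + z).
Proof. by move=> Ha Hb g Dg Eg; rewrite mevalD Ha ?Hb. Qed.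

(** The ideal is zero, so a relation with a small constant term is one without constant term. *)
Lemma stab_place :
  exists p : place (kap K), [/\ forall i j, reg p (act (gen_elt K) (map_mx (kap K) f) i j),
    reg p (gen_det K)^-1, forall x, reg p x -> stab_reg x & forall x, small p x -> x = 0].
Proof.
have rc z : stab_reg (kap K z).
  by exists z%:MP, 0%N, z; split; [move=> g _ _; rewrite mevalC|rewrite mulr1].
have rD x y : stab_reg x -> stab_reg y -> stab_reg (x + y).
  move=> [a [n [z [Hz Ex]]]] [b [l [t [Ht Ey]]]].
  exists (a * \det (gmx K) ^+ l + b * \det (gmx K) ^+ n), (n + l)%N, (z * 1 + t * 1); split.
    by apply: stab_valueD; apply: stab_valueM => //; apply: stab_value_detX.
  by rewrite rmorphD !rmorphM /= -!gen_detX -Ex -Ey exprD; ring.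
have rM x y : stab_reg x -> stab_reg y -> stab_reg (x * y).
  move=> [a [n [z [Hz Ex]]]] [b [l [t [Ht Ey]]]].
  exists (a * b), (n + l)%N, (z * t); split; first exact: stab_valueM.
  by rewrite rmorphM /= -Ex -Ey exprD; ring.
have s0W x : x = 0 -> stab_reg x by move=> ->; rewrite -(rmorph0 (kap K)).
have sD (x y : F) : x = 0 -> y = 0 -> x + y = 0 by move=> -> ->; rewrite addr0.
have sM (x y : F) : stab_reg x -> y = 0 -> x * y = 0 by move=> _ ->; rewrite mulr0.
have s1 : (1 : F) <> 0 by apply/eqP; apply: oner_neq0.
exists (Place rc rD rM erefl s0W sD sM s1); split=> //= [i j|].
  rewrite -gen_orbitE; exists (gen_orbit f i j), 0%N, (c * f i j); split; last by rewrite mulr1.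
  move=> g Dg Eg; have -> : c * f i j = act g f i j by rewrite Eg mxE.
  have -> : gen_orbit f i j = gpull_at f 'X_(mxvec_index i j) by rewrite gpull_atX.
  by rewrite gpull_eval mmapX mmap1U mxvecE.
exists 1, 1%N, 1; split; first by move=> g _ _; rewrite meval1.
by rewrite expr1 mulVf ?rmorph1 ?gen_det_neq0.
Qed.

Lemma stab_entry T r t : (forall h, (h < T)%N -> (h.*2 < d + e)%N) -> ~ destab T f ->
  exists L : seq K, forall g : 'M[K]_2, \det g = 1 -> act g f = c *: f -> g r t \in L.
Proof.
move=> HT Nf; have [p [rG rD regp smallp]] := stab_place.
set y := gen_elt K r t.
have y0 : y != 0.
  rewrite /y [_ r t]mxE tofrac_eq0; apply: contraNneq (oner_neq0 K) => E.
  have := congr1 (meval (mx_entry (const_mx 1 : 'M[K]_2))) E.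
  rewrite meval0 => E0.
  by have := gmx_eval (const_mx 1 : 'M[K]_2) => /matrixP /(_ r t); rewrite [LHS]mxE E0 mxE => ->.
(* If [y^-1] could be made small, [gen_pivot] would make [y] regular and [1 = y * y^-1] small. Hence
   [1 = P(1/y)] with [P] without constant term: an equation of integral dependence for [y]. *)
have [P [sP0 rP EP]] : ev_mixed p y^-1 1.
  apply: NNPP => N1; pose q := adjoin_small N1.
  have pq : place_le p q by apply: adjoin_small_le.
  have [|q' [qq' _ rg]] := gen_pivot (proj1 pq _ rD) Nf.
    by left; split=> // i j; apply: (proj1 pq).
  apply: (@small1 _ _ _ q'); rewrite -(mulfV y0); apply: smallM; first exact: rg.
  by apply: (proj2 qq'); apply: adjoin_small_gen.
have {}sP0 := smallp _ sP0.
have [D HD] : exists D : 'I_(size P) -> {mpoly K[4]} * nat * K,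
    forall i, stab_value (D i).1.1 (D i).2 /\ P`_i * gen_det K ^+ (D i).1.2 = tofrac (D i).1.1.
  have H i : exists D : {mpoly K[4]} * nat * K,
      stab_value D.1.1 D.2 /\ P`_i * gen_det K ^+ D.1.2 = tofrac D.1.1.
    by have [a [n [z [Ha Ea]]]] := regp _ (rP i); exists (a, n, z).
  exact: (fin_all_exists (fun i : 'I_(size P) => H i)).
set R := size P in D HD; pose n0 := (\sum_i (D i).1.2)%N.
have nD i : ((D i).1.2 <= n0)%N by rewrite /n0 (bigD1 i) //= leq_addr.
pose V := \sum_(i < R | (0 < i)%N) (D i).1.1 * \det (gmx K) ^+ (n0 - (D i).1.2) * gmx K r t ^+ (R - i).
have aux (E : fieldType) (u v w x z : E) : u != 0 ->
    w * x * (v * u) * (z * u^-1) = z * x * w * v.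
  by move=> u0; field.
have EV : \det (gmx K) ^+ n0 * gmx K r t ^+ R = V.
  apply/eqP; rewrite -tofrac_eq; apply/eqP.
  rewrite rmorphM !rmorphXn /= -/(gen_det K) /V rmorph_sum /=.
  have -> : tofrac (gmx K r t) = y by rewrite /y [RHS]mxE.
  rewrite -[LHS]mulr1 -EP horner_coef mulr_sumr [RHS]big_mkcond; apply: eq_bigr => i _ /=.
  case: ltnP => [i0|]; last first.
    by rewrite leqn0 => /eqP i0; rewrite i0 sP0 mul0r mulr0.
  rewrite !rmorphM !rmorphXn /= -(proj2 (HD i)) -/(gen_det K).
  have -> : tofrac (gmx K r t) = y by rewrite /y [RHS]mxE.
  have ER : y ^+ R = y ^+ (R - i) * y ^+ i by rewrite -exprD subnK // ltnW // ltn_ord.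
  have En : gen_det K ^+ n0 = gen_det K ^+ (n0 - (D i).1.2) * gen_det K ^+ (D i).1.2.
    by rewrite -exprD subnK.
  rewrite ER En exprVn.
  have yi : y ^+ i != 0 by rewrite expf_neq0.
  by apply: (aux F).
(* At a matrix of determinant 1 mapping [f] to [c *: f], the coefficients of the relation take the
   constant values [(D i).2], so the entry is a root of this monic polynomial. *)
pose B : {poly K} := 'X^R - \sum_(i < R | (0 < i)%N) (D i).2 *: 'X^(R - i).
have B0 : B != 0.
  apply: contraTneq (oner_neq0 K) => B0; have := congr1 (coefp R) B0.
  rewrite /= coef0 coefB coefXn eqxx coef_sum big1 ?subr0 => [/eqP E|i i0]; first by rewrite negbK.
  by rewrite coefZ coefXn eqn_leq leq_subr andbT leqNgt ltn_subrL i0 (leq_ltn_trans _ (ltn_ord i)) // mulr0.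
have [L HL] := finite_roots B0; exists L => g Dg Eg; apply: HL.
have := congr1 (meval (mx_entry g)) EV.
have gE : (gmx K r t).@[mx_entry g] = g r t.
  by rewrite -[in RHS](gmx_eval g) [RHS]mxE.
have mX (q : {mpoly K[4]}) n : (q ^+ n).@[mx_entry g] = q.@[mx_entry g] ^+ n.
  exact: (rmorphXn (meval (mx_entry g))).
have dX n := stab_value_detX n Dg Eg.
rewrite mevalM dX mul1r mX gE /V raddf_sum /= => E.
rewrite /B hornerD hornerN hornerXn E horner_sum; apply/eqP; rewrite subr_eq0; apply/eqP.
apply: eq_bigr => i _; rewrite !mevalM dX mulr1 mX gE hornerZ hornerXn.
by rewrite (proj1 (HD i) g Dg Eg).
Qed.

End Entry.

(** A stabilizing matrix maps [f] to [c *: f], and invariance of [S] forces [c ^+ m = 1]. For each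
    of these finitely many [c], every entry lies in a finite list. *)
Lemma finite_stabilizer_of T f (S : {mpoly K[d.+1 * e.+1]}) m :
  S \is m.-homog -> (0 < m)%N -> peval S (mxvec f) != 0 ->
  (forall g, \det g = 1 -> peval S (mxvec (act g f)) = peval S (mxvec f)) ->
  (forall h, (h < T)%N -> (h.*2 < d + e)%N) -> ~ destab T f -> finite_stabilizer f.
Proof.
move=> hS m0 Sf inv HT Nf.
have [C HC] : exists C : seq K, forall c, c ^+ m = 1 -> c \in C.
  have [|C HC] := @finite_roots K ('X^m - 1%:P); first by rewrite -size_poly_eq0 size_XnsubC.
  by exists C => c cm; apply: HC; rewrite !hornerE cm subrr.
have [L HL] : exists L : seq K, forall c g r t, c \in C -> \det g = 1 -> act g f = c *: f -> g r t \in L.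
  elim: {HC} C => [|c C [L HL]]; first by exists [::].
  have [L00 H00] := stab_entry c 0 0 HT Nf; have [L01 H01] := stab_entry c 0 1 HT Nf.
  have [L10 H10] := stab_entry c 1 0 HT Nf; have [L11 H11] := stab_entry c 1 1 HT Nf.
  exists (L00 ++ L01 ++ L10 ++ L11 ++ L) => c' g r t; rewrite inE !mem_cat => /orP [/eqP->|cC] Dg Eg.
    by case: (ord2P r) => ->; case: (ord2P t) => ->;
      rewrite ?(H00 _ Dg Eg) ?(H01 _ Dg Eg) ?(H10 _ Dg Eg) ?(H11 _ Dg Eg) ?orbT.
  by rewrite (HL c') ?orbT.
pose LL := [seq (a, b) | a <- L, b <- L].
exists [seq mx2 x.1 x.2 y.1 y.2 | x <- LL, y <- LL] => g Dg [c c0].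
rewrite sl2_act_coordE mxvecK -linearZ /= => /(can_inj mxvecK) Eg.
have cm : c ^+ m = 1.
  apply: (mulIf Sf); rewrite mul1r -(peval_scale _ _ hS) -[RHS](inv g Dg) Eg linearZ //.
rewrite [g]mx2_eta; have Hg r t := HL c g r t (HC c cm) Dg Eg.
have HLL r : (g r 0, g r 1) \in LL by apply/allpairsP; exists (g r 0, g r 1); split=> /=; rewrite ?Hg.
by apply/allpairsP; exists ((g 0 0, g 0 1), (g 1 0, g 1 1)); split=> //=; apply: HLL.
Qed.

End FiniteStabilizer.

(** * The numerical criterion *)

Section Criterion.
Variables (k : fieldType) (K : closedFieldType) (iota : {rmorphism k -> K}) (d e : nat).
Hypothesis char0 : [pchar K] =i pred0.
Local Notation N := (d.+1 * e.+1)%N.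
Implicit Types (f : 'M[K]_(d.+1, e.+1)).

Lemma semistable_of_invariant m (s : {mpoly k[N]}) f : f != 0 -> (0 < m)%N ->
  invariant_section m s -> peval (map_mpoly iota s) (mxvec f) != 0 -> semistable iota f.
Proof.
move=> f0 m0 Is sf; exists m, s; split=> //.
  by split=> //; rewrite -(linear0 mxvec) (inj_eq (can_inj mxvecK)).
by apply: affine_principal_open m0; apply: dhomog_map; case: Is.
Qed.

Lemma not_destab_semistable f : f != 0 -> ~ destab (d + e)./2.+1 f -> semistable iota f.
Proof.
move=> f0 Nf; have [mu mu0 Hmu] := semistable_monomial char0 f0 Nf.
apply: (@semistable_of_invariant (mdeg mu) (invariant_of 'X_[mu])) => //.
- by rewrite lt0n mdeg_eq0.
- by apply: invariant_of_invariant; rewrite dhomogX.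
rewrite /peval invariant_of_eval mxvecK; move: Hmu.
by rewrite /gpull !mmapX.
Qed.

(** The neighborhood is the nonvanishing locus of an invariant that vanishes on the whole
    destabilized locus. So none of its points is destabilized, and the closed orbit argument applies
    to each of them, not only to [f]. *)
Lemma not_destab_stable f : f != 0 -> ~ destab (uphalf (d + e)) f -> stable iota f.
Proof.
move=> f0 Nf; set T := uphalf (d + e) in Nf.
have HT h : (h < T)%N -> (h.*2 < d + e)%N by rewrite /T; lia.
have [m [s [m0 Is sf sZ]]] := stable_invariant iota char0 HT Nf.
have hS := dhomog_map iota (proj1 Is).
split; first exact: (semistable_of_invariant f0 m0 Is sf).
split.
  apply: (finite_stabilizer_of hS m0 sf _ HT Nf) => g Dg.
  exact: (invariant_peval iota f Is Dg).
pose U := nonvanishing_locus iota s.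
have U_of w : peval (map_mpoly iota s) w != 0 -> U w.
  by move=> sw; split=> //; apply: contraNneq sw => ->; rewrite (peval_homog0 hS m0).
exists U; split=> //.
- exists [:: s] => [t|v]; first by rewrite inE => /eqP->; exists m; case: Is.
  by split=> [Uv|[t]]; [exists s; rewrite ?mem_head|rewrite inE => /eqP->].
- exact: affine_principal_open hS m0.
- move=> g v Dg [_ sv]; apply: U_of.
  by rewrite sl2_act_coordE (invariant_peval iota _ Is Dg) vec_mxK.
- move=> v [_ sv]; rewrite -[v]vec_mxK in sv *; set u := vec_mx v in sv *.
  have Nu : ~ destab T u by move=> /sZ su; rewrite su eqxx in sv.
  have [T' [T'h T'0 T'w]] := cone_equations (@orbit_cone _ _ _ u).
  exists T' => // w; split=> [Ow|[[_ sw] Hw]].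
    split=> [|h hT]; last exact: T'0.
    apply: U_of; case: Ow => g Dg [c c0 ->].
    rewrite (peval_scale _ _ hS) sl2_act_coordE mxvecK (invariant_peval iota _ Is Dg).
    by rewrite mulf_neq0 // expf_neq0.
  rewrite -[w]vec_mxK in sw Hw *.
  apply: (orbit_of_equations Is m0 HT Nu sv sw) => P HP; exact: T'w.
- exact: U_of.
Qed.

Lemma stable_iff f : f != 0 -> (stable iota f <-> ~ destab (uphalf (d + e)) f).
Proof. by move=> f0; split; [apply: stable_not_destab|apply: not_destab_stable]. Qed.

Lemma semistable_iff f : f != 0 -> (semistable iota f <-> ~ destab (d + e)./2.+1 f).
Proof. by move=> f0; split; [apply: semistable_not_destab|apply: not_destab_semistable]. Qed.

End Criterion.

Lemma half_le (n m : nat) : ((n%:R / 2 : rat) <= m%:R)%R = (uphalf n <= m)%N.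
Proof.
rewrite Num.Theory.ler_pdivrMr // -[2]/(2%:R) -natrM Num.Theory.ler_nat; lia.
Qed.

Lemma half_lt (n m : nat) : ((n%:R / 2 : rat) < m%:R)%R = (n./2.+1 <= m)%N.
Proof.
rewrite Num.Theory.ltr_pdivrMr // -[2]/(2%:R) -natrM Num.Theory.ltr_nat; lia.
Qed.

Theorem theorem1p1 (k : fieldType) (char0 : [pchar k] =i pred0)
  (K : closedFieldType) (iota : {rmorphism k -> K}) (d e : nat)
  (f : 'M[K]_(d.+1, e.+1)) (f_neq0 : f != 0) :
  (stable iota f <->
     ~ exists (p : 'rV[K]_2) (m : nat),
         [/\ p != 0, has_multiplicity f p p m
           & (((d + e)%:R / 2 : rat) <= m%:R)%R]) /\
  (semistable iota f <->
     ~ exists (p : 'rV[K]_2) (m : nat),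
         [/\ p != 0, has_multiplicity f p p m
           & (((d + e)%:R / 2 : rat) < m%:R)%R]).
Proof.
have K0 : [pchar K] =i pred0 by move=> p; rewrite (fmorph_pchar iota) char0.
have E T (Q : nat -> bool) : (forall m, Q m = (T <= m)%N) ->
    ~ destab T f <-> ~ exists (p : 'rV[K]_2) (m : nat), [/\ p != 0, has_multiplicity f p p m & Q m].
  move=> EQ; rewrite -(multiplicity_destab T f_neq0).
  by split=> N [p [m [p0 hm Qm]]]; apply: N; exists p, m; split=> //; rewrite ?EQ // -EQ.
split.
  apply: iff_trans (stable_iff iota K0 f_neq0) (E _ (fun m => _) _) => m; exact: half_le.
apply: iff_trans (semistable_iff iota K0 f_neq0) (E _ (fun m => _) _) => m; exact: half_lt.
Qed.
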